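(* There exists a constant $\gamma^*>0$ such that for any $\gamma\in(0,\gamma^* )$, setting $m(x)=e^{\gamma\langle x\rangle}$, there exist a weight function $\widetilde m=\widetilde m(x,v)$ on $\mathbb{R}^d\times\mathcal V$ comparable to $m$ (that is, $c_1e^{\gamma\langle x\rangle}\le\widetilde m(x,v)\le c_2e^{\gamma\langle x\rangle}$ for some constants $0<c_1\le c_2$) and a constant $C\in(0,\infty)$ such that, for every $f_0\in L^1(m)$, the solution $f$ to the linear runs and tumbles equation $\partial_tf=\mathcal Lf$ with initial datum $f_0$ satisfies $$\int_{\mathbb{R}^d\times\mathcal V}|f(t)|\,\widetilde m\,dx\,dv\le\max\Bigl(C\int_{\mathbb{R}^d\times\mathcal V}|f_0|\,dx\,dv,\ \int_{\mathbb{R}^d\times\mathcal V}|f_0|\,\widetilde m\,dx\,dv\Bigr),\qquad\forall\,t\ge0.$$ In particular, the semigroup $S_{\mathcal L}$ is bounded in $L^1(m)$, i.e. $\sup_{t\ge0}\|S_{\mathcal L}(t)\|_{L^1(m)\to L^1(m)}<\infty$.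
   Context: Let $d\ge1$ and $\chi\in(0,1)$. The velocity set is $\mathcal V:=B(0,V_0)\subset\mathbb{R}^d$ with $V_0$ chosen so that $|\mathcal V|=1$, and $K(x,v):=1+\chi\,\mathrm{sign}(x\cdot v)$. We write $\langle x\rangle:=(1+|x|^2)^{1/2}$ and $\|f\|_{L^1(m)}:=\|mf\|_{L^1(\mathbb{R}^d\times\mathcal V)}$. The operator is $$\mathcal Lf(x,v):=-v\cdot\nabla_xf(x,v)+\int_{\mathcal V}\bigl\{K(x,v')f(x,v')-K(x,v)f(x,v)\bigr\}\,dv'.$$ For $f_0\in L^1(m)$ the equation $\partial_tf=\mathcal Lf$, $f(0)=f_0$, has a unique weak (distributional) solution $f\in C([0,\infty);L^1(m))$, and $S_{\mathcal L}(t)f_0:=f(t,\cdot)$ defines a continuous semigroup in $L^1(m)$. *)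

(* Defs.v *)
From HB Require Import structures.
From mathcomp Require Import all_boot all_order all_algebra.
From mathcomp Require Import all_classical all_reals all_analysis.
Set Implicit Arguments.
Unset Strict Implicit.
Unset Printing Implicit Defensive.
Import Order.TTheory GRing.Theory Num.Theory.
Import numFieldNormedType.Exports.
Local Open Scope classical_set_scope.
Local Open Scope ring_scope.

(* 'rV[R]_n carries the sigma-algebra generated by the n coordinate maps, i.e.
   the Borel sigma-algebra of R^n. *)
Section measurable_rV.
Context {R : realType} {n : nat}.

Definition rV_coord (i : 'I_n) (x : 'rV[R]_n) : measurableTypeR R := x ord0 i.

Let rV_set0 : g_sigma_preimage rV_coord set0.
Proof. exact: sigma_algebra0. Qed.

Let rV_setC A : g_sigma_preimage rV_coord A -> g_sigma_preimage rV_coord (~` A).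
Proof. exact: sigma_algebraC. Qed.

Let rV_bigcup (F : (set 'rV[R]_n)^nat) :
  (forall i, g_sigma_preimage rV_coord (F i)) ->
  g_sigma_preimage rV_coord (\bigcup_i (F i)).
Proof. exact: sigma_algebra_bigcup. Qed.

HB.instance Definition _ := @isMeasurable.Build default_measure_display
  'rV[R]_n (g_sigma_preimage rV_coord) rV_set0 rV_setC rV_bigcup.

Lemma measurable_rV_coord (i : 'I_n) : measurable_fun setT (rV_coord i).
Proof.
move=> _ Y mY; rewrite setTI; apply: sub_sigma_algebra => /=.
rewrite -bigcup_seq/=; exists i => /=; first by rewrite mem_index_enum.
by exists Y => //; rewrite setTI.
Qed.

Lemma measurable_fun_rVP d (T : measurableType d) (f : T -> 'rV[R]_n) :
  (forall i, measurable_fun setT (rV_coord i \o f)) -> measurable_fun setT f.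
Proof.
move=> mf.
suff prefS : g_sigma_preimage (fun i => rV_coord i \o f) `<=` measurable.
  move=> _ A mA; rewrite setTI; apply: prefS; rewrite g_sigma_preimage_comp.
  by exists A => //; rewrite setTI.
apply: smallest_sub; first exact: sigma_algebra_measurable.
rewrite -bigcup_seq => A [i _] [B mB <-]; exact: mf.
Qed.

End measurable_rV.

Section lebesgue_rV.
Context {R : realType}.

Definition cons_rV n (p : measurableTypeR R * 'rV[R]_n) : 'rV[R]_n.+1 :=
  \row_i oapp (fun j => p.2 ord0 j) (p.1 : R) (unlift ord0 i).

Definition uncons_rV n (x : 'rV[R]_n.+1) : measurableTypeR R * 'rV[R]_n :=
  (x ord0 ord0, \row_j x ord0 (lift ord0 j)).

Lemma uncons_rVK n : cancel (@uncons_rV n) (@cons_rV n).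
Proof.
move=> x; apply/rowP => i; rewrite !mxE.
by case: unliftP => [j|] -> //=; rewrite mxE.
Qed.

Lemma cons_rVK n : cancel (@cons_rV n) (@uncons_rV n).
Proof.
move=> [t y]; rewrite /uncons_rV !mxE unlift_none /=; congr pair.
by apply/rowP => j; rewrite !mxE liftK.
Qed.

Lemma measurable_cons_rV n : measurable_fun setT (@cons_rV n).
Proof.
apply: measurable_fun_rVP => i.
case: (unliftP ord0 i) => [j|] ->.
- rewrite (_ : _ \o _ = rV_coord j \o snd).
    by apply: measurableT_comp => //; exact: measurable_rV_coord.
  by apply/funext => p; rewrite /= /rV_coord mxE liftK.
- rewrite (_ : _ \o _ = fst) //.
  by apply/funext => p; rewrite /= /rV_coord mxE unlift_none.
Qed.

Lemma measurable_uncons_rV n : measurable_fun setT (@uncons_rV n).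
Proof.
apply/measurable_fun_pairP; split.
  exact: (@measurable_rV_coord _ _ ord0).
apply: measurable_fun_rVP => i.
rewrite (_ : _ \o _ = rV_coord (lift ord0 i)); first exact: measurable_rV_coord.
by apply/funext => x; rewrite /= /rV_coord mxE.
Qed.

Lemma product_sigma_finite d1 d2 (T1 : measurableType d1)
    (T2 : measurableType d2) (m1 : {sigma_finite_measure set T1 -> \bar R})
    (m2 : {sigma_finite_measure set T2 -> \bar R}) :
  sigma_finite setT (m1 \x m2)%E.
Proof.
have /sigma_finiteP[F [TF ndF Foo]] := sigma_finiteT m1.
have /sigma_finiteP[G [TG ndG Goo]] := sigma_finiteT m2.
exists (fun n => F n `*` G n).
  rewrite -setXTT TF TG predeqE => -[x y]; split.
    move=> [/= [n _ Fnx] [k _ Gky]]; exists (maxn n k) => //; split.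
    - by move: x Fnx; exact/subsetPset/ndF/leq_maxl.
    - by move: y Gky; exact/subsetPset/ndG/leq_maxr.
  by move=> [n _ []/= ? ?]; split; exists n.
move=> k; have [? ?] := Foo k; have [? ?] := Goo k.
split; first exact: measurableX.
by rewrite product_measure1E// lte_mul_pinfty// ge0_fin_numE.
Qed.

Section step.
Context n (mu : {sigma_finite_measure set 'rV[R]_n -> \bar R}).

Definition lebesgue_rV_step : set 'rV[R]_n.+1 -> \bar R :=
  pushforward (lebesgue_measure \x mu)%E (@cons_rV n).

Let step0 : lebesgue_rV_step set0 = 0%E.
Proof. by rewrite /lebesgue_rV_step /pushforward preimage_set0 measure0. Qed.

Let step_ge0 A : (0 <= lebesgue_rV_step A)%E.
Proof. exact: (measure_ge0 (lebesgue_measure \x mu)%E). Qed.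

Let step_sigma_additive : semi_sigma_additive lebesgue_rV_step.
Proof.
move=> F mF tF mUF; rewrite /lebesgue_rV_step /pushforward preimage_bigcup.
apply: measure_semi_sigma_additive.
- by move=> k; rewrite -[X in measurable X]setTI; exact: measurable_cons_rV.
- apply/trivIsetP => /= i j _ _ ij; rewrite -preimage_setI.
  by move/trivIsetP : tF => /(_ _ _ _ _ ij) ->//; rewrite preimage_set0.
- rewrite -preimage_bigcup -[X in measurable X]setTI.
  exact: measurable_cons_rV.
Qed.

HB.instance Definition _ := isMeasure.Build _ _ _
  lebesgue_rV_step step0 step_ge0 step_sigma_additive.

Let step_sigma_finite : sigma_finite setT lebesgue_rV_step.
Proof.
have [F FT Ffin] : sigma_finite setT (lebesgue_measure \x mu)%E.
  exact: product_sigma_finite.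
exists (fun k => @uncons_rV n @^-1` F k).
  by rewrite -preimage_bigcup -FT preimage_setT.
move=> k; have [mF Fk] := Ffin k; split.
  by rewrite -[X in measurable X]setTI; exact: measurable_uncons_rV.
rewrite /lebesgue_rV_step /pushforward -comp_preimage.
rewrite (_ : _ \o _ = id) //.
by apply/funext => p /=; rewrite cons_rVK.
Qed.

HB.instance Definition _ := Measure_isSigmaFinite.Build _ _ _
  lebesgue_rV_step step_sigma_finite.

End step.

(* Lebesgue measure on R^n, as the n-fold product of the Lebesgue measure on
   the line. *)
Fixpoint lebesgue_rV n : {sigma_finite_measure set 'rV[R]_n -> \bar R} :=
  match n with
  | 0 => \d_(0 : 'rV[R]_0)
  | k.+1 => lebesgue_rV_step (lebesgue_rV k)
  end.

End lebesgue_rV.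

Section smooth.
Context {R : realType} {W : normedModType R}.

(* On a finite-dimensional W this is the usual class C^k: all iterated
   directional derivatives up to order k exist and are continuous. *)
Fixpoint class_C (k : nat) (phi : W -> R) : Prop :=
  continuous phi /\
  match k with
  | 0 => True
  | j.+1 => forall w : W,
      (forall p, derivable phi p w) /\ class_C j (fun p => 'D_w phi p)
  end.

Definition smooth (phi : W -> R) : Prop := forall k, class_C k phi.

Definition supp (phi : W -> R) : set W := closure [set p | phi p != 0].

End smooth.

Section run_and_tumble.
Context {R : realType} {d : nat}.
Implicit Types (x v : 'rV[R]_d) (chi gamma : R).

(* `|x| is the sup norm on 'rV[R]_d, hence the explicit Euclidean norm. *)
Definition dotp x v : R := \sum_(i < d) x ord0 i * v ord0 i.
Definition enorm x : R := Num.sqrt (dotp x x).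
Definition jap x : R := Num.sqrt (1 + enorm x ^+ 2).

Definition velocities V0 : set 'rV[R]_d := [set v | enorm v < V0].

(* Functions on R^d x V are represented by functions on R^d x R^d of which only
   the restriction to [phase V0] matters. *)
Definition phase V0 : set ('rV[R]_d * 'rV[R]_d) := setT `*` velocities V0.

Definition dxdv : {measure set ('rV[R]_d * 'rV[R]_d) -> \bar R} :=
  (lebesgue_rV d \x lebesgue_rV d)%E.

Definition tumble chi x v : R := 1 + chi * Num.sg (dotp x v).

Definition exp_weight gamma (z : 'rV[R]_d * 'rV[R]_d) : R :=
  expR (gamma * jap z.1).

Implicit Types (m f : 'rV[R]_d * 'rV[R]_d -> R).

Definition L1 V0 m : set ('rV[R]_d * 'rV[R]_d -> R) :=
  [set f | dxdv.-integrable (phase V0) (fun z => (m z * f z)%:E)].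

Definition L1norm V0 m f : \bar R :=
  (\int[dxdv]_(z in phase V0) `|m z * f z|%:E)%E.

Definition collision chi V0 f (z : 'rV[R]_d * 'rV[R]_d) : R :=
  \int[lebesgue_rV d]_(v' in velocities V0)
     (tumble chi z.1 v' * f (z.1, v') - tumble chi z.1 z.2 * f z).

Local Notation txv := (R * ('rV[R]_d * 'rV[R]_d))%type.

Definition dt (phi : txv -> R) (p : txv) : R := 'D_((1, (0, 0)) : txv) phi p.

Definition v_grad_x (phi : txv -> R) (p : txv) : R :=
  \sum_(i < d) p.2.2 ord0 i * 'D_((0, (delta_mx ord0 i, 0)) : txv) phi p.

Definition test_function V0 (phi : txv -> R) : Prop :=
  [/\ smooth phi, compact (supp phi) &
      supp phi `<=` [set p | 0 < p.1 /\ phase V0 p.2]].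

(* d_t f = L f in the sense of distributions on (0, +oo) x R^d x V: the
   derivatives in t and x are moved onto the test function, the integral part
   of L is kept on f.  The time integral is iterated outside of the phase space
   integral, so no joint measurability in (t, x, v) of the representatives f(t)
   is required.  Values of f at negative times are irrelevant. *)
Record weak_solution chi V0 m (f0 : 'rV[R]_d * 'rV[R]_d -> R)
    (f : R -> 'rV[R]_d * 'rV[R]_d -> R) : Prop := WeakSolution {
  sol_L1 : forall t : R, 0 <= t -> L1 V0 m (f t) ;
  sol_continuous : forall t : R, 0 <= t ->
    L1norm V0 m (f s \- f t) @[s --> within [set s : R | 0 <= s] (nbhs t)]
      --> 0%E ;
  sol_init : {ae dxdv, forall z, phase V0 z -> f 0 z = f0 z} ;
  sol_eq : forall phi, test_function V0 phi ->
    \int[lebesgue_measure]_(t in `]0, +oo[)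
      \int[dxdv]_(z in phase V0)
        (f t z * (dt phi (t, z) + v_grad_x phi (t, z))
         + collision chi V0 (f t) z * phi (t, z)) = 0 }.

(* S_L(t) f0 := f(t) with f the solution in C([0, +oo); L^1(m)) issued from f0.
   At each time the solution is unique up to a null set; [xget] selects a
   representative (its default value 0 is never used, a solution existing for
   every f0 in L^1(m)). *)
Definition S_L chi V0 m (t : R) (f0 : 'rV[R]_d * 'rV[R]_d -> R) :
    'rV[R]_d * 'rV[R]_d -> R :=
  xget (fun=> cst 0) [set f | weak_solution chi V0 m f0 f] t.

Definition opnorm V0 m
    (T : ('rV[R]_d * 'rV[R]_d -> R) -> 'rV[R]_d * 'rV[R]_d -> R) : \bar R :=
  ereal_sup [set L1norm V0 m (T g) | g in
    [set g | L1 V0 m g /\ (L1norm V0 m g <= 1)%E]].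

End run_and_tumble.

(* Main.v *)
(* The collision operator is f |-> G f - 2 f with G positive, since the tumbling
   rate 1 + chi sign(x . v) is at most 2.  Testing the equation with
   theta(t) psi(x - t v, v), where psi is smooth and theta arbitrary, the du
   Bois-Reymond lemma turns the weak formulation into Duhamel's formula for the
   pairing of f with transported test functions, which extends to all bounded
   measurable psi by a monotone class argument.  Choosing psi so that transport
   carries it at time s + h to sgn f(s + h) min(w, n) gives, for n -> oo and then
   h -> 0, a one-sided differential inequality for N(t) = int |f(t)| w dx dv:
   N' <= int |f| L* w.
   For w = 1 the mass is nonincreasing.  For w = e^(gamma <x>) (1 + gamma tilt),
   where the tilt is (x . v - (chi / 2) |x . v|) / <x>, one has L* w <= - a w + b,
   so N decreases as long as it exceeds (b / a) times the initial mass. *)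
Require Import Defs.
From mathcomp Require Import all_boot all_order all_algebra.
From mathcomp Require Import all_classical all_reals all_analysis.
From mathcomp Require Import measurable_realfun.
From mathcomp Require Import ring lra.
Set Implicit Arguments.
Unset Strict Implicit.
Unset Printing Implicit Defensive.
Import Order.TTheory GRing.Theory Num.Theory.
Import numFieldNormedType.Exports.
Import HBNNSimple.
Local Open Scope classical_set_scope.
Local Open Scope ring_scope.

(** The obstacle is that f is only a weak solution: there is no equation for |f|, f need not be
    differentiable along characteristics, and sgn f is not an admissible test function. Duality
    circumvents this: |f(s + h)| is f(s + h) times a measurable function of modulus at most 1, that
    function is pulled back along the free flow, and Duhamel's formula compares the times s and s +
    h. This is why the formula has to reach all bounded measurable functions, starting from smooth
    ones built out of e^(-1/x). The shift by 2 serves the sign: with a positive gain, a bound |phi|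
    <= k w on the pulled back function passes to its adjoint gain, whatever the signs of f are. The
    pull-back evaluates w at x + h v, so that only an upper bound on the difference quotients of w
    enters. The decay of the weight at infinity rests on one geometric fact, that the mean of |x .
    v| over the ball is at least A |x| with A > 0; [gamma] must be small compared with (1 - chi)
    (chi / 2) A for the errors of second order in [gamma] to be absorbed. *)

Section Rintegrable.
Context d (T : measurableType d) (R : realType) (mu : {measure set T -> \bar R}).
Context (D : set T) (mD : measurable D).
Implicit Types f g h : T -> R.
Local Notation I f := (mu.-integrable D (EFin \o f)).

Lemma Rintegrable_measurable f : I f -> measurable_fun D f.
Proof. by move=> /integrableP[/measurable_EFinP]. Qed.

Lemma RintegrableZ (c : R) f : I f -> I (fun x => c * f x).
Proof. by move=> fi; apply: eq_integrable (integrableZl mD c fi). Qed.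

Lemma RintegrableD f g : I f -> I g -> I (fun x => f x + g x).
Proof. by move=> fi gi; apply: eq_integrable (integrableD mD fi gi). Qed.

Lemma RintegrableB f g : I f -> I g -> I (fun x => f x - g x).
Proof. by move=> fi gi; apply: eq_integrable (integrableB mD fi gi). Qed.

Lemma Rintegrable_norm f : I f -> I (fun x => `|f x|).
Proof. exact: integrable_norm. Qed.

Lemma le_Rintegrable f g : measurable_fun D f -> (forall x, D x -> `|f x| <= g x) ->
  I g -> I f.
Proof.
move=> mf fg; apply: le_integrable => //; first exact/measurable_EFinP.
by move=> x Dx /=; rewrite lee_fin (le_trans (fg x Dx))// ler_norm.
Qed.

Lemma RintegrableM f h (c : R) : I f -> measurable_fun D h ->
  (forall x, D x -> `|h x| <= c) -> I (fun x => f x * h x).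
Proof.
move=> fi mh hc; apply: (@le_Rintegrable _ (fun x => c * `|f x|)).
- by apply: measurable_funM => //; exact: Rintegrable_measurable.
- by move=> x Dx; rewrite normrM mulrC ler_wpM2r// hc.
- exact/RintegrableZ/Rintegrable_norm.
Qed.

Lemma Rintegrable_fin f : I f -> (\int[mu]_(x in D) (f x)%:E)%E = (\int[mu]_(x in D) f x)%:E.
Proof. by move=> fi; rewrite fineK//; exact: integrable_fin_num. Qed.

End Rintegrable.

(** * Smooth functions *)
Section smooth_calculus.
Context {R : realType}.

(** Reduces directional derivatives to one real variable, where the chain rule [is_derive1_comp] is
    available. *)
Lemma is_derive_lineP (W : normedModType R) (phi : W -> R) (p w : W) (l : R) :
  is_derive p w phi l <-> is_derive (0 : R) (1 : R) (fun h : R => phi (h *: w + p)) l.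
Proof.
have E : 'D_w phi p = 'D_1 (fun h : R => phi (h *: w + p)) 0.
  rewrite /derive; set g1 := fun h => h^-1 *: _; set g2 := fun h => h^-1 *: _.
  suff -> : g1 = g2 by [].
  by apply/funext => h; rewrite /g1 /g2/= addr0 scale0r add0r [_%:A]mulr1.
split=> [[dphi vphi]|[dphi vphi]].
- by apply: (DeriveDef ((derivable1P _ _ _).1 dphi)); rewrite -E.
- by apply: (DeriveDef ((derivable1P _ _ _).2 dphi)); rewrite E.
Qed.

Lemma is_derive1_affine (a b x : R) : is_derive x (1 : R) (fun h : R => h * a + b) a.
Proof.
have := is_deriveD (is_deriveM (is_derive_id x (1 : R)) (is_derive_cst a x (1 : R)))
  (is_derive_cst b x (1 : R)).
by rewrite /= scaler0 add0r addr0 [_%:A]mulr1.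
Qed.

Lemma is_derive1_line (g : R -> R) (x w l : R) :
  is_derive x 1 g l -> is_derive x w g (w * l).
Proof.
move=> dg; apply/is_derive_lineP.
have dg' : is_derive (0 *: w + x) (1 : R) g l by rewrite scale0r add0r.
have dl : is_derive (0 : R) (1 : R) (fun h : R => h *: w + x) w.
  exact: is_derive1_affine.
by rewrite mulrC; exact: (@is_derive1_comp _ g (fun h : R => h *: w + x) 0 _ _ dg' dl).
Qed.

Lemma is_derive_comp (W : normedModType R) (g : R -> R) (phi : W -> R)
    (p w : W) (a b : R) :
  is_derive p w phi a -> is_derive (phi p) 1 g b ->
  is_derive p w (g \o phi) (b * a).
Proof.
move=> /is_derive_lineP dphi dg; apply/is_derive_lineP.
have dg' : is_derive (phi (0 *: w + p)) (1 : R) g b by rewrite scale0r add0r.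
exact: (@is_derive1_comp _ g (fun h : R => phi (h *: w + p)) 0 _ _ dg' dphi).
Qed.

Context {W : normedModType R}.
Implicit Types phi psi : W -> R.

Lemma class_CW k phi : class_C k.+1 phi -> class_C k phi.
Proof.
elim: k phi => [|k IH] phi [cphi dphi]; split=> // w.
by have [? ?] := dphi w; split=> //; exact: IH.
Qed.

Lemma class_C_cst k (c : R) : class_C k (cst c : W -> R).
Proof.
elim: k c => [|k IH] c; split=> //; try by move=> ?; exact: cst_continuous.
move=> w; split=> [p|]; first exact: derivable_cst.
rewrite (_ : (fun _ => _) = cst 0) //.
by apply/funext => p; rewrite derive_cst.
Qed.

Lemma class_CD k phi psi : class_C k phi -> class_C k psi ->
  class_C k (fun p => phi p + psi p).
Proof.
elim: k phi psi => [|k IH] phi psi [cphi dphi] [cpsi dpsi]; split=> //;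
  try by move=> p; apply: cvgD; [exact: cphi|exact: cpsi].
move=> w; have [d1 d1'] := dphi w; have [d2 d2'] := dpsi w; split.
  by move=> p; exact: (derivableD (d1 p) (d2 p)).
rewrite (_ : (fun _ => _) = (fun p => 'D_w phi p + 'D_w psi p)); first by apply: IH.
by apply/funext => p; rewrite -deriveD.
Qed.

Lemma class_CM k phi psi : class_C k phi -> class_C k psi ->
  class_C k (fun p => phi p * psi p).
Proof.
elim: k phi psi => [|k IH] phi psi.
  by move=> [cphi _] [cpsi _]; split=> // p; apply: cvgM; [exact: cphi|exact: cpsi].
move=> Cphi Cpsi; have [cphi dphi] := Cphi; have [cpsi dpsi] := Cpsi; split.
  by move=> p; apply: cvgM; [exact: cphi|exact: cpsi].
move=> w; have [d1 d1'] := dphi w; have [d2 d2'] := dpsi w; split.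
  by move=> p; exact: (derivableM (d1 p) (d2 p)).
rewrite (_ : (fun _ => _) =
  (fun p => phi p * 'D_w psi p + psi p * 'D_w phi p)); last first.
  by apply/funext => p; rewrite (_ : (fun p => phi p * psi p) = phi * psi)// deriveM.
by apply: class_CD; apply: IH => //; exact: class_CW.
Qed.

Lemma smoothP phi : smooth phi <->
  continuous phi /\ forall w, (forall p, derivable phi p w) /\ smooth ('D_w phi).
Proof.
split=> [sphi|[cphi dphi] [|k]].
- split; first by have [] := sphi 0%N.
  move=> w; split; first by have [_ /(_ w)[]] := sphi 1%N.
  by move=> k; have [_ /(_ w)[]] := sphi k.+1.
- by split.
- by split=> // w; have [? ?] := dphi w; split.
Qed.

Lemma smooth_cst (c : R) : smooth (cst c : W -> R).
Proof. by move=> k; exact: class_C_cst. Qed.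

Lemma smoothD phi psi : smooth phi -> smooth psi -> smooth (fun p => phi p + psi p).
Proof. by move=> sphi spsi k; exact: class_CD. Qed.

Lemma smoothM phi psi : smooth phi -> smooth psi -> smooth (fun p => phi p * psi p).
Proof. by move=> sphi spsi k; exact: class_CM. Qed.

Lemma smooth_sum (I : Type) (r : seq I) (F : I -> W -> R) :
  (forall i, smooth (F i)) -> smooth (fun p => \sum_(i <- r) F i p).
Proof.
move=> sF; elim: r => [|i r IH].
  by under eq_fun do rewrite big_nil; exact: smooth_cst.
by under eq_fun do rewrite big_cons; exact: smoothD.
Qed.

Lemma smooth_continuous phi : smooth phi -> continuous phi.
Proof. by move=> /(_ 0%N) []. Qed.

Lemma smooth_derivable phi p w : smooth phi -> is_derive p w phi ('D_w phi p).
Proof. by move=> /smoothP[_ /(_ w)[dphi _]]; exact: DeriveDef. Qed.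

(** The derivative in direction w is the constant phi w, so all further derivatives are constants
    too. *)
Lemma smooth_linear phi : continuous phi ->
  (forall p w h, phi (h *: w + p) = h * phi w + phi p) -> smooth phi.
Proof.
move=> cphi lphi.
have dphi w p : is_derive p w phi (phi w).
  by apply/is_derive_lineP; under eq_fun do rewrite lphi; exact: is_derive1_affine.
apply/smoothP; split=> // w; split=> [p|]; first by have [] := dphi w p.
rewrite (_ : (fun _ => _) = cst (phi w)); first exact: smooth_cst.
by apply/funext => p; have [_] := dphi w p.
Qed.

End smooth_calculus.

(** The induction on the order generalises g, since the chain rule produces ['D_1 g] composed with
    phi. *)
Lemma smooth_comp (R : realType) (W : normedModType R) (g : R -> R) (phi : W -> R) : smooth g -> smooth phi -> smooth (g \o phi).
Proof.
move=> sg sphi k; elim: k g sg phi sphi => [|k IH] g sg phi sphi.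
  split=> // p; apply: continuous_comp.
    exact: smooth_continuous.
  exact: (smooth_continuous sg).
split.
  move=> p; apply: continuous_comp.
    exact: smooth_continuous.
  exact: (smooth_continuous sg).
move=> w; have D p : is_derive p w (g \o phi) ('D_1 g (phi p) * 'D_w phi p).
  by apply: is_derive_comp; exact: smooth_derivable.
split=> [p|]; first by have [] := D p.
rewrite (_ : (fun _ => _) = (fun p => ('D_1 g \o phi) p * 'D_w phi p)); last first.
  by apply/funext => p; have [_] := D p.
apply: class_CM; last by have /smoothP[_ /(_ w)[_]] := sphi; exact.
by apply: IH => //; have /smoothP[_ /(_ 1)[_]] := sg.
Qed.

(** * Smooth functions of one variable that are flat at 0 *)

Section smooth_real.
Context {R : realType}.

(** A family stable under differentiation is smooth by induction on the order. The scalar c in the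
    induction absorbs the factor w of the derivative in direction w. *)
Lemma smooth_ind (P : (R -> R) -> Prop) :
  (forall g, P g -> exists2 g', P g' & forall x : R, is_derive x (1 : R) g (g' x)) ->
  forall g, P g -> smooth g.
Proof.
move=> HP; suff H k : forall (c : R) g, P g -> class_C k (fun x : R => c * g x).
  by move=> g Pg k; have := H k 1 _ Pg; under eq_fun do rewrite mul1r.
have cont (c : R) g : P g -> continuous (fun x : R => c * g x).
  move=> Pg x; apply: cvgM; first exact: cvg_cst.
  have [g' _ /(_ x)[dg _]] := HP _ Pg.
  by apply: differentiable_continuous; exact/derivable1_diffP.
elim: k => [|k IH] c g Pg; split=> //; try exact: cont.
have [g' Pg' dg] := HP _ Pg => w.
have D (x : R) : is_derive x w (fun x : R => c * g x) (c * (w * g' x)).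
  have := is_deriveM (is_derive_cst c x w) (is_derive1_line w (dg x)).
  by rewrite /= scaler0 addr0.
split=> [x|]; first by have [] := D x.
rewrite (_ : (fun p => 'D_w _ p) = (fun x : R => c * w * g' x)); first exact: IH.
by apply/funext => x; have [_ ->] := D x; rewrite mulrA.
Qed.

Lemma smooth_expR : smooth (@expR R).
Proof.
apply: (@smooth_ind (fun g => g = @expR R)) => // g ->.
by exists expR => // x; exact: is_derive_expR.
Qed.

(** The polynomial parameter makes the family stable under differentiation: with y = 1/x, the
    derivative of p(y) e^(-y) in x is y^2 (p - p')(y) e^(-y). *)
Definition flat (p : {poly R}) (x : R) : R :=
  if 0 < x then p.[x^-1] * expR (- x^-1) else 0.

(** Monomial by monomial, from y^i / i! <= e^y. *)
Lemma horner_le_expR (p : {poly R}) :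
  exists2 C : R, 0 <= C & forall y, 0 <= y -> `|p.[y]| <= C * expR y.
Proof.
exists (\sum_(i < size p) `|p`_i| * i`!%:R); first by apply: sumr_ge0 => i _; rewrite mulr_ge0.
move=> y y0; rewrite horner_coef mulr_suml (le_trans (ler_norm_sum _ _ _))//.
apply: ler_sum => i _; rewrite normrM -mulrA ler_wpM2l//.
rewrite ger0_norm ?exprn_ge0//; case: (nat_of_ord i) => [|n].
  by rewrite expr0 fact0 mul1r; have := expR_ge1Dx y; lra.
have h := expR_ge1Dxn n y0.
rewrite mulrC -ler_pdivrMr ?ltr0n ?fact_gt0//.
by apply: le_trans h; rewrite lerDr.
Qed.

(** The bound |q(y)| <= C e^y for q = X^2 p, read at y = 1/x. Quadratic decay is what gives the
    derivative 0 at the origin. *)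
Lemma flat_le_sqr (p : {poly R}) :
  exists2 C : R, 0 <= C & forall x, `|flat p x| <= C * x ^+ 2.
Proof.
have [C C0 hC] := horner_le_expR ('X^2 * p); exists C => // x.
rewrite /flat; case: ifPn => x0; last by rewrite normr0 mulr_ge0// sqr_ge0.
have y0 : 0 < x^-1 by rewrite invr_gt0.
have := hC _ (ltW y0); rewrite hornerM hornerXn normrM (ger0_norm (exprn_ge0 _ (ltW y0))).
rewrite normrM (ger0_norm (expR_ge0 _)) expRN => h.
rewrite ler_pdivrMr ?expR_gt0//.
have e : x ^+ 2 * x^-1 ^+ 2 = 1 by rewrite -exprMn divff ?expr1n ?gt_eqF.
have := ler_wpM2l (sqr_ge0 x) h; rewrite mulrA e mul1r => /le_trans -> //.
by rewrite mulrCA mulrA.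
Qed.

Lemma is_derive_flat (p : {poly R}) (x : R) :
  is_derive x (1 : R) (flat p) (flat ('X^2 * (p - p^`())) x).
Proof.
have [x0|x0|->] := ltgtP x 0.
- rewrite {2}/flat ltNge (ltW x0)/=.
  apply: (@near_eq_is_derive _ _ _ (cst 0)).
  near=> z; rewrite /flat ltNge; suff -> : z <= 0 by [].
  by apply/ltW; near: z; exact: lt_nbhsl.
- rewrite {2}/flat x0.
  have E : \near x, p.[x^-1] * expR (- x^-1) = flat p x.
    near=> z; rewrite /flat; suff -> : 0 < z by [].
    by near: z; exact: lt_nbhsr.
  have dV : is_derive x (1 : R) (fun z : R => z^-1) (- x ^- 2).
    have := is_deriveV (lt0r_neq0 x0) (is_derive_id x (1 : R)).
    by rewrite [_ *: _]mulr1.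
  have dp := @is_derive1_comp _ (horner p) _ _ _ _ (is_derive_poly p x^-1) dV.
  have de := @is_derive1_comp _ expR (fun z => - z^-1) _ _ _ (is_derive_expR (- x^-1)) (is_deriveN dV).
  apply: (near_eq_is_derive E); apply: (is_derive_eq (is_deriveM dp de)).
  rewrite !hornerE/= /GRing.scale/= exprVn; ring.
(* At the origin the difference quotient is at most C |h|. *)
- rewrite {2}/flat ltxx.
  have [C C0 hC] := flat_le_sqr p.
  have L : (h^-1 *: ((flat p \o shift 0) (h *: (1 : R)) - flat p 0)) @[h --> 0^'] --> (0 : R).
    apply/cvgrPdist_le => e e0; near=> h.
    rewrite sub0r normrN /= addr0 [_%:A]mulr1 {2}/flat ltxx subr0.
    have h0 : h != 0 by near: h; exact: nbhs_dnbhs_neq.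
    rewrite [_ *: _]mulrC normrM normfV ler_pdivrMr ?normr_gt0//.
    rewrite (le_trans (hC _))// -real_normK ?num_real// expr2 mulrA ler_wpM2r//.
    have : `|h| <= e / (C + 1).
      near: h; apply: dnbhs0_le; rewrite divr_gt0//; lra.
    rewrite ler_pdivlMr; last lra.
    by apply: le_trans; rewrite mulrC ler_wpM2l//; lra.
  by apply: DeriveDef; [apply/cvg_ex; exists 0; exact: L|exact: cvg_lim].
Unshelve. all: by end_near. Qed.

Lemma smooth_flat (p : {poly R}) : smooth (flat p).
Proof.
apply: (@smooth_ind (fun g => exists p, g = flat p)); last by exists p.
move=> _ [q ->]; exists (flat ('X^2 * (q - q^`()))); first by eexists.
exact: is_derive_flat.
Qed.

End smooth_real.

(** * The du Bois-Reymond lemma *)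
Section du_bois_reymond.
Context {R : realType}.
Local Notation mu := (@lebesgue_measure R).
Implicit Types F G g : R -> R.

Lemma continuous_integrable_itv g (a b : R) : continuous g ->
  mu.-integrable `[a, b] (EFin \o g).
Proof.
move=> cg; apply: continuous_compact_integrable; first exact: segment_compact.
exact: continuous_subspaceT.
Qed.

Lemma is_derive_primitive g (a x : R) : continuous g -> a < x ->
  is_derive x (1 : R) (fun x => \int[mu]_(t in `[a, x]) g t) (g x).
Proof.
move=> cg ax; have [dF vF] := @continuous_FTC1_closed R g a x (x + 1) (ltac:(lra))
  (continuous_integrable_itv _ _ cg) ax (cg x).
by apply: DeriveDef; [exact: dF|rewrite -derive1E; exact: vF].
Qed.

Lemma Rintegral_FTC2 g F (a b : R) : a < b ->
  (forall x, a <= x <= b -> {for x, continuous g}) ->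
  (forall x, a <= x <= b -> is_derive x (1 : R) F (g x)) ->
  mu.-integrable `[a, b] (EFin \o g) /\ \int[mu]_(x in `[a, b]) g x = F b - F a.
Proof.
move=> ab cg dF.
have cg' : {within `[a, b], continuous g}.
  by apply: continuous_in_subspaceT => x; rewrite inE/= in_itv/=; exact: cg.
split; first by apply: continuous_compact_integrable; first exact: segment_compact.
have cF x : a <= x <= b -> {for x, continuous F}.
  move=> /dF [dFx _]; apply: differentiable_continuous; exact/derivable1_diffP.
rewrite /Rintegral (@continuous_FTC2 _ g F a b ab) //.
- split.
  + by move=> x /[!in_itv]/= /andP[ax xb]; have [] := dF x; rewrite ?(ltW ax) ?(ltW xb).
  + by apply: cvg_at_right_filter; apply: cF; rewrite lexx ltW.
  + by apply: cvg_at_left_filter; apply: cF; rewrite lexx ltW.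
- move=> x /[!in_itv]/= /andP[ax xb]; rewrite derive1E.
  by have [] := dF x; rewrite ?(ltW ax) ?(ltW xb).
Qed.

Lemma is_derive1_shift g (x c l : R) : is_derive (x - c) (1 : R) g l ->
  is_derive x (1 : R) (fun y => g (y - c)) l.
Proof.
move=> dg; have ds : is_derive x (1 : R) (fun y : R => y - c) 1.
  have := is_derive1_affine 1 (- c) x.
  by under eq_fun do rewrite mulr1.
by have := @is_derive1_comp _ g (fun y : R => y - c) x _ _ dg ds; rewrite mulr1.
Qed.

Definition bump (r x : R) : R := flat 1 x * flat 1 (r - x).

Lemma flat1_ge0 (x : R) : 0 <= flat 1 x.
Proof. by rewrite /flat; case: ifP => // _; rewrite hornerE mul1r expR_ge0. Qed.

Lemma flat1_gt0 (x : R) : 0 < x -> 0 < flat 1 x.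
Proof. by move=> x0; rewrite /flat x0 hornerE mul1r expR_gt0. Qed.

Lemma flat1_eq0 (x : R) : x <= 0 -> flat 1 x = 0.
Proof. by move=> x0; rewrite /flat ltNge x0. Qed.

Lemma smooth_affine (a b : R) : smooth (fun x : R => a * x + b).
Proof.
apply: smoothD; last exact: smooth_cst.
apply: smooth_linear; first by move=> x; apply: cvgM; [exact: cvg_cst|exact: cvg_id].
by move=> p w h; rewrite mulrDr [h *: w](_ : _ = h * w)// mulrCA.
Qed.

Lemma smooth_bump (r : R) : smooth (bump r).
Proof.
apply: smoothM; first exact: smooth_flat.
rewrite (_ : (fun x => flat 1 (r - x)) = flat 1 \o (fun x : R => -1 * x + r)).
  by apply: smooth_comp; [exact: smooth_flat|exact: smooth_affine].
by apply/funext => x /=; congr flat; ring.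
Qed.

Lemma bump_ge0 (r x : R) : 0 <= bump r x.
Proof. by rewrite mulr_ge0 ?flat1_ge0. Qed.

Lemma bump_eq0 (r x : R) : (x <= 0) || (r <= x) -> bump r x = 0.
Proof.
rewrite /bump => /orP[x0|rx]; first by rewrite flat1_eq0 ?mul0r.
by rewrite (@flat1_eq0 (r - x)) ?mulr0// subr_le0.
Qed.

Lemma bump_gt0 (r x : R) : 0 < x < r -> 0 < bump r x.
Proof. by move=> /andP[x0 xr]; rewrite mulr_gt0 ?flat1_gt0 ?subr_gt0. Qed.

(** A smooth transition from 0 to a positive constant; differences of its translates are smoothed
    indicators of intervals. *)
Lemma bump_primitive (r : R) : 0 < r -> exists E : R -> R,
  [/\ forall x, is_derive x (1 : R) E (bump r x),
      forall x, x <= 0 -> E x = 0,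
      forall x, r <= x -> E x = E r & 0 < E r].
Proof.
move=> r0; have cb := smooth_continuous (smooth_bump r).
(* [is_derive_primitive] only differentiates to the right of the base point; the base point -1
   covers a neighbourhood of 0, and E is locally 0 further left. *)
pose F x := \int[mu]_(t in `[-1, x]) bump r t.
pose E x := if x <= 0 then 0 else F x.
have F0 x : x <= 0 -> F x = 0.
  move=> x0; rewrite /F (@eq_Rintegral _ _ _ _ _ (cst 0)) ?Rintegral_cst ?mul0r//.
  move=> y; rewrite inE/= in_itv/= => /andP[_ yx].
  by rewrite bump_eq0// (le_trans yx x0).
have dE x : is_derive x (1 : R) E (bump r x).
  have [x1|x1] := ltP (-1) x.
    have EF : \near x, F x = E x.
      by near=> z; rewrite /E; case: ifP => // /F0.
    exact: (near_eq_is_derive EF (is_derive_primitive cb x1)).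
  have EF : \near x, cst 0 x = E x.
    near=> z; rewrite /E; suff -> : z <= 0 by [].
    near: z; apply: lt_le_nbhsl; lra.
  rewrite bump_eq0; last by apply/orP; left; lra.
  exact: (near_eq_is_derive EF).
have cE x : {for x, continuous E}.
  by have [dEx _] := dE x; apply: differentiable_continuous; exact/derivable1_diffP.
have mvt (a b : R) : a < b -> exists2 c, a < c < b & E b - E a = bump r c * (b - a).
  move=> ab; have [|c] := @MVT R E (bump r) a b ab (fun c _ => dE c).
  - exact: continuous_subspaceT.
  - by rewrite in_itv/= => abc h; exists c.
exists E; split=> //.
- by move=> x x0; rewrite /E x0.
- move=> x; rewrite le_eqVlt => /predU1P[->//|rx].
  have [c /andP[rc _]] := mvt _ _ rx; rewrite bump_eq0 ?mul0r; first by move/subr0_eq.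
  by rewrite (ltW rc) orbT.
- have [c /andP[c0 cr]] := mvt _ _ r0; rewrite {2}/E lexx subr0 => ->.
  by rewrite subr0 mulr_gt0// bump_gt0// c0.
Unshelve. all: by end_near. Qed.

Definition compact_in_pos (theta : R -> R) := exists a b : R,
  [/\ 0 < a, a < b & forall x, ~~ (a <= x <= b) -> theta x = 0].

(** F' = G weakly on ]0, +oo[. With A a primitive of G, the function K = F - A has weak derivative
    0; a rise of K between s and t would be detected by a test function. *)
Lemma du_bois_reymond_le F G : continuous F -> continuous G ->
  (forall theta, smooth theta -> compact_in_pos theta ->
    \int[mu]_(t in `]0, +oo[) ('D_1 theta t * F t + theta t * G t) = 0) ->
  forall s t, 0 < s -> s < t -> F t - F s <= \int[mu]_(r in `[s, t]) G r.
Proof.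
move=> cF cG H s t s0 st; rewrite leNgt; apply/negP => lt.
(* A base point strictly below s, so that A is differentiable at s itself. *)
pose al := s / 2; have al0 : 0 < al by rewrite /al; lra.
have als : al < s by rewrite /al; lra.
pose A x := \int[mu]_(r in `[al, x]) G r.
have dA x : al < x -> is_derive x (1 : R) A (G x).
  exact: is_derive_primitive.
have AE : \int[mu]_(r in `[s, t]) G r = A t - A s.
  apply: (Rintegral_FTC2 st _ _).2 => x /andP[sx _]; first exact: cG.
  by apply: dA; rewrite (lt_le_trans als).
pose K x := F x - A x.
have cA x : al < x -> {for x, continuous A}.
  by move=> /dA[dAx _]; apply: differentiable_continuous; exact/derivable1_diffP.
have cK x : al < x -> {for x, continuous K}.
  by move=> /cA cAx; apply: cvgB => //; exact: cF.
have Kst : K s < K t by rewrite AE in lt; rewrite /K; lra.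
pose e := (K t - K s) / 3; have e0 : 0 < e by rewrite /e; lra.
(* With e a third of the rise, the values of K just after s and just after t stay separated by e. *)
have [r [r0 Ks Kt]] : exists r, [/\ 0 < r,
    forall x, s <= x <= s + r -> K x <= K s + e &
    forall x, t <= x <= t + r -> K t - e <= K x].
  have /cvgrPdist_le/(_ e e0)[d1 /= d10 h1] := cK s als.
  have /cvgrPdist_le/(_ e e0)[d2 /= d20 h2] := cK t (lt_trans als st).
  pose m := Num.min d1 d2.
  have m0 : 0 < m by rewrite lt_min d10.
  have md1 : m <= d1 by rewrite ge_min lexx.
  have md2 : m <= d2 by rewrite ge_min lexx orbT.
  exists (m / 2); rewrite divr_gt0//; split=> // x /andP[x1 x2].
    have x3 : `|s - x| < d1 by rewrite ltr_distl; lra.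
    by move: (h1 x x3); rewrite /= ler_distl; clear; lra.
  have x3 : `|t - x| < d2 by rewrite ltr_distl; lra.
  by move: (h2 x x3); rewrite /= ler_distl; clear; lra.
(* The test function is a smoothed indicator of [s, t]; its derivative averages
   K = F - A just after s and subtracts an average of K just after t. *)
have [E [dE E0 Er Er0]] := bump_primitive r0.
have cb := smooth_continuous (smooth_bump r).
pose theta x := E (x - s) - E (x - t).
pose dth x := bump r (x - s) - bump r (x - t).
have dtheta x : is_derive x (1 : R) theta (dth x).
  by apply: is_deriveB; apply: is_derive1_shift; exact: dE.
have cbs c : continuous (fun x => bump r (x - c)).
  move=> x; apply: (@continuous_comp _ _ _ (fun y : R => y - c) (bump r)); last exact: cb.
  by apply: cvgB; [exact: cvg_id|exact: cvg_cst].
have cdth : continuous dth by move=> x; apply: cvgB; exact: cbs.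
have sdth : smooth dth.
  have sb c : smooth (fun x => bump r (x - c)).
    rewrite (_ : (fun x => _) = bump r \o (fun x : R => 1 * x + (- c))).
      by apply: smooth_comp; [exact: smooth_bump|exact: smooth_affine].
    by apply/funext => x /=; rewrite mul1r.
  rewrite (_ : dth = fun x => bump r (x - s) + (-1) * bump r (x - t)).
    by apply: smoothD => //; apply: smoothM => //; exact: smooth_cst.
  by apply/funext => x; rewrite mulN1r.
have Dth w x : 'D_w theta x = w * dth x by have [] := is_derive1_line w (dtheta x).
have stheta : smooth theta.
  apply/smoothP; split.
    move=> x; have [dx _] := dtheta x.
    by apply: differentiable_continuous; exact/derivable1_diffP.
  move=> w; split=> [x|]; first by have [] := is_derive1_line w (dtheta x).
  rewrite (_ : 'D_w theta = (fun x : R => w * dth x)); last first.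
    by apply/funext => x; exact: Dth.
  by apply: smoothM => //; exact: smooth_cst.
have th0 x : ~~ (s <= x <= t + r) -> theta x = 0.
  rewrite /theta negb_and -!ltNge => /orP[xs|xt].
    by rewrite !E0 ?subrr//; lra.
  by rewrite [E (x - s)]Er ?[E (x - t)]Er ?subrr//; lra.
have dth0 x : ~~ (s <= x <= t + r) -> dth x = 0.
  rewrite /dth negb_and -!ltNge => /orP[xs|xt].
    by rewrite !bump_eq0 ?subrr//; apply/orP; left; lra.
  by rewrite !bump_eq0 ?subrr//; apply/orP; right; lra.
pose b := t + r; have sb : s < b by rewrite /b; lra.
have ctheta := smooth_continuous stheta.
have := H theta stheta (ex_intro _ s (ex_intro _ b (And3 s0 sb th0))).
have -> : \int[mu]_(t in `]0, +oo[) ('D_1 theta t * F t + theta t * G t) =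
          \int[mu]_(t in `[s, b]) (dth t * F t + theta t * G t).
  rewrite Rintegral_mkcond [RHS]Rintegral_mkcond; congr (Rintegral _ _ _).
  apply/funext => x; rewrite !patchE !mem_setE !in_itv/= andbT Dth mul1r.
  case: (boolP (s <= x <= b)) => [/andP[sx xb]|xsb]; first by rewrite (lt_le_trans s0).
  by rewrite th0// dth0// !mul0r addr0 if_same.
have thb : theta b = 0.
  by rewrite /theta [E (b - s)]Er ?[E (b - t)]Er ?subrr// /b; lra.
have ths : theta s = 0 by rewrite /theta !E0 ?subrr//; lra.
have sal x : s <= x <= b -> al < x by move=> /andP[sx _]; exact: lt_le_trans sx.
(* The integrand is the derivative of theta A, which vanishes at both ends. Subtracting this from
   the hypothesis leaves the integral of dth K equal to 0. *)
have [iA zA] : mu.-integrable `[s, b] (EFin \o (fun t => dth t * A t + theta t * G t)) /\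
    \int[mu]_(t in `[s, b]) (dth t * A t + theta t * G t) = 0.
  have [x /sal sx|x /sal sx|iA vA] := @Rintegral_FTC2
    (fun t => dth t * A t + theta t * G t) (fun x => theta x * A x) s b sb.
  - apply: cvgD; apply: cvgM; [exact: cdth|exact: cA|exact: ctheta|exact: cG].
  - apply: (is_derive_eq (is_deriveM (dtheta x) (dA x sx))).
    by rewrite addrC /GRing.scale/= [A x * _]mulrC.
  - by split => //; rewrite vA thb ths !mul0r subrr.
have iF : mu.-integrable `[s, b] (EFin \o (fun t => dth t * F t + theta t * G t)).
  apply: continuous_integrable_itv => x.
  by apply: cvgD; apply: cvgM; [exact: cdth|exact: cF|exact: ctheta|exact: cG].
move=> zF; have : \int[mu]_(t in `[s, b]) (dth t * K t) = 0.
  transitivity (\int[mu]_(t in `[s, b]) ((dth t * F t + theta t * G t) -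
     (dth t * A t + theta t * G t))); last by rewrite RintegralB// zF zA subrr.
  by apply: eq_Rintegral => x _; rewrite /K; ring.
apply/eqP; rewrite lt_eqF//.
(* The function integrated here dominates dth K, and its integral is (K s - K t + 2 e) E(r) = - e
   E(r) < 0, the contradiction. *)
have [x xsb|x xsb|ib vb] := @Rintegral_FTC2
    (fun x => (K s + e) * bump r (x - s) - (K t - e) * bump r (x - t))
    (fun x => (K s + e) * E (x - s) - (K t - e) * E (x - t)) s b sb.
- by apply: cvgB; (apply: cvgM; [exact: cvg_cst|exact: cbs]).
- have h c k : is_derive x (1 : R) (fun x => k * E (x - c)) (k * bump r (x - c)).
    have := is_deriveM (is_derive_cst k x (1 : R)) (is_derive1_shift (dE (x - c))).
    by rewrite /= scaler0 addr0.
  exact: is_deriveB.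
have e1 : E (s - s) = 0 by rewrite subrr E0.
have e2 : E (s - t) = 0 by rewrite E0// subr_le0 ltW.
have e3 : E (b - s) = E r by apply: Er; rewrite /b; lra.
have e4 : E (b - t) = E r by apply: Er; rewrite /b; lra.
rewrite e1 e2 e3 e4 !mulr0 subrr subr0 in vb.
apply: (@le_lt_trans _ _ (\int[mu]_(x in `[s, b])
   ((K s + e) * bump r (x - s) - (K t - e) * bump r (x - t)))).
  apply: le_Rintegral => //.
    apply: continuous_compact_integrable; first exact: segment_compact.
    apply: continuous_in_subspaceT => x; rewrite inE/= in_itv/= => /sal xal.
    by apply: cvgM; [exact: cdth|exact: cK].
  move=> x; rewrite /= in_itv/= => xsb; rewrite /dth mulrBl; apply: lerB.
    have [/andP[x1 x2]|x1] := boolP (s <= x <= s + r).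
      by rewrite mulrC ler_wpM2r ?bump_ge0// Ks// x1.
    rewrite bump_eq0 ?mul0r ?mulr0//; apply/orP.
    by move: x1; rewrite negb_and -!ltNge => /orP[] /ltW; [left; rewrite subr_le0|right; rewrite lerBrDl].
  have [/andP[x1 x2]|x1] := boolP (t <= x <= t + r).
    by rewrite mulrC ler_wpM2l ?bump_ge0// Kt// x1.
  rewrite bump_eq0 ?mul0r ?mulr0//; apply/orP.
  by move: x1; rewrite negb_and -!ltNge => /orP[] /ltW; [left; rewrite subr_le0|right; rewrite lerBrDl].
by rewrite vb -mulrBl nmulr_rlt0//; move: Kst; rewrite /e; clear; lra.
Qed.

Lemma du_bois_reymond F G : continuous F -> continuous G ->
  (forall theta, smooth theta -> compact_in_pos theta ->
    \int[mu]_(t in `]0, +oo[) ('D_1 theta t * F t + theta t * G t) = 0) ->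
  forall s t, 0 <= s -> s < t -> F t - F s = \int[mu]_(r in `[s, t]) G r.
Proof.
move=> cF cG H.
have pos s t : 0 < s -> s < t -> F t - F s = \int[mu]_(r in `[s, t]) G r.
  move=> s0 st; apply/eqP; rewrite eq_le du_bois_reymond_le//=.
  have := @du_bois_reymond_le (fun x => - F x) (fun x => - G x) _ _ _ s t s0 st.
  have -> : \int[mu]_(r in `[s, t]) (- G r) = - \int[mu]_(r in `[s, t]) G r.
    rewrite -mulN1r -RintegralZl//; last exact: continuous_integrable_itv.
    by apply: eq_Rintegral => x _; rewrite mulN1r.
  rewrite -opprD lerN2; apply.
  - by move=> x; apply: cvgN; exact: cF.
  - by move=> x; apply: cvgN; exact: cG.
  - move=> theta stheta [a [b [a0 ab thab]]].
    rewrite -[RHS](H (fun x => -1 * theta x)).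
    + apply: eq_Rintegral => x _.
      have [_ ->] := is_deriveM (is_derive_cst (-1 : R) (x : R) (1 : R)) (smooth_derivable (x : R) (1 : R) stheta).
      by rewrite /= scaler0 addr0 /GRing.scale/=; ring.
    + by apply: smoothM => //; exact: smooth_cst.
    + by exists a, b; split=> // x /thab ->; rewrite mulr0.
move=> s t; rewrite le_eqVlt => /predU1P[<- {s}|]; last exact: pos.
(* Test functions vanish near time 0, so s = 0 is reached by continuity: F - A is constant on ]0, t]
   and has a limit at 0 from the right. *)
move=> t0; pose A (x : R) := \int[mu]_(r in `[-1, x]) G r.
have dA (x : R) : -1 < x -> is_derive x (1 : R) A (G x).
  exact: is_derive_primitive.
have AE s : 0 <= s -> s < t -> \int[mu]_(r in `[s, t]) G r = A t - A s.
  move=> s0 st; apply: (Rintegral_FTC2 st _ _).2 => x; first by move=> _; exact: cG.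
  by move=> /andP[sx _]; apply: dA; lra.
have cA (x : R) : -1 < x -> {for x, continuous A}.
  by move=> /dA[dAx _]; apply: differentiable_continuous; exact/derivable1_diffP.
have N1 : -1 < 0 :> R by lra.
have cK : {for (0 : R), continuous (fun x : R => F x - A x)} by apply: cvgB; [exact: cF|exact: cA].
have cK0 : (fun x : R => F x - A x) @ (0 : R)^'+ --> F 0 - A 0 by exact: cvg_at_right_filter.
have cKt : (fun x : R => F x - A x) @ (0 : R)^'+ --> F t - A t.
  apply: (cvg_trans (near_eq_cvg _) (cvg_cst (F t - A t))).
  near=> x; have x0 : 0 < x by near: x; exact: nbhs_right_gt.
  have xt : x < t by near: x; exact: nbhs_right_lt.
  by have := pos _ _ x0 xt; rewrite AE ?ltW// /cst; lra.
have e : F 0 - A 0 = F t - A t := cvg_unique (@norm_hausdorff _ R) cK0 cKt.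
by rewrite AE// -[F t](subrK (A t)) -e; ring.
Unshelve. all: by end_near. Qed.

End du_bois_reymond.

(** * Velocity averages *)
Section reflection.
Context {R : realType}.
Local Notation leb := (@lebesgue_measure R).

(** Coordinate reflections are the only symmetries of the velocity ball that are used. *)
Definition refl n (i : 'I_n) (v : 'rV[R]_n) : 'rV[R]_n :=
  \row_j (if j == i then - v ord0 j else v ord0 j).

Lemma measurable_refl n (i : 'I_n) : measurable_fun setT (refl i).
Proof.
apply: measurable_fun_rVP => j; have [ji|ji] := eqVneq j i.
  rewrite (_ : _ \o _ = (fun v => - rV_coord j v)); last first.
    by apply/funext => v; rewrite /= /rV_coord mxE ji eqxx.
  by apply: measurableT_comp => //; exact: measurable_rV_coord.
rewrite (_ : _ \o _ = rV_coord j); first exact: measurable_rV_coord.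
by apply/funext => v; rewrite /= /rV_coord mxE (negbTE ji).
Qed.

Lemma lebesgue_rVS n (A : set 'rV[R]_n.+1) : lebesgue_rV n.+1 A =
  (\int[leb]_x lebesgue_rV n (xsection (@cons_rV R n @^-1` A) x))%E.
Proof. by []. Qed.

Lemma measurable_cons_preimage n (A : set 'rV[R]_n.+1) : measurable A ->
  measurable (@cons_rV R n @^-1` A).
Proof.
by move=> mA; rewrite -[X in measurable X]setTI; exact: measurable_cons_rV.
Qed.

Lemma refl_cons0 n (x : measurableTypeR R) (y : 'rV[R]_n) :
  refl ord0 (cons_rV (x, y)) = cons_rV (- (x : R), y).
Proof.
by apply/rowP => j; rewrite !mxE; case: (unliftP ord0 j) => [k|] ->.
Qed.

Lemma refl_consS n (i : 'I_n) (x : measurableTypeR R) (y : 'rV[R]_n) :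
  refl (lift ord0 i) (cons_rV (x, y)) = cons_rV (x, refl i y).
Proof.
apply/rowP => j; rewrite !mxE; case: (unliftP ord0 j) => [k|] -> /=.
  by rewrite mxE (inj_eq (@lift_inj _ _)).
by [].
Qed.

(** Induction along the recursive construction of the measure: the reflection acts either on the
    tail, or on the first coordinate, where it is x -> - x on the line. *)
Lemma lebesgue_rV_refl n (i : 'I_n) (A : set 'rV[R]_n) : measurable A ->
  lebesgue_rV n (refl i @^-1` A) = lebesgue_rV n A.
Proof.
elim: n i A => [|n IH] i A mA; first by case: i.
have mB := measurable_cons_preimage mA.
rewrite !lebesgue_rVS; case: (unliftP ord0 i) => [j|] ->.
  apply: eq_integral => x _; rewrite -[RHS](IH j); last exact: measurable_xsection.
  congr (lebesgue_rV n _); apply/seteqP; split => y;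
    by rewrite /xsection/= !in_setE/= refl_consS.
have mh := @measurable_fun_xsection _ _ _ _ _ (lebesgue_rV n) _ mB.
set h := _ \o _ in mh.
transitivity (\int[leb]_x (h \o (-%R : _ -> measurableTypeR R)) x)%E.
  apply: eq_integral => x _; congr (lebesgue_rV n _); apply/seteqP; split => y;
    by rewrite /xsection/= !in_setE/= refl_cons0.
rewrite -[X in (\int[_]_(_ in X) _)%E](preimage_setT (-%R : _ -> measurableTypeR R)).
rewrite -ge0_integral_pushforward//.
by apply: eq_measure_integral => /= B mB' _; exact: lebesgue_measureN.
Qed.

(** Needed to see that a velocity coordinate cannot vanish almost everywhere on the ball. *)
Lemma lebesgue_rV_hyperplane n (i : 'I_n) :
  lebesgue_rV n [set v : 'rV[R]_n | v ord0 i = 0] = 0%E.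
Proof.
elim: n i => [[]//|n IH] i.
rewrite lebesgue_rVS; case: (unliftP ord0 i) => [j|] ->.
  rewrite (eq_integral (cst 0%E)) ?integral0// => x _.
  rewrite -(IH j); congr (lebesgue_rV n _); apply/seteqP; split => y;
  by rewrite /xsection/= !in_setE/= mxE liftK.
have -> : @cons_rV R n @^-1` [set v | v ord0 ord0 = 0] = [set 0] `*` setT.
  rewrite predeqE => -[x y] /=; rewrite mxE unlift_none/=; by split=> [|[]].
transitivity ((leb \x lebesgue_rV n)%E ([set 0] `*` setT)); first by [].
have m0 : measurable ([set 0] : set (measurableTypeR R)) by exact: (@measurable_set1 R 0).
rewrite product_measure1E//.
rewrite [X in (X * _)%E](_ : _ = 0%E) ?mul0e//; exact: (@lebesgue_measure_set1 R 0).
Qed.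

Variables (d : nat) (V0 : R).
Hypothesis volV : lebesgue_rV d (velocities V0) = 1%E.
Local Notation vol := (lebesgue_rV d).
Local Notation V := (@velocities R d V0).

Lemma measurable_dotpl (x : 'rV[R]_d) : measurable_fun setT (dotp x).
Proof.
apply: measurable_sum => i; apply: measurable_funM; first exact: measurable_cst.
exact: (@measurable_rV_coord R d i).
Qed.

Lemma measurable_dotpp : measurable_fun setT (fun z : 'rV[R]_d * 'rV[R]_d => dotp z.1 z.2).
Proof.
apply: measurable_sum => i; apply: measurable_funM.
  by apply: (measurableT_comp (measurable_rV_coord i)).
by apply: (measurableT_comp (measurable_rV_coord i)).
Qed.

Lemma measurable_enorm : measurable_fun setT (@enorm R d).
Proof.
apply: measurableT_comp; first by apply: continuous_measurable_fun; exact: sqrt_continuous.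
apply: measurable_sum => i; apply: measurable_funM; exact: (@measurable_rV_coord R d i).
Qed.

Lemma measurable_V : measurable V.
Proof.
have -> : V = setT `&` @enorm R d @^-1` `]-oo, V0[.
  by apply/seteqP; split => v; rewrite /velocities/= in_itv//= => -[].
by apply: measurable_enorm; [exact: measurableT|exact: measurable_itv].
Qed.

Lemma dotp_refl (i : 'I_d) (x v : 'rV[R]_d) :
  dotp x v - dotp x (refl i v) = 2 * (x ord0 i * v ord0 i).
Proof.
rewrite /dotp -sumrB (bigD1 i)//= big1 ?addr0; first by rewrite mxE eqxx; ring.
by move=> j ji; rewrite mxE (negbTE ji) subrr.
Qed.

Lemma enorm_refl (i : 'I_d) (v : 'rV[R]_d) : enorm (refl i v) = enorm v.
Proof.
congr Num.sqrt; apply: eq_bigr => j _; rewrite !mxE; case: ifP => _ //.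
by rewrite mulrNN.
Qed.

Lemma enorm_ge0 (x : 'rV[R]_d) : 0 <= enorm x.
Proof. exact: sqrtr_ge0. Qed.

Lemma dotpp_ge0 (x : 'rV[R]_d) : 0 <= dotp x x.
Proof. by apply: sumr_ge0 => i _; rewrite -expr2 sqr_ge0. Qed.

Lemma enorm_sqr (x : 'rV[R]_d) : enorm x ^+ 2 = dotp x x.
Proof. by rewrite sqr_sqrtr ?dotpp_ge0. Qed.

Lemma dotpN (x v : 'rV[R]_d) : dotp (- x) v = - dotp x v.
Proof. by rewrite /dotp -sumrN; apply: eq_bigr => i _; rewrite mxE mulNr. Qed.

Lemma dotpC (x v : 'rV[R]_d) : dotp x v = dotp v x.
Proof. by apply: eq_bigr => i _; rewrite mulrC. Qed.

Lemma enorm0_dotp (x v : 'rV[R]_d) : enorm x = 0 -> dotp x v = 0.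
Proof.
move=> x0; have := enorm_sqr x; rewrite x0 expr0n/= => /esym/psumr_eq0P x0'.
rewrite /dotp big1// => i _; have /eqP := x0' (fun i _ => sqr_ge0 (x ord0 i)) i isT.
by rewrite mulf_eq0 orbb => /eqP ->; rewrite mul0r.
Qed.

Lemma dotp_le (x v : 'rV[R]_d) : dotp x v <= enorm x * enorm v.
Proof.
have [x0|x0] := eqVneq (enorm x) 0; first by rewrite enorm0_dotp// x0 mul0r.
have [v0|v0] := eqVneq (enorm v) 0; first by rewrite dotpC enorm0_dotp// v0 mulr0.
have xv0 : 0 < enorm x * enorm v.
  by rewrite mulr_gt0// lt_neqAle enorm_ge0 eq_sym andbT.
(* Cauchy-Schwarz: the sum expands to 2 |x| |v| (|x| |v| - x . v). *)
have : 0 <= \sum_(i < d) (enorm v * x ord0 i - enorm x * v ord0 i) ^+ 2.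
  by apply: sumr_ge0 => i _; exact: sqr_ge0.
have -> : \sum_(i < d) (enorm v * x ord0 i - enorm x * v ord0 i) ^+ 2 =
   enorm v ^+ 2 * dotp x x - 2 * (enorm x * enorm v) * dotp x v + enorm x ^+ 2 * dotp v v.
  by rewrite /dotp !mulr_sumr -sumrB -big_split/=; apply: eq_bigr => i _; ring.
rewrite -!enorm_sqr => h; rewrite -subr_ge0 -(pmulr_rge0 _ xv0); nra.
Qed.

Lemma norm_dotp_le (x v : 'rV[R]_d) : `|dotp x v| <= enorm x * enorm v.
Proof.
rewrite ler_norml dotp_le andbT lerNl -dotpN.
apply: le_trans (dotp_le _ _) _; rewrite le_eqVlt; apply/orP; left; apply/eqP.
by congr (_ * _); rewrite /enorm dotpN dotpC dotpN opprK.
Qed.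

Lemma bounded_integrable_V (h : 'rV[R]_d -> R) (c : R) : measurable_fun setT h ->
  (forall v, V v -> `|h v| <= c) -> vol.-integrable V (EFin \o h).
Proof.
move=> mh hc.
apply: (@le_integrable _ _ _ _ _ measurable_V _ (cst c%:E)).
- by apply/measurable_EFinP; exact: measurable_funTS.
- move=> v Vv /=; rewrite lee_fin (le_trans (hc v Vv))// ler_norm//.
- apply/integrableP; split; first exact: measurable_cst.
  rewrite /= (integral_cst _ measurable_V) [X in (_ * X)%E](_ : _ = 1%E) ?mule1 ?ltry//.
Qed.

Lemma V_refl (i : 'I_d) : refl i @^-1` V = V.
Proof. by apply/seteqP; split => v; rewrite /= /velocities/= enorm_refl. Qed.

Lemma Rintegral_refl (i : 'I_d) (h : 'rV[R]_d -> R) (c : R) : measurable_fun setT h ->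
  (forall v, V v -> `|h v| <= c) ->
  \int[vol]_(v in V) h (refl i v) = \int[vol]_(v in V) h v.
Proof.
move=> mh hc; congr fine; rewrite -[in LHS](V_refl i).
have mEh : measurable_fun setT (EFin \o h) by exact/measurable_EFinP.
rewrite -(@integral_pushforward _ _ _ _ _ _ (measurable_refl i) vol V (EFin \o h))//.
- apply: eq_measure_integral => /= [|? B mB' _]; first exact: measurable_refl.
  exact: lebesgue_rV_refl.
- rewrite (V_refl i); apply: (@bounded_integrable_V (h \o refl i) c).
    by apply: (measurableT_comp mh); exact: measurable_refl.
  by move=> v Vv; apply: hc; rewrite -(V_refl i) in Vv.
- exact: measurable_V.
Qed.

Lemma coord_le (i : 'I_d) (v : 'rV[R]_d) : `|v ord0 i| <= enorm v.
Proof.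
rewrite -[leRHS]ger0_norm ?enorm_ge0// -ler_sqr ?nnegrE// !real_normK ?num_real//.
rewrite enorm_sqr /dotp (bigD1 i)//= expr2 lerDl sumr_ge0// => j _.
by rewrite -expr2 sqr_ge0.
Qed.

Lemma integrable_coord (i : 'I_d) : vol.-integrable V (fun v : 'rV[R]_d => (v ord0 i)%:E).
Proof.
apply: (@bounded_integrable_V (rV_coord i) V0); first exact: measurable_rV_coord.
by move=> v /ltW; apply: le_trans; exact: coord_le.
Qed.

Lemma integral_coord (i : 'I_d) : \int[vol]_(v in V) (v ord0 i) = 0.
Proof.
have := @Rintegral_refl i (rV_coord i) V0 (measurable_rV_coord i) _.
have h v : V v -> `|v ord0 i| <= V0 by move=> /ltW; apply: le_trans; exact: coord_le.
move=> /(_ h); rewrite /rV_coord.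
under eq_Rintegral do rewrite mxE eqxx -mulN1r.
rewrite (RintegralZl _ measurable_V (integrable_coord i)) => ?; lra.
Qed.

Lemma integral_dotp (x : 'rV[R]_d) : \int[vol]_(v in V) dotp x v = 0.
Proof.
suff H (s : seq 'I_d) :
    vol.-integrable V (EFin \o (fun v : 'rV[R]_d => \sum_(i <- s) x ord0 i * v ord0 i)) /\
    \int[vol]_(v in V) (\sum_(i <- s) x ord0 i * v ord0 i) = 0 by exact: (H _).2.
elim: s => [|i s [IH1 IH2]].
  have -> : (fun v : 'rV[R]_d => \sum_(i <- [::]) x ord0 i * v ord0 i) = cst 0.
    by apply/funext => v; rewrite big_nil.
  split.
    by apply: (@bounded_integrable_V (cst 0) 0); [exact: measurable_cst|move=> v _; rewrite normr0].
  by rewrite Rintegral_cst ?mul0r//; exact: measurable_V.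
have -> : (fun v : 'rV[R]_d => \sum_(i <- i :: s) x ord0 i * v ord0 i) =
    (fun v => x ord0 i * v ord0 i + \sum_(i <- s) x ord0 i * v ord0 i).
  by apply/funext => v; rewrite big_cons.
have ii : vol.-integrable V (EFin \o (fun v : 'rV[R]_d => x ord0 i * v ord0 i)).
  by apply: (RintegrableZ measurable_V); exact: integrable_coord.
split; first by apply: (RintegrableD measurable_V ii IH1).
rewrite (RintegralD measurable_V ii IH1) IH2 addr0.
by rewrite (RintegralZl _ measurable_V (integrable_coord i)) integral_coord mulr0.
Qed.

Definition mean_abs_dotp (x : 'rV[R]_d) : R := \int[vol]_(v in V) `|dotp x v|.

Lemma integrable_norm_dotp (x : 'rV[R]_d) :
  vol.-integrable V (EFin \o (fun v : 'rV[R]_d => `|dotp x v|)).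
Proof.
apply: (@bounded_integrable_V _ (enorm x * V0)).
  by apply: measurableT_comp => //; exact: measurable_dotpl.
move=> v /ltW Vv; rewrite normr_id (le_trans (norm_dotp_le _ _))//.
by rewrite ler_wpM2l ?enorm_ge0.
Qed.

(** Were the integral 0, the ball would lie in the union of a null set and a null hyperplane,
    against its volume 1. *)
Lemma mean_abs_coord_gt0 (i : 'I_d) : 0 < \int[vol]_(v in V) `|v ord0 i|.
Proof.
have ic : vol.-integrable V (EFin \o (fun v : 'rV[R]_d => `|v ord0 i|)).
  apply: (@bounded_integrable_V _ V0).
    by apply: measurableT_comp => //; exact: (@measurable_rV_coord R d i).
  by move=> v /ltW; rewrite normr_id; apply: le_trans; exact: coord_le.
rewrite lt_neqAle Rintegral_ge0 ?andbT//; apply/eqP => /esym h0.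
have : (\int[vol]_(v in V) `|(v ord0 i)%:E| = 0)%E.
  transitivity (\int[vol]_(v in V) (`|v ord0 i|)%:E)%E; first by [].
  by rewrite (Rintegrable_fin measurable_V ic) h0.
have mc : measurable_fun V (fun v : 'rV[R]_d => (v ord0 i)%:E).
  by apply/measurable_EFinP; apply: measurable_funTS; exact: (@measurable_rV_coord R d i).
move/(ae_eq_integral_abs _ measurable_V mc) => [N [mN N0 hN]].
have mH : measurable [set v : 'rV[R]_d | v ord0 i = 0].
  by rewrite -[X in measurable X]setTI; exact: (@measurable_rV_coord R d i measurableT _ (measurable_set1 0)).
have VNH : V `<=` N `|` [set v | v ord0 i = 0].
  move=> v Vv; have [v0|v0] := pselect (v ord0 i = 0); [by right|left].
  by apply: hN => /(_ Vv) [].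
have : (vol V <= 0)%E.
  apply: (@le_trans _ _ (vol (N `|` [set v | v ord0 i = 0]))).
    by apply: le_measure => //; rewrite inE; [exact: measurable_V|exact: measurableU].
  apply: (le_trans (measureU2 _ mN mH)).
  rewrite [X in (X + _)%E](_ : _ = 0%E)// [X in (_ + X)%E](_ : _ = 0%E) ?adde0//.
  exact: lebesgue_rV_hyperplane.
by rewrite volV leNgt lte01.
Qed.

Lemma mean_abs_dotp_ge0 (x : 'rV[R]_d) : 0 <= mean_abs_dotp x.
Proof. exact: Rintegral_ge0. Qed.

(** Averaging over v and its reflection v' in coordinate i: |x . v| + |x . v'| >= |x . v - x . v'| =
    2 |x_i v_i|. *)
Lemma mean_abs_dotp_ge_coord (i : 'I_d) (x : 'rV[R]_d) :
  `|x ord0 i| * \int[vol]_(v in V) `|v ord0 i| <= mean_abs_dotp x.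
Proof.
have ic : vol.-integrable V (EFin \o (fun v : 'rV[R]_d => `|v ord0 i|)).
  exact/Rintegrable_norm/integrable_coord.
have mxr : measurable_fun setT (fun v : 'rV[R]_d => `|dotp x (refl i v)|).
  apply: measurableT_comp => //.
  by apply: (measurableT_comp (measurable_dotpl x)); exact: measurable_refl.
have ixr : vol.-integrable V (EFin \o (fun v : 'rV[R]_d => `|dotp x (refl i v)|)).
  apply: (@bounded_integrable_V _ (enorm x * V0)) => // v /ltW Vv.
  rewrite normr_id (le_trans (norm_dotp_le _ _))//.
  by rewrite ler_wpM2l ?enorm_ge0// enorm_refl.
have -> : mean_abs_dotp x = 2^-1 * \int[vol]_(v in V) (`|dotp x v| + `|dotp x (refl i v)|).
  rewrite RintegralD//; [|exact: measurable_V|exact: integrable_norm_dotp].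
  rewrite (@Rintegral_refl i (fun v => `|dotp x v|) (enorm x * V0)).
  - by rewrite -/(mean_abs_dotp x); lra.
  - by apply: measurableT_comp => //; exact: measurable_dotpl.
  - move=> v /ltW Vv; rewrite normr_id (le_trans (norm_dotp_le _ _))//.
    by rewrite ler_wpM2l ?enorm_ge0.
rewrite -!RintegralZl//; try exact: measurable_V; last first.
  by apply: RintegrableD; [exact: measurable_V|exact: integrable_norm_dotp|].
apply: le_Rintegral; first exact: measurable_V.
- by apply: RintegrableZ; [exact: measurable_V|].
- apply: RintegrableZ; first exact: measurable_V.
  by apply: RintegrableD; [exact: measurable_V|exact: integrable_norm_dotp|].
move=> v _; have := ler_normB (dotp x v) (dotp x (refl i v)).
rewrite dotp_refl normrM (@ger0_norm _ 2)// normrM; lra.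
Qed.

Lemma mean_abs_dotp_lower : exists2 A : R, 0 < A &
  forall x : 'rV[R]_d, A * enorm x <= mean_abs_dotp x.
Proof.
pose m i := \int[vol]_(v in V) `|v ord0 i|.
have m0 (i : 'I_d) : 0 < m i by exact: mean_abs_coord_gt0.
(* From |x| <= sum of |x_i| and |x_i| <= mean / m_i; the summand 1 makes S positive whatever the
   sum. *)
pose S := 1 + \sum_(i < d) (m i)^-1.
have S0 : 0 < S by rewrite ltr_pwDl// sumr_ge0// => i _; rewrite invr_ge0 ltW.
exists S^-1; first by rewrite invr_gt0.
move=> x; rewrite ler_pdivrMl//.
have e1 : enorm x <= \sum_(i < d) `|x ord0 i|.
  rewrite -ler_sqr ?nnegrE ?enorm_ge0 ?sumr_ge0// enorm_sqr /dotp.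
  rewrite expr2 mulr_suml ler_sum// => i _.
  apply: (@le_trans _ _ (`|x ord0 i| * `|x ord0 i|)).
    by rewrite -normrM ler_norm.
  by rewrite ler_wpM2l// (bigD1 i)//= lerDl sumr_ge0.
apply: (le_trans e1); rewrite mulrDl mul1r mulr_suml.
rewrite (@le_trans _ _ (\sum_(i < d) (m i)^-1 * mean_abs_dotp x))// ?lerDr ?mean_abs_dotp_ge0//.
apply: ler_sum => i _; rewrite mulrC ler_pdivlMr//.
exact: mean_abs_dotp_ge_coord.
Qed.

End reflection.

(** * The Lyapunov weight *)
Section japanese_bracket.
Context {R : realType} {d : nat}.
Implicit Types x v : 'rV[R]_d.

Lemma jap_sqr x : jap x ^+ 2 = 1 + dotp x x.
Proof. by rewrite sqr_sqrtr ?enorm_sqr// addr_ge0// ?dotpp_ge0. Qed.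

Lemma jap_ge0 x : 0 <= jap x.
Proof. exact: sqrtr_ge0. Qed.

Lemma jap_ge1 x : 1 <= jap x.
Proof.
by rewrite -ler_sqr ?nnegrE ?jap_ge0// expr1n jap_sqr lerDl dotpp_ge0.
Qed.

Lemma enorm_le_jap x : enorm x <= jap x.
Proof.
by rewrite -ler_sqr ?nnegrE ?jap_ge0 ?enorm_ge0// jap_sqr enorm_sqr lerDr.
Qed.

Lemma jap_le_enorm x : jap x <= 1 + enorm x.
Proof.
have := enorm_ge0 x => x0.
rewrite -ler_sqr ?nnegrE ?jap_ge0 ?addr_ge0// jap_sqr -enorm_sqr; nra.
Qed.

Lemma dotp_shift (h : R) x v w : dotp (x + h *: v) w = dotp x w + h * dotp v w.
Proof.
by rewrite /dotp mulr_sumr -big_split; apply: eq_bigr => i _; rewrite !mxE mulrDl mulrA.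
Qed.

Lemma jap_shift_sqr (h : R) x v :
  jap (x + h *: v) ^+ 2 = jap x ^+ 2 + 2 * h * dotp x v + h ^+ 2 * dotp v v.
Proof.
rewrite !jap_sqr dotp_shift [dotp x _]dotpC [dotp v _]dotpC !dotp_shift.
by rewrite [dotp v x]dotpC; ring.
Qed.

Lemma enormN v : enorm (- v) = enorm v.
Proof. by rewrite /enorm dotpN dotpC dotpN opprK. Qed.

Lemma jap_lip (h V0 : R) x v : 0 <= h -> enorm v <= V0 ->
  jap (x + h *: v) <= jap x + h * V0.
Proof.
move=> h0 vV; have J0 := jap_ge0 x; have v0 := enorm_ge0 v.
have V00 : 0 <= V0 by exact: le_trans vV.
rewrite -ler_sqr ?nnegrE ?jap_ge0 ?addr_ge0 ?mulr_ge0// jap_shift_sqr.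
have p1 : dotp x v <= jap x * V0.
  apply: le_trans (dotp_le x v) _; apply: ler_pM => //; [exact: enorm_ge0|exact: enorm_le_jap].
have p2 : dotp v v <= V0 ^+ 2 by rewrite -enorm_sqr ler_sqr ?nnegrE.
have h20 : 0 <= h ^+ 2 by exact: sqr_ge0.
have := ler_wpM2l h0 p1; have := ler_wpM2l h20 p2; nra.
Qed.

Lemma jap_lip_opp (h V0 : R) x v : 0 <= h -> enorm v <= V0 ->
  jap x <= jap (x + h *: v) + h * V0.
Proof.
move=> h0 vV; have := @jap_lip h V0 (x + h *: v) (- v) h0.
by rewrite enormN scalerN addrK => /(_ vV).
Qed.

(** The tangent bound of the square root, in the form K <= (K^2 + J^2) / (2 J). It gives the
    expansion of the bracket along the flow without differentiating. *)
Lemma jap_concave (h : R) x v : jap (x + h *: v) <=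
  jap x + h * (dotp x v / jap x) + h ^+ 2 * dotp v v / (2 * jap x).
Proof.
have J0 : 0 < jap x by exact: lt_le_trans (jap_ge1 x).
have -> : jap x + h * (dotp x v / jap x) + h ^+ 2 * dotp v v / (2 * jap x) =
   (jap (x + h *: v) ^+ 2 + jap x ^+ 2) / (2 * jap x).
  rewrite jap_shift_sqr; field; lra.
rewrite ler_pdivlMr ?mulr_gt0//; have := sqr_ge0 (jap (x + h *: v) - jap x); nra.
Qed.

(** e^y <= 1 / (1 - y), and (1 - y) (1 + y + 2 y^2) = 1 + y^2 (1 - 2 y) >= 1. *)
Lemma expR_le_quadratic (y : R) : y <= 2^-1 -> expR y <= 1 + y + 2 * y ^+ 2.
Proof.
move=> y2; have y1 : 0 < 1 - y by lra.
have := expR_ge1Dx (- y); rewrite expRN => h.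
have : expR y <= (1 - y)^-1 by rewrite -[expR y]invrK lef_pV2 ?posrE ?invr_gt0 ?expR_gt0.
move=> /le_trans; apply; rewrite -[leLHS]mul1r ler_pdivrMr//.
have := sqr_ge0 y; nra.
Qed.

Lemma measurable_jap : measurable_fun setT (@jap R d).
Proof.
apply: (measurableT_comp (continuous_measurable_fun (@sqrt_continuous R))).
apply: measurable_funD; first exact: measurable_cst.
by apply: measurable_funX; exact: measurable_enorm.
Qed.

End japanese_bracket.

(** * The tilted exponential weight and its Lyapunov inequality *)

Section weight.
Context {R : realType} {d : nat}.
Variables (chi V0 : R).
Hypotheses (chi_gt0 : 0 < chi) (chi_lt1 : chi < 1) (V0_gt0 : 0 < V0).
Hypothesis volV : lebesgue_rV d (velocities V0) = 1%E.
Local Notation vol := (lebesgue_rV d).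
Local Notation V := (@velocities R d V0).
Variables (A gamma : R).
Hypothesis A_gt0 : 0 < A.
Hypothesis lower : forall x : 'rV[R]_d, A * enorm x <= mean_abs_dotp V0 x.
Hypothesis gamma_gt0 : 0 < gamma.
Hypothesis gamma_small : gamma * (2 + 4 * V0 + 6 * V0 ^+ 2) <= 1.
Implicit Types x v : 'rV[R]_d.

Local Notation delta := (chi / 2).

(* To first order in gamma, the tumbling of the corrector (x . v) / <x> turns the
   transport term (x . v) / <x> of e^(gamma <x>) into - chi |x . v| / <x>.  The
   term - delta |x . v| makes the velocity average of the tilt negative, whence a
   decay rate of order (1 - chi) delta A. *)
Definition tilt x v : R := (dotp x v - delta * `|dotp x v|) / jap x.

Definition weight (z : 'rV[R]_d * 'rV[R]_d) : R :=
  exp_weight gamma z * (1 + gamma * tilt z.1 z.2).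

(* Dominates the difference quotients of the weight along x + h v, 0 < h <= gamma.
   The terms in V0 ^+ 2 are slack for the second-order errors and for the kink
   of `|x . v|, which is thus never differentiated. *)
Definition weight_slope (z : 'rV[R]_d * 'rV[R]_d) : R :=
  gamma * exp_weight gamma z *
  ((dotp z.1 z.2 / jap z.1) * (1 + gamma * tilt z.1 z.2)
   + 5 * gamma * V0 ^+ 2 + 16 * V0 ^+ 2 / jap z.1).

Lemma gamma_bounds :
  [/\ gamma <= 1, gamma * V0 <= 4^-1 & gamma * (6 * V0 ^+ 2) <= 1].
Proof.
have g0 := ltW gamma_gt0; have a1 := mulr_ge0 g0 (ltW V0_gt0).
have a2 := mulr_ge0 g0 (sqr_ge0 V0); move: gamma_small; rewrite !mulrDr => h.
by split; lra.
Qed.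

Lemma dotp_jap_le x v : enorm v <= V0 -> `|dotp x v / jap x| <= V0.
Proof.
move=> vV; have J0 : 0 < jap x by exact: lt_le_trans (jap_ge1 x).
rewrite normrM normfV (gtr0_norm J0) ler_pdivrMr// mulrC.
apply: le_trans (norm_dotp_le x v) _.
by apply: ler_pM => //; [exact: enorm_ge0|exact: enorm_ge0|exact: enorm_le_jap].
Qed.

Lemma tilt_le x v : enorm v <= V0 -> `|tilt x v| <= 2 * V0.
Proof.
move=> /(dotp_jap_le x) h; have J0 : 0 < jap x by exact: lt_le_trans (jap_ge1 x).
have -> : tilt x v = dotp x v / jap x - delta * `|dotp x v / jap x|.
  by rewrite /tilt normrM normfV (gtr0_norm J0) mulrBl mulrA.
move: (dotp x v / jap x) h => u h.
apply: le_trans (ler_normB _ _) _.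
rewrite normrM normr_id (@ger0_norm _ delta) ?divr_ge0 ?(ltW chi_gt0)//.
have d1 : delta <= 1 by have := chi_lt1; lra.
have := ler_wpM2r (normr_ge0 u) d1; rewrite mul1r; lra.
Qed.

Lemma gamma_tilt x v : enorm v <= V0 -> - 2^-1 <= gamma * tilt x v <= 2^-1.
Proof.
move=> /(tilt_le x) h; rewrite -ler_norml normrM (gtr0_norm gamma_gt0).
have [_ gV _] := gamma_bounds; have := ler_wpM2l (ltW gamma_gt0) h; lra.
Qed.

Lemma exp_weight_gt0 (z : 'rV[R]_d * 'rV[R]_d) : 0 < exp_weight gamma z.
Proof. exact: expR_gt0. Qed.

Lemma weight_bounds (z : 'rV[R]_d * 'rV[R]_d) : enorm z.2 <= V0 ->
  2^-1 * exp_weight gamma z <= weight z <= 2 * exp_weight gamma z.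
Proof.
move=> /(gamma_tilt z.1) /andP[h1 h2]; rewrite /weight; have := exp_weight_gt0 z.
by move=> h; rewrite [2^-1 * _]mulrC [2 * _]mulrC !ler_pM2l//; lra.
Qed.

(** The numerator is g(x . v) with g u = u - delta |u|, and x . v grows by h |v|^2 >= 0 along the
    flow; the Lipschitz bound of g replaces a derivative at the kink. The change of numerator and
    that of denominator each cost 2 h V0^2 <x>, and passing from <x> to <x + h v> doubles the total
    to 8 h V0^2. *)
Lemma tilt_shift (h : R) x v : 0 <= h -> h <= gamma -> enorm v <= V0 ->
  tilt (x + h *: v) v <= tilt x v + 8 * h * V0 ^+ 2 / jap x.
Proof.
move=> h0 hg vV; have J1 := jap_ge1 x; have J0 : 0 < jap x by exact: lt_le_trans J1.
have K1 := jap_ge1 (x + h *: v).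
have K0 : 0 < jap (x + h *: v) by exact: lt_le_trans K1.
have := jap_lip_opp x h0 vV; have := jap_lip x h0 vV.
have hV : h * V0 <= 4^-1 by have [_ gV _] := gamma_bounds; apply: le_trans gV; rewrite ler_wpM2r ?(ltW V0_gt0).
have := dotp_jap_le x vV; rewrite normrM normfV (gtr0_norm J0) ler_pdivrMr//.
rewrite /tilt dotp_shift.
have q0 := dotpp_ge0 v; have q1 : dotp v v <= V0 ^+ 2.
  by rewrite -enorm_sqr ler_sqr ?nnegrE ?enorm_ge0 ?(ltW V0_gt0).
move: (dotp x v) (dotp v v) q0 q1 => p q q0 q1.
move: (jap x) J1 J0 (jap (x + h *: v)) K1 K0 => J J1 J0 K K1 K0 pV KJ JK.
pose g u : R := u - delta * `|u|.
have hq0 : 0 <= h * q by rewrite mulr_ge0.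
have hq1 : h * q <= h * V0 ^+ 2 by rewrite ler_wpM2l.
have d0 : 0 <= delta by rewrite divr_ge0 ?(ltW chi_gt0).
have d1 : delta <= 1 by have := chi_lt1; lra.
have gmono : g (p + h * q) <= g p + 2 * h * V0 ^+ 2.
  have e : `|p| <= `|p + h * q| + h * q.
    by have := ler_normB (p + h * q) (h * q); rewrite addrK (ger0_norm hq0).
  have := ler_wpM2l d0 e; rewrite /g mulrDr.
  have := ler_wpM2r hq0 d1; rewrite mul1r; lra.
have gle : `|g p| <= 2 * V0 * J.
  apply: le_trans (ler_normB _ _) _; rewrite normrM normr_id (ger0_norm d0).
  have := ler_wpM2r (normr_ge0 p) d1; rewrite mul1r; lra.
rewrite -/(g p) -/(g (p + h * q)) -mulrDl ler_pdivrMr// mulrAC ler_pdivlMr//.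
have V2 : 0 <= h * V0 ^+ 2 by rewrite mulr_ge0// sqr_ge0.
have s1 := ler_wpM2r (ltW J0) gmono.
(* The cost of changing the denominator: |g p| <= 2 V0 J and |J - K| <= h V0. *)
have s2 : g p * (J - K) <= 2 * (h * V0 ^+ 2) * J.
  apply: le_trans (ler_norm _) _; rewrite normrM.
  have -> : 2 * (h * V0 ^+ 2) * J = (2 * V0 * J) * (h * V0) by ring.
  by apply: ler_pM => //; rewrite ler_norml; apply/andP; split; lra.
have s3 : (h * V0 ^+ 2) * J <= (h * V0 ^+ 2) * (2 * K) by rewrite ler_wpM2l//; lra.
nra.
Qed.

(** The exponential factor and the tilt factor are bounded separately, by E and F; expanding E F
    yields the constants of [weight_slope]. *)
Lemma weight_shift (h : R) x v : 0 < h -> h <= gamma -> enorm v <= V0 ->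
  weight (x + h *: v, v) <= weight (x, v) + h * weight_slope (x, v).
Proof.
move=> /ltW h0 hg vV; have J1 := jap_ge1 x; have J0 : 0 < jap x by exact: lt_le_trans J1.
have V00 := ltW V0_gt0; have g0 := ltW gamma_gt0; have [g1 gV gV2] := gamma_bounds.
have V2 : 0 <= V0 ^+ 2 by exact: sqr_ge0.
have hV : h * V0 <= 4^-1 by apply: le_trans gV; rewrite ler_wpM2r.
rewrite /weight /weight_slope /exp_weight/=.
set K := jap (x + h *: v); set J := jap x in J1 J0 *.
have KJ : K <= J + h * V0 by exact: jap_lip.
have JK : J <= K + h * V0 by exact: jap_lip_opp.
have q0 := dotpp_ge0 v; have q1 : dotp v v <= V0 ^+ 2.
  by rewrite -enorm_sqr ler_sqr ?nnegrE ?enorm_ge0.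
have KC : K <= J + h * (dotp x v / J) + h ^+ 2 * dotp v v / (2 * J) by exact: jap_concave.
have uV := dotp_jap_le x vV; rewrite -/J ler_norml in uV.
have /andP[t1 t2] := gamma_tilt x vV.
have ts := tilt_shift x h0 hg vV; rewrite -/J in ts.
set u := dotp x v / J in KC uV *; move: (tilt (x + h *: v) v) (tilt x v) ts t1 t2 => T' T ts t1 t2.
(* 5/2 = 1/2 + 2: the second-order term of [jap_concave] and the quadratic term of
   [expR_le_quadratic]. *)
pose E := 1 + gamma * h * (u + 5 / 2 * gamma * V0 ^+ 2).
pose F := 1 + gamma * T + 8 * gamma * h * V0 ^+ 2 / J.
have gh0 : 0 <= gamma * h by rewrite mulr_ge0.
have iJ0 : 0 <= J^-1 by rewrite invr_ge0 ltW.
have iJ1 : J^-1 <= 1 by rewrite invf_le1.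
have E2 : expR (gamma * (K - J)) <= E.
  have y1 : gamma * (K - J) <= gamma * h * V0 by rewrite -mulrA ler_wpM2l//; lra.
  have y2 : - (gamma * h * V0) <= gamma * (K - J).
    by rewrite -mulrA -mulrN ler_wpM2l//; lra.
  have ghV : gamma * h * V0 <= 4^-1.
    by rewrite mulrAC -[leRHS]mulr1; apply: ler_pM => //; [exact: mulr_ge0|exact: le_trans hg g1].
  apply: le_trans (expR_le_quadratic _) _; first lra.
  have ysq : (gamma * (K - J)) ^+ 2 <= (gamma * h * V0) ^+ 2.
    by rewrite -real_normK ?num_real// ler_sqr ?nnegrE ?mulr_ge0// ler_norml y1 y2.
  have s1 : (gamma * h * V0) ^+ 2 <= gamma * h * (gamma * V0 ^+ 2).
    have -> : (gamma * h * V0) ^+ 2 = gamma * h * (gamma * (h * V0 ^+ 2)) by ring.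
    rewrite ler_wpM2l// ler_wpM2l// -[leRHS]mul1r ler_wpM2r//; exact: le_trans hg g1.
  have s2 : gamma * (K - J) <= gamma * h * u + gamma * h * (gamma * V0 ^+ 2) / 2.
    have s3 : h ^+ 2 * dotp v v / (2 * J) <= h * (gamma * V0 ^+ 2) / 2.
      have -> : h ^+ 2 * dotp v v / (2 * J) = h * (h * dotp v v * J^-1) / 2 by field; lra.
      rewrite ler_wpM2r// ler_wpM2l// -[leRHS]mulr1.
      by apply: ler_pM => //; [rewrite mulr_ge0|apply: ler_pM].
    have : gamma * (K - J) <= gamma * (h * u + h * (gamma * V0 ^+ 2) / 2).
      by rewrite ler_wpM2l//; lra.
    lra.
  rewrite /E; lra.
(* This bound turns the 8 of F into the 16 of [weight_slope]; likewise 1 + gamma T <= 2 turns 5/2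
   into 5. *)
have E22 : E <= 2.
  have -> : E = 1 + (h * (gamma * u) + h * gamma * (5 / 2 * gamma * V0 ^+ 2)) by rewrite /E; ring.
  have h1 : h <= 1 by exact: le_trans hg g1.
  have b1 : h * (gamma * u) <= 4^-1.
    apply: (@le_trans _ _ (h * 4^-1)); last by rewrite -[leRHS]mul1r ler_wpM2r.
    by rewrite ler_wpM2l//; apply: le_trans gV; rewrite ler_wpM2l//; case/andP: uV.
  have b2 : h * gamma * (5 / 2 * gamma * V0 ^+ 2) <= 1 * (5 / 12).
    apply: ler_pM; rewrite ?mulr_ge0//; last lra.
    by rewrite -[leRHS]mulr1; apply: ler_pM.
  lra.
have F0 : 1 + gamma * T' <= F.
  rewrite /F -addrA lerD2l; have := ler_wpM2l g0 ts; rewrite mulrDr.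
  have -> : gamma * (8 * h * V0 ^+ 2 / J) = 8 * gamma * h * V0 ^+ 2 / J by ring.
  by [].
have FJ0 : 0 <= 8 * gamma * h * V0 ^+ 2 / J by rewrite !mulr_ge0.
have F00 : 0 <= F by rewrite /F; lra.
have -> : gamma * K = gamma * J + gamma * (K - J) by ring.
rewrite expRD; set q := expR (gamma * J); have q_gt0 : 0 < q by exact: expR_gt0.
have main : expR (gamma * (K - J)) * (1 + gamma * T') <= E * F.
  apply: (@le_trans _ _ (expR (gamma * (K - J)) * F)).
    by rewrite ler_wpM2l// expR_ge0.
  by rewrite ler_wpM2r.
rewrite -mulrA; apply: (@le_trans _ _ (q * (E * F))); first by rewrite ler_wpM2l// ltW.
have -> : q * (1 + gamma * T) + h * (gamma * q * (u * (1 + gamma * T) + 5 * gamma * V0 ^+ 2 + 16 * V0 ^+ 2 / J))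
  = q * ((1 + gamma * T) + gamma * h * (u * (1 + gamma * T) + 5 * gamma * V0 ^+ 2 + 16 * V0 ^+ 2 / J)) by ring.
rewrite ler_wpM2l ?(ltW q_gt0)// /F mulrDr.
have a1 : E * (8 * gamma * h * V0 ^+ 2 / J) <= 2 * (8 * gamma * h * V0 ^+ 2 / J) by rewrite ler_wpM2r.
have a2 : (gamma * h) * (5 / 2 * gamma * V0 ^+ 2 * (1 + gamma * T)) <= (gamma * h) * (5 * gamma * V0 ^+ 2).
  have T2 : 1 + gamma * T <= 2 by lra.
  have c0 : 0 <= 5 / 2 * gamma * V0 ^+ 2 by rewrite !mulr_ge0.
  by rewrite ler_wpM2l//; have := ler_wpM2l c0 T2; lra.
rewrite {1}/E; lra.
Qed.

Lemma weight_slope_bound (z : 'rV[R]_d * 'rV[R]_d) : enorm z.2 <= V0 ->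
  `|weight_slope z| <= (2 * V0 + 21 * V0 ^+ 2) * exp_weight gamma z.
Proof.
move=> vV; have [g1 gV gV2] := gamma_bounds; have g0 := ltW gamma_gt0.
have q0 := exp_weight_gt0 z; have J1 := jap_ge1 z.1.
have J0 : 0 < jap z.1 by exact: lt_le_trans J1.
have := dotp_jap_le z.1 vV; have /andP[t1 t2] := gamma_tilt z.1 vV => uV.
rewrite /weight_slope normrM (@ger0_norm _ (_ * _)) ?mulr_ge0 ?(ltW q0)//.
rewrite [leRHS]mulrC -mulrA mulrCA ler_wpM2l ?(ltW q0)//.
rewrite -[leRHS]mul1r ler_pM//.
apply: le_trans (ler_normD _ _) _.
have V2 : 0 <= V0 ^+ 2 by exact: sqr_ge0.
have V00 := ltW V0_gt0.
have iJ : 16 * V0 ^+ 2 / jap z.1 <= 16 * V0 ^+ 2.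
  have i1 : (jap z.1)^-1 <= 1 by rewrite invf_le1.
  by have := ler_wpM2l (mulr_ge0 (ler0n R 16) V2) i1; rewrite mulr1.
have iJ0 : 0 <= 16 * V0 ^+ 2 / jap z.1 by rewrite !mulr_ge0// ?invr_ge0 ?(ltW J0).
have gV5 : 5 * gamma * V0 ^+ 2 <= 5 * V0 ^+ 2.
  by rewrite -[5 * gamma * _]mulrA ler_wpM2l// -[leRHS]mul1r ler_wpM2r.
have gV50 : 0 <= 5 * gamma * V0 ^+ 2 by rewrite !mulr_ge0.
rewrite (@ger0_norm _ (16 * _ / _))//.
apply: le_trans (lerD (ler_normD _ _) (lexx _)) _.
rewrite (@ger0_norm _ (5 * _ * _))// normrM.
have : `|dotp z.1 z.2 / jap z.1| * `|1 + gamma * tilt z.1 z.2| <= V0 * 2.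
  by apply: ler_pM => //; rewrite ler_norml; apply/andP; split; lra.
lra.
Qed.

Lemma weight_slope_le (z : 'rV[R]_d * 'rV[R]_d) : enorm z.2 <= V0 ->
  weight_slope z <= 2 * (2 * V0 + 21 * V0 ^+ 2) * weight z.
Proof.
move=> vV; have := weight_slope_bound vV; have /andP[w1 _] := weight_bounds vV.
move=> /(le_trans (ler_norm _))/le_trans; apply.
have c0 : 0 <= 2 * V0 + 21 * V0 ^+ 2.
  by rewrite addr_ge0// mulr_ge0 ?sqr_ge0 ?(ltW V0_gt0).
have := ler_wpM2l c0 w1; lra.
Qed.

Lemma measurable_exp_weight : measurable_fun setT (exp_weight gamma : 'rV[R]_d * 'rV[R]_d -> R).
Proof.
apply: (measurableT_comp (@measurable_expR R)); apply: measurable_funM => //.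
exact: (measurableT_comp measurable_jap).
Qed.

Lemma measurable_jap_inv : measurable_fun setT (fun z : 'rV[R]_d * 'rV[R]_d => (jap z.1)^-1).
Proof.
pose g (u : R) := (Num.sqrt (1 + u ^+ 2))^-1.
have cg : continuous g.
  move=> u; apply: cvgV.
    by rewrite gt_eqF// sqrtr_gt0 ltr_pwDl// sqr_ge0.
  apply: (@continuous_comp _ _ _ (fun u : R => 1 + u ^+ 2) Num.sqrt); last exact: sqrt_continuous.
  by apply: cvgD; [exact: cvg_cst|exact: exprn_continuous].
have mf : measurable_fun setT (fun z : 'rV[R]_d * 'rV[R]_d => enorm z.1).
  exact: (measurableT_comp (@measurable_enorm R d) measurable_fst).
exact: (measurableT_comp (continuous_measurable_fun cg) mf).
Qed.

Lemma measurable_tilt : measurable_fun setT (fun z : 'rV[R]_d * 'rV[R]_d => tilt z.1 z.2).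
Proof.
apply: measurable_funM; last exact: measurable_jap_inv.
apply: measurable_funB; first exact: measurable_dotpp.
by apply: measurable_funM => //; apply: measurableT_comp => //; exact: measurable_dotpp.
Qed.

Lemma measurable_weight : measurable_fun setT weight.
Proof.
apply: measurable_funM; first exact: measurable_exp_weight.
by apply: measurable_funD => //; apply: measurable_funM => //; exact: measurable_tilt.
Qed.

Lemma measurable_weight_slope : measurable_fun setT weight_slope.
Proof.
apply: measurable_funM.
  by apply: measurable_funM => //; exact: measurable_exp_weight.
apply: measurable_funD; last by apply: measurable_funM => //; exact: measurable_jap_inv.
apply: measurable_funD => //; apply: measurable_funM.
  by apply: measurable_funM; [exact: measurable_dotpp|exact: measurable_jap_inv].
by apply: measurable_funD => //; apply: measurable_funM => //; exact: measurable_tilt.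
Qed.

(** The part of the tilt linear in v has mean 0 by symmetry; only the term in |x . v| survives, with
    a negative sign. *)
Lemma weight_mean x : \int[vol]_(v in V) weight (x, v) =
  exp_weight gamma (x, 0) * (1 - gamma * delta * mean_abs_dotp V0 x / jap x).
Proof.
have mV : measurable V by exact: measurable_V.
have ip : vol.-integrable V (EFin \o (fun v => dotp x v)).
  apply: (@bounded_integrable_V _ _ _ volV _ (enorm x * V0)); first exact: measurable_dotpl.
  move=> v /ltW Vv; rewrite (le_trans (norm_dotp_le _ _))//.
  by rewrite ler_wpM2l ?enorm_ge0.
have ia : vol.-integrable V (EFin \o (fun v => `|dotp x v|)) by exact: integrable_norm_dotp.
have i1 : vol.-integrable V (EFin \o (fun v : 'rV[R]_d => 1)).
  by apply: (@bounded_integrable_V _ _ _ volV _ 1) => // v _; rewrite normr1.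
pose c := gamma / jap x.
transitivity (\int[vol]_(v in V) (exp_weight gamma (x, 0) *
    ((1 + c * dotp x v) - c * delta * `|dotp x v|))).
  by apply: eq_Rintegral => v _; rewrite /weight /exp_weight/= /tilt /c; ring.
have i2 := RintegrableD mV i1 (RintegrableZ mV c ip).
have i3 := RintegrableZ mV (c * delta) ia.
rewrite RintegralZl//; last exact: RintegrableB.
rewrite RintegralB// RintegralD//; last exact: RintegrableZ.
rewrite !RintegralZl// integral_dotp// Rintegral_cst// [X in fine X](_ : _ = 1%E)//=.
by rewrite -/(mean_abs_dotp V0 x) /c; ring.
Qed.

Local Notation a0 := ((1 - chi) * delta * A).
Local Notation B := (16 * V0 ^+ 2 + a0).

(** After division by gamma e^(gamma <x>), the transport term (x . v) / <x> cancels against the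
    tumbling of the tilt. What remains is - chi |x . v| / <x>, which absorbs the correction in
    delta, and the mean of the weight, which yields - a0 up to errors in 1 / <x> and in gamma. *)
Lemma lyapunov x v : gamma * (14 * V0 ^+ 2) <= a0 -> enorm v <= V0 ->
  weight_slope (x, v)
  + tumble chi x v * (\int[vol]_(v' in V) weight (x, v') - weight (x, v))
  <= - (gamma * a0 / 8) * weight (x, v) + gamma * B * expR (gamma * (4 * B / a0)).
Proof.
move=> ga vV; have [c0 c1 A0 g0] := And4 chi_gt0 chi_lt1 A_gt0 gamma_gt0.
have J1 := jap_ge1 x; have J0 : 0 < jap x by exact: lt_le_trans J1.
have a00 : 0 < a0 by rewrite !mulr_gt0// ?subr_gt0// invr_gt0.
have V2 : 0 <= V0 ^+ 2 by exact: sqr_ge0.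
have B0 : 0 < B by rewrite ltr_wpDl// mulr_ge0.
have /andP[_ w2] := @weight_bounds (x, v) vV.
rewrite weight_mean /weight_slope {1 2}/weight /exp_weight/= /tumble.
set q := expR (gamma * jap x) in w2 *; have q0 : 0 < q by exact: expR_gt0.
have uV := dotp_jap_le x vV; have TV := tilt_le x vV; set T := tilt x v in TV *.
have aL : A * (jap x - 1) <= mean_abs_dotp V0 x.
  apply: le_trans (lower x); rewrite ler_wpM2l ?(ltW A0)//.
  by have := jap_le_enorm x; lra.
have a_ge0 := mean_abs_dotp_ge0 V0 x.
set a := mean_abs_dotp V0 x in aL a_ge0 *.
set p := dotp x v in uV *; set J := jap x in J1 J0 uV q q0 aL *.
have TE : T = (p - delta * `|p|) / J by [].
set s := Num.sg p; have sp : s * p = `|p| by rewrite /s -normrEsg.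
have sap : s * `|p| = p by rewrite /s -numEsg.
have s1 : - 1 <= s <= 1.
  by rewrite -ler_norml normr_sg lern1 leq_b1.
have K1 : 1 - chi <= 1 + chi * s.
  by case/andP: s1 => /(ler_wpM2l (ltW c0)) + _; lra.
have iJ0 : 0 < J^-1 by rewrite invr_gt0.
have JJ : J * J^-1 = 1 by rewrite divff// gt_eqF.
(* All quantities here are divided by gamma q; s p = |p| and s |p| = p evaluate the tumbling of the
   tilt exactly. *)
have core : p / J * (1 + gamma * T) + 5 * gamma * V0 ^+ 2 + 16 * V0 ^+ 2 / J
    + (1 + chi * s) * (- (delta * a / J) - T) <= - (a0 / 2) + B / J.
  have -> : (1 + chi * s) * (- (delta * a / J) - T) =
     - ((1 + chi * s) * (delta * a / J)) - (p + chi * (s * p)) / J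
      + delta * (`|p| + chi * (s * `|p|)) / J by rewrite TE; ring.
  rewrite sp sap.
  have t1 : p / J * (gamma * T) <= 2 * gamma * V0 ^+ 2.
    have -> : p / J * (gamma * T) = gamma * (p / J * T) by ring.
    have -> : 2 * gamma * V0 ^+ 2 = gamma * (V0 * (2 * V0)) by ring.
    rewrite ler_wpM2l ?(ltW g0)//; apply: le_trans (ler_norm _) _; rewrite normrM.
    by apply: ler_pM.
  have t2 : (1 - chi) * (delta * (A * (J - 1)) / J) <= (1 + chi * s) * (delta * a / J).
    have d0 : 0 <= delta by lra.
    apply: (@le_trans _ _ ((1 - chi) * (delta * a / J))).
      rewrite ler_wpM2l ?subr_ge0 ?(ltW c1)// ler_wpM2r ?(ltW iJ0)//.
      by rewrite ler_wpM2l.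
    by rewrite ler_wpM2r// mulr_ge0 ?(ltW iJ0)// mulr_ge0.
  have t3 : (1 - chi) * (delta * (A * (J - 1)) / J) = a0 - a0 / J.
    transitivity (a0 * (J * J^-1 - J^-1)); first by ring.
    by rewrite JJ; ring.
  (* Here delta = chi / 2 is used: |p| + chi p <= 2 |p|. *)
  have t4 : delta * (`|p| + chi * p) / J <= chi * `|p| / J.
    rewrite ler_wpM2r ?(ltW iJ0)//.
    have := ler_wpM2l (ltW c0) (ler_norm p); have := ler_wpM2r (normr_ge0 p) (ltW c1).
    have d0 : 0 <= delta by lra.
    move=> e1 e2; have e3 : `|p| + chi * p <= 2 * `|p| by lra.
    by have := ler_wpM2l d0 e3; lra.
  (* The errors 2 gamma V0^2 (from t1) and 5 gamma V0^2 sum to 7 gamma V0^2, at most a0 / 2 by the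
     bound on 14 gamma V0^2. *)
  rewrite mulrDr mulr1 !mulrDl; lra.
have mainE : gamma * q * (p / J * (1 + gamma * T) + 5 * gamma * V0 ^+ 2 + 16 * V0 ^+ 2 / J)
   + (1 + chi * s) * (q * (1 - gamma * delta * a / J) - q * (1 + gamma * T))
  = gamma * q * (p / J * (1 + gamma * T) + 5 * gamma * V0 ^+ 2 + 16 * V0 ^+ 2 / J
    + (1 + chi * s) * (- (delta * a / J) - T)) by ring.
rewrite mainE; have gq0 : 0 < gamma * q by rewrite mulr_gt0.
apply: (le_trans (ler_wpM2l (ltW gq0) core)).
(* Far out, J >= 4 B / a0, the error B / J takes half of the decay a0 / 2; in the remaining bounded
   region q is at most the exponential on the right. *)
have qJ : q * (B / J) <= q * (a0 / 4) + B * expR (gamma * (4 * B / a0)).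
  have [hJ|hJ] := leP (4 * B / a0) J.
    apply: (@le_trans _ _ (q * (a0 / 4))); last by rewrite lerDl mulr_ge0 ?expR_ge0 ?(ltW B0).
    rewrite ler_wpM2l ?(ltW q0)// ler_pdivrMr//.
    by move: hJ; rewrite ler_pdivrMr//; lra.
  apply: (@le_trans _ _ (B * expR (gamma * (4 * B / a0)))).
    rewrite mulrC; apply: ler_pM; rewrite ?(ltW q0) ?divr_ge0 ?(ltW B0) ?(ltW J0)//.
      by rewrite ler_pdivrMr// ler_peMr ?(ltW B0).
    by rewrite ler_expR ler_wpM2l ?(ltW g0)// ltW.
  by rewrite lerDr mulr_ge0 ?(ltW q0)// divr_ge0 ?(ltW a00).
have := ler_wpM2l (ltW g0) qJ.
(* The remaining decay - gamma q a0 / 4 becomes - (gamma a0 / 8) times the weight, because the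
   weight is at most 2 q. *)
have ga0 : 0 <= gamma * a0 / 8 by rewrite divr_ge0// mulr_ge0 ?(ltW g0) ?(ltW a00).
have w2' : q * (1 + gamma * T) <= 2 * q by exact: w2.
have := ler_wpM2l ga0 w2'; lra.
Qed.

End weight.

(** * Test functions transported by the free flow *)
Section transport.
Context {R : realType} {d : nat}.
Local Notation X := ('rV[R]_d * 'rV[R]_d)%type.
Local Notation txv := (R * ('rV[R]_d * 'rV[R]_d))%type.
Implicit Types (phi psi : txv -> R) (p : txv).

Definition material_derivative phi p : R := dt phi p + v_grad_x phi p.
Local Notation T := material_derivative.

Lemma material_derivativeM phi psi p : smooth phi -> smooth psi ->
  T (fun q => phi q * psi q) p = phi p * T psi p + psi p * T phi p.
Proof.
move=> sphi spsi; have D w : 'D_w (fun q => phi q * psi q) p =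
    phi p * 'D_w psi p + psi p * 'D_w phi p.
  by have [_ ->] := is_deriveM (smooth_derivable p w sphi) (smooth_derivable p w spsi).
rewrite /T /dt /v_grad_x D.
under eq_bigr do rewrite D mulrDr mulrCA [X in _ + X]mulrCA.
by rewrite big_split -!mulr_sumr/=; ring.
Qed.

Lemma material_derivativeD phi psi p : smooth phi -> smooth psi ->
  T (fun q => phi q + psi q) p = T phi p + T psi p.
Proof.
move=> sphi spsi; have D w : 'D_w (fun q => phi q + psi q) p =
    'D_w phi p + 'D_w psi p.
  by have [_ ->] := is_deriveD (smooth_derivable p w sphi) (smooth_derivable p w spsi).
rewrite /T /dt /v_grad_x D.
under eq_bigr do rewrite D mulrDr.
by rewrite big_split/=; ring.
Qed.

Lemma material_derivative_comp (g : R -> R) phi p : smooth g -> smooth phi ->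
  T (g \o phi) p = 'D_1 g (phi p) * T phi p.
Proof.
move=> sg sphi; have D w : 'D_w (g \o phi) p = 'D_1 g (phi p) * 'D_w phi p.
  by have [_ ->] := is_derive_comp (smooth_derivable p w sphi) (smooth_derivable (phi p) 1 sg).
rewrite /T /dt /v_grad_x D.
under eq_bigr do rewrite D mulrCA.
by rewrite -mulr_sumr mulrDr.
Qed.

Lemma derive_affine phi p w (a b : R) : (forall h : R, phi (h *: w + p) = h * a + b) ->
  'D_w phi p = a.
Proof.
move=> E; suff [_ ->] : is_derive p w phi a by [].
by apply/is_derive_lineP; under eq_fun do rewrite E; exact: is_derive1_affine.
Qed.

Definition time p : R := p.1.
Definition velocity (i : 'I_d) p : R := p.2.2 ord0 i.
Definition position (i : 'I_d) p : R := p.2.1 ord0 i.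

Lemma continuous_velocity i : continuous (velocity i).
Proof.
move=> p; apply: (@continuous_comp _ _ _ (fun p : txv => p.2.2) (fun v : 'rV[R]_d => v ord0 i)).
  by apply: (@continuous_comp _ _ _ (fun p : txv => p.2) snd); exact: cvg_snd.
exact: coord_continuous.
Qed.

Lemma continuous_position i : continuous (position i).
Proof.
move=> p; apply: (@continuous_comp _ _ _ (fun p : txv => p.2.1) (fun v : 'rV[R]_d => v ord0 i)).
  by apply: (@continuous_comp _ _ _ (fun p : txv => p.2) fst); [exact: cvg_snd|exact: cvg_fst].
exact: coord_continuous.
Qed.

Lemma smooth_time : smooth time.
Proof. by apply: smooth_linear => // p; exact: cvg_fst. Qed.

Lemma smooth_velocity i : smooth (velocity i).
Proof.
apply: smooth_linear; first exact: continuous_velocity.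
by move=> p w h; rewrite /velocity /= !mxE.
Qed.

Lemma smooth_position i : smooth (position i).
Proof.
apply: smooth_linear; first exact: continuous_position.
by move=> p w h; rewrite /position /= !mxE.
Qed.

Lemma v_grad_x_sum_delta (F : 'I_d -> R) (c : R) i :
  \sum_(j < d) F j * (c * (i == j)%:R) = c * F i.
Proof.
rewrite (bigD1 i)//= eqxx mulr1 big1 ?addr0 1?mulrC// => j ji.
by rewrite eq_sym (negbTE ji) !mulr0.
Qed.

Lemma material_derivative_time p : T time p = 1.
Proof.
rewrite /T /dt /v_grad_x (@derive_affine _ _ _ 1 p.1); last by move=> h.
rewrite big1 ?addr0// => i _; rewrite (@derive_affine _ _ _ 0 p.1) ?mulr0//.
Qed.

Lemma material_derivative_velocity i p : T (velocity i) p = 0.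
Proof.
rewrite /T /dt /v_grad_x (@derive_affine _ _ _ 0 (velocity i p)); last first.
  by move=> h; rewrite /velocity/= !mxE mulr0.
rewrite big1 ?addr0// => j _; rewrite (@derive_affine _ _ _ 0 (velocity i p)) ?mulr0// => h.
by rewrite /velocity/= !mxE mulr0.
Qed.

Lemma material_derivative_position i p : T (position i) p = velocity i p.
Proof.
rewrite /T /dt /v_grad_x (@derive_affine _ _ _ 0 (position i p)); last first.
  by move=> h; rewrite /position/= !mxE mulr0.
rewrite add0r -[RHS]mul1r -(v_grad_x_sum_delta (fun j => velocity j p)).
apply: eq_bigr => j _; rewrite (@derive_affine _ _ _ (i == j)%:R (position i p)) ?mul1r// => h.
by rewrite /position/= !mxE eqxx/=.
Qed.

Lemma material_derivative_cst (c : R) p : T (cst c) p = 0.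
Proof.
by rewrite /T /dt /v_grad_x derive_cst big1 ?addr0// => i _; rewrite derive_cst mulr0.
Qed.

(** Smooth solutions of the free transport equation. They form an algebra stable under smooth
    functions, so that all test functions come from the coordinates of x - t v and v. *)
Definition transported phi := smooth phi /\ forall p, T phi p = 0.

Lemma transported_cst (c : R) : transported (cst c).
Proof. by split; [exact: smooth_cst|exact: material_derivative_cst]. Qed.

Lemma transportedM phi psi : transported phi -> transported psi ->
  transported (fun p => phi p * psi p).
Proof.
move=> [s1 T1] [s2 T2]; split=> [|p]; first exact: smoothM.
by rewrite material_derivativeM// T1 T2 !mulr0 addr0.
Qed.

Lemma transportedD phi psi : transported phi -> transported psi ->
  transported (fun p => phi p + psi p).
Proof.
move=> [s1 T1] [s2 T2]; split=> [|p]; first exact: smoothD.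
by rewrite material_derivativeD// T1 T2 addr0.
Qed.

Lemma transported_comp (g : R -> R) phi : smooth g -> transported phi ->
  transported (g \o phi).
Proof.
move=> sg [s1 T1]; split=> [|p]; first exact: smooth_comp.
by rewrite material_derivative_comp// T1 mulr0.
Qed.

Lemma transported_sum (I : Type) (r : seq I) (F : I -> txv -> R) :
  (forall i, transported (F i)) -> transported (fun p => \sum_(i <- r) F i p).
Proof.
move=> tF; elim: r => [|i r IH].
  by under eq_fun do rewrite big_nil; exact: transported_cst.
by under eq_fun do rewrite big_cons; exact: transportedD.
Qed.

Lemma transported_velocity i : transported (velocity i).
Proof. by split; [exact: smooth_velocity|exact: material_derivative_velocity]. Qed.

(** The phase point at time 0 of the characteristic passing through z at time t. *)
Definition foot (t : R) (z : X) : X := (z.1 - t *: z.2, z.2).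

Lemma transported_origin i : transported (fun p => (foot p.1 p.2).1 ord0 i).
Proof.
have -> : (fun p : txv => (foot p.1 p.2).1 ord0 i) =
    (fun p => position i p + (-1) * (time p * velocity i p)).
  by apply/funext => p; rewrite /foot/= !mxE mulN1r.
have s2 : smooth (fun p => time p * velocity i p).
  by apply: smoothM; [exact: smooth_time|exact: smooth_velocity].
have s3 : smooth (fun p => (-1) * (time p * velocity i p)).
  by apply: smoothM => //; exact: smooth_cst.
split=> [|p]; first by apply: smoothD => //; exact: smooth_position.
rewrite material_derivativeD//; last exact: smooth_position.
rewrite material_derivative_position (@material_derivativeM (cst (-1)))//; last exact: smooth_cst.
rewrite material_derivativeM; [|exact: smooth_time|exact: smooth_velocity].
by rewrite material_derivative_time material_derivative_velocity material_derivative_cst /cst; ring.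
Qed.

End transport.

(** * Profiles, cutoffs and admissible test functions *)

Section test_functions.
Context {R : realType} {d : nat}.
Variable V0 : R.
Hypothesis V0_gt0 : 0 < V0.
Local Notation X := ('rV[R]_d * 'rV[R]_d)%type.
Local Notation txv := (R * ('rV[R]_d * 'rV[R]_d))%type.
Local Notation T := material_derivative.

(* Smooth, identically 0 for u <= 0, and increasing with n to 1 for u > 0. *)
Definition step (n : nat) (u : R) : R := 1 - expR (- n%:R * flat 1 u).

Lemma step_ge0_le1 n u : 0 <= step n u <= 1.
Proof.
rewrite /step gerBl expR_ge0 andbT subr_ge0 -[leRHS]expR0 ler_expR.
by rewrite mulNr oppr_le0 mulr_ge0// flat1_ge0.
Qed.

Lemma step_eq0 n u : u <= 0 -> step n u = 0.
Proof. by move=> u0; rewrite /step flat1_eq0// mulr0 expR0 subrr. Qed.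

Lemma smooth_step n : smooth (step n).
Proof.
have -> : step n = fun u => 1 + (-1) * expR (- n%:R * flat 1 u).
  by apply/funext => u; rewrite /step mulN1r.
apply: smoothD; first exact: smooth_cst.
apply: smoothM; first exact: smooth_cst.
apply: (smooth_comp smooth_expR (phi := fun u : R => - n%:R * flat 1 u)).
by apply: smoothM; [exact: smooth_cst|exact: smooth_flat].
Qed.

Lemma measurable_step n : measurable_fun setT (step n).
Proof. by apply: continuous_measurable_fun; exact: smooth_continuous (smooth_step n). Qed.

(** The argument may depend on n, as the velocity threshold in [cutoff] does. *)
Lemma cvg_step (u : nat -> R) (eta : R) : 0 < eta -> (\forall n \near \oo, eta <= u n) ->
  step n (u n) @[n --> \oo] --> (1 : R).
Proof.
move=> eta0 hu; have c0 := flat1_gt0 eta0.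
apply/cvgrPdist_le => e e0; near=> n.
have un : eta <= u n by near: n.
rewrite /step opprB addrC subrK ger0_norm ?expR_ge0// mulNr.
have fn : flat 1 eta <= flat 1 (u n).
  have u0 : 0 < u n by exact: lt_le_trans un.
  rewrite /flat eta0 u0 !hornerE ?mul1r ler_expR lerN2.
  by rewrite lef_pV2 ?posrE.
apply: (@le_trans _ _ (expR (- (n%:R * flat 1 eta)))).
  by rewrite ler_expR lerN2 ler_wpM2l.
rewrite expRN -[leRHS]invrK lef_pV2 ?posrE ?invr_gt0 ?expR_gt0//.
apply: le_trans (expR_ge1Dx _); rewrite -[leLHS]add0r lerD// -ler_pdivrMr//.
by near: n; exact: nbhs_infty_ger.
Unshelve. all: by end_near. Qed.

(** Initial data whose free transport is smooth; supports are not restricted, this being left to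
    [cutoff] and to a factor in time. *)
Definition profile (psi : X -> R) := [/\ transported (fun p => psi (foot p.1 p.2)),
  measurable_fun setT psi & forall z, 0 <= psi z <= 1].

Lemma profile1 : profile (cst 1).
Proof. by split; [exact: transported_cst|exact: measurable_cst|by move=> z /=; rewrite lexx ler01]. Qed.

Lemma profileM psi1 psi2 : profile psi1 -> profile psi2 -> profile (fun z => psi1 z * psi2 z).
Proof.
move=> [t1 m1 b1] [t2 m2 b2]; split; first exact: transportedM.
- exact: measurable_funM.
- move=> z; have /andP[? ?] := b1 z; have /andP[? ?] := b2 z.
  by rewrite mulr_ge0//= -[leRHS]mulr1 ler_pM.
Qed.

Lemma profile_step n (phi : X -> R) : transported (fun p => phi (foot p.1 p.2)) ->
  measurable_fun setT phi -> profile (fun z => step n (phi z)).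
Proof.
move=> tphi mphi; split.
- exact: (transported_comp (smooth_step n) tphi).
- exact: (measurableT_comp (measurable_step n)).
- by move=> z; exact: step_ge0_le1.
Qed.

(** Evaluated at the foot of the characteristic, it is itself transported, so that localising
    creates no commutator term. The margin 1/(n + 1) keeps the support away from the boundary of the
    velocity ball. *)
Definition cutoff n (z : X) : R := step n (n%:R - dotp z.1 z.1) *
  step n (V0 ^+ 2 - n.+1%:R^-1 - dotp z.2 z.2).

Lemma transported_sub (c : R) phi : transported phi ->
  transported (fun p : txv => c - phi p).
Proof.
move=> tphi; have -> : (fun p => c - phi p) = (fun p => cst c p + (cst (-1) p * phi p)).
  by apply/funext => p; rewrite /= mulN1r.
by apply: transportedD; [exact: transported_cst|apply: transportedM => //; exact: transported_cst].
Qed.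

Lemma profile_cutoff n : profile (cutoff n).
Proof.
apply: profileM; apply: profile_step.
- apply: transported_sub; apply: transported_sum => i.
  by apply: transportedM; exact: transported_origin.
- apply: measurable_funB => //; apply: measurable_sum => i.
  by apply: measurable_funM; apply: (measurableT_comp (measurable_rV_coord i)).
- apply: transported_sub; apply: transported_sum => i.
  by apply: transportedM; exact: transported_velocity.
- apply: measurable_funB => //; apply: measurable_sum => i.
  by apply: measurable_funM; apply: (measurableT_comp (measurable_rV_coord i)).
Qed.

Lemma cvg_cutoff (z : X) : phase V0 z -> cutoff n z @[n --> \oo] --> (1 : R).
Proof.
move=> [_ Vz]; rewrite -[X in _ --> X]mul1r; apply: cvgM.
  apply: (@cvg_step _ 1) => //; near=> n; rewrite lerBrDr.
  by near: n; exact: nbhs_infty_ger.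
(* Half of the gap to the boundary; the other half absorbs 1/(n + 1) for large n. *)
pose eta := (V0 ^+ 2 - dotp z.2 z.2) / 2.
have eta0 : 0 < eta.
  by rewrite divr_gt0// subr_gt0 -enorm_sqr ltr_sqr ?nnegrE ?enorm_ge0// ltW.
apply: (@cvg_step _ eta) => //; near=> n.
have : n.+1%:R^-1 <= eta.
  rewrite -[leRHS]invrK lef_pV2 ?posrE ?invr_gt0//.
  apply: (@le_trans _ _ n%:R); last by rewrite ler_nat.
  by near: n; exact: nbhs_infty_ger.
by rewrite /eta; move: (n.+1%:R^-1) => y; lra.
Unshelve. all: by end_near. Qed.

Lemma smooth_theta (theta : R -> R) : smooth theta -> smooth (fun p : txv => theta p.1).
Proof. by move=> stheta; apply: (smooth_comp stheta smooth_time). Qed.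

Lemma material_derivative_theta (theta : R -> R) (phi : txv -> R) p :
  smooth theta -> transported phi ->
  T (fun p => theta p.1 * phi p) p = 'D_1 theta p.1 * phi p.
Proof.
move=> stheta [sphi Tphi]; rewrite material_derivativeM//; last exact: smooth_theta.
rewrite Tphi mulr0 add0r (material_derivative_comp _ stheta smooth_time).
by rewrite material_derivative_time mulr1 mulrC.
Qed.

Lemma continuous_sum_sqr (F : 'I_d -> txv -> R) : (forall i, smooth (F i)) ->
  continuous (fun p => \sum_(i < d) F i p * F i p).
Proof.
move=> sF; apply: smooth_continuous; apply: smooth_sum => i.
by apply: smoothM; exact: sF.
Qed.

(** The support lies in the closed set K cut out by the time interval and the two thresholds, and K
    lies in a compact box: bounded time and speed keep x close to its foot. *)
Lemma test_function_cutoff n (psi : X -> R) (theta : R -> R) : profile psi ->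
  smooth theta -> compact_in_pos theta ->
  test_function V0 (fun p => theta p.1 * (psi (foot p.1 p.2) * cutoff n (foot p.1 p.2))).
Proof.
move=> npsi stheta [a [b [a0 ab thab]]].
have [[spsi _] _ _] := profileM npsi (profile_cutoff n).
pose G1 (p : txv) := dotp (foot p.1 p.2).1 (foot p.1 p.2).1.
pose G2 (p : txv) := dotp p.2.2 p.2.2.
pose c2 := V0 ^+ 2 - n.+1%:R^-1.
pose K := (@fst R X) @^-1` `[a, b] `&` G1 @^-1` [set u | u <= n%:R] `&` G2 @^-1` [set u | u <= c2].
have cG1 : continuous G1.
  apply: (@continuous_sum_sqr (fun i p => (foot p.1 p.2).1 ord0 i)) => i.
  exact: (transported_origin i).1.
have cG2 : continuous G2.
  by apply: (@continuous_sum_sqr velocity) => i; exact: smooth_velocity.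
have clK : closed K.
  apply: closedI; first apply: closedI.
  - by apply: closed_comp => [p _|]; [exact: cvg_fst|exact: interval_closed].
  - by apply: closed_comp => [p _|]; [exact: cG1|exact: closed_le].
  - by apply: closed_comp => [p _|]; [exact: cG2|exact: closed_le].
have suppK : supp (fun p => theta p.1 * (psi (foot p.1 p.2) * cutoff n (foot p.1 p.2))) `<=` K.
  rewrite /supp; move/closure_id : (clK) => ->; apply: closure_subset => p /= p0.
  split; [split|]; rewrite /K/=.
  - rewrite in_itv/=; apply: contraNT p0 => /thab ->; by rewrite mul0r.
  - rewrite leNgt; apply: contraNN p0 => h; rewrite /cutoff step_eq0 ?mul0r ?mulr0//.
    by rewrite subr_le0 ltW.
  - rewrite leNgt; apply: contraNN p0 => h.
    by rewrite /cutoff [X in _ * (_ * (_ * X))]step_eq0 ?mulr0// subr_le0 ltW.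
have KV p : K p -> enorm p.2.2 < V0.
  move=> [_ /= h]; rewrite -ltr_sqr ?nnegrE ?enorm_ge0 ?(ltW V0_gt0)// enorm_sqr.
  by apply: le_lt_trans h _; rewrite /c2 gtrBl.
split.
- by apply: smoothM => //; exact: smooth_theta.
(* x = foot + t v, where |foot|^2 <= n gives |foot| <= n + 1, and t <= b, |v| < V0. *)
- pose M1 := n%:R + 1 + b * V0.
  have cpt (M : R) : compact [set v : 'rV[R]_d | forall i, `[- M, M]%classic (v ord0 i)].
    by apply: (@rV_compact R d (fun=> `[- M, M]%classic)) => i; exact: segment_compact.
  pose box (M : R) := [set v : 'rV[R]_d | forall i, `[- M, M]%classic (v ord0 i)].
  apply: (@subclosed_compact _ _ (`[a, b]%classic `*` (box M1 `*` box V0))).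
  + exact: closed_closure.
  + by apply: compact_setX; [exact: segment_compact|apply: compact_setX; exact: cpt].
  + move=> p /suppK Kp; have Vp := KV _ Kp; case: Kp => -[/= tab h1] _; split=> //=.
    have vb i : `|p.2.2 ord0 i| <= V0 by apply: le_trans (coord_le i _) (ltW Vp).
    split=> i /=; rewrite in_itv/= -ler_norml//.
    have -> : p.2.1 ord0 i = (foot p.1 p.2).1 ord0 i + p.1 * p.2.2 ord0 i.
      by rewrite /foot/= !mxE subrK.
    apply: (le_trans (ler_normD _ _)); rewrite /M1 lerD//.
      apply: (le_trans (coord_le i _)).
      rewrite -ler_sqr ?nnegrE ?enorm_ge0 ?addr_ge0// enorm_sqr.
      apply: (le_trans h1); have := ler0n R n; nra.
    rewrite in_itv/= in tab; case/andP: tab => ta tb.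
    rewrite normrM ger0_norm; last by apply: ltW; exact: lt_le_trans ta.
    by apply: ler_pM => //; apply: ltW; exact: lt_le_trans ta.
- move=> p /suppK Kp; split; last by split => //=; exact: KV.
  case: Kp => -[/=]; rewrite in_itv/= => /andP[ta _] _ _.
  exact: lt_le_trans ta.
Qed.

End test_functions.

(** * The adjoint of the collision operator *)
Section section_integral.
Context d1 d2 (T1 : measurableType d1) (T2 : measurableType d2) (R : realType).
Variable m2 : {sigma_finite_measure set T2 -> \bar R}.

Lemma measurable_section_integral (f : T1 * T2 -> \bar R) : measurable_fun setT f ->
  measurable_fun setT (fun x => \int[m2]_y f (x, y))%E.
Proof.
move=> mf; rewrite (_ : (fun x => _) =
  (fun x => \int[m2]_y f^\+ (x, y) - \int[m2]_y f^\- (x, y))%E).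
  apply: emeasurable_funB; apply: (@measurable_fun_fubini_tonelli_F _ _ T1 T2 R m2) => //.
    exact: measurable_funepos.
  exact: measurable_funeneg.
apply/funext => x; rewrite integralE.
by under eq_integral do rewrite funepos_comp/=;
   under [X in (_ - X = _)%E]eq_integral do rewrite funeneg_comp/=.
Qed.

Lemma measurable_section_Rintegral (V : set T2) (f : T1 * T2 -> R) :
  measurable V -> measurable_fun setT f ->
  measurable_fun setT (fun x => \int[m2]_(y in V) f (x, y)).
Proof.
move=> mV mf; pose h (z : T1 * T2) : \bar R := (\1_V z.2 * f z)%:E.
apply: (@measurableT_comp _ _ _ _ _ _ (fine : \bar R -> R)); first exact: (@fine_measurable R setT).
have -> : (fun x => \int[m2]_(y in V) (f (x, y))%:E)%E = (fun x => \int[m2]_y h (x, y))%E.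
  apply/funext => x; rewrite integral_mkcond; apply: eq_integral => y _.
  by rewrite patchE /h/= indicE; case: ifP => _; rewrite ?mul1r ?mul0r.
apply: measurable_section_integral; apply/measurable_EFinP => /=.
apply: measurable_funM => //.
by apply: (measurableT_comp (measurable_indic mV)).
Qed.

End section_integral.

Section kernel_adjoint.
Context d1 d2 (T1 : measurableType d1) (T2 : measurableType d2) (R : realType).
Variable m1 : {sigma_finite_measure set T1 -> \bar R}.
Variable m2 : {sigma_finite_measure set T2 -> \bar R}.
Local Notation mu := (m1 \x m2)%E.
Variables (V : set T2) (mV : measurable V) (m2V : m2 V = 1%E).
Local Notation D := ([set: T1] `*` V).
Variables (K : T1 * T2 -> R) (k : R).
Hypotheses (mK : measurable_fun setT K) (Kk : forall z, `|K z| <= k).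

Lemma measurable_cylinder : measurable D.
Proof. exact: measurableX. Qed.
Local Notation mD := measurable_cylinder.

Variables (f : T1 * T2 -> R) (fi : mu.-integrable D (EFin \o f)).

(** The shape of [collision] for an abstract kernel; the two are convertible for the kernel
    [rate chi]. *)
Definition exchange (z : T1 * T2) : R :=
  \int[m2]_(v in V) (K (z.1, v) * f (z.1, v) - K z * f z).

Let g (z : T1 * T2) : R := K z * (f \_ D) z.
Let G (x : T1) : R := \int[m2]_v g (x, v).

Let mem_D x v : ((x, v) \in D) = (v \in V).
Proof. by apply/idP/idP => [/set_mem[_ Vv]|/set_mem Vv]; apply/mem_set. Qed.

Let gE z : D z -> g z = K z * f z.
Proof. by move=> Dz; rewrite /g patchE mem_set. Qed.

Let gV x v : ~ V v -> g (x, v) = 0.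
Proof. by move=> Vv; rewrite /g patchE mem_D memNset// mulr0. Qed.

Let fhi : mu.-integrable setT (EFin \o (f \_ D)).
Proof. by rewrite -restrict_EFin; apply/(integrable_mkcond _ mD). Qed.

Let mg : measurable_fun setT g.
Proof. by apply: measurable_funM => //; exact: Rintegrable_measurable fhi. Qed.

Let gi : mu.-integrable setT (EFin \o g).
Proof.
have := RintegrableM measurableT fhi mK (fun z _ => Kk z).
by under eq_fun do rewrite mulrC.
Qed.

Let giD : mu.-integrable D (EFin \o g).
Proof. by apply: integrableS gi => //; exact: mD. Qed.

Let mG : measurable_fun setT G.
Proof. exact: measurable_section_Rintegral. Qed.

Let cstV (c : R) : m2.-integrable V (EFin \o cst c).
Proof.
apply/integrableP; split; first exact/measurable_EFinP/measurable_cst.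
by rewrite /= (integral_cst _ mV) [X in (_ * X)%E](_ : _ = 1%E) ?mule1 ?ltry.
Qed.

Let section_V (h : T2 -> R) : (forall v, ~ V v -> h v = 0) ->
  \int[m2]_(v in V) h v = \int[m2]_v h v.
Proof.
move=> h0; rewrite Rintegral_mkcond; apply: eq_Rintegral => v _; rewrite patchE.
by case: ifPn => // /negP Vv; rewrite h0// => /mem_set.
Qed.

Let exchangeE z : D z -> m2.-integrable setT (fun v => (g (z.1, v))%:E) ->
  exchange z = G z.1 - g z.
Proof.
case: z => x v [_ /= Vv] gx.
have gxV : m2.-integrable V (EFin \o (fun v => g (x, v))) by apply: integrableS gx.
rewrite /exchange/=.
transitivity (\int[m2]_(v' in V) (g (x, v') - cst (g (x, v)) v')).
  by apply: eq_Rintegral => v' /set_mem Vv'; rewrite !gE//.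
rewrite RintegralB// section_V; last by move=> ? ?; exact: gV.
by rewrite Rintegral_cst// [X in fine X](_ : _ = 1%E)//= mulr1.
Qed.

(** By Fubini almost every section is integrable; only there does the integral of the difference in
    [exchange] split. *)
Let ae_section : {ae mu, forall z, m2.-integrable setT (fun v => (g (z.1, v))%:E)}.
Proof.
have [N [mN N0 hN]] := ae_integrable1 gi; exists (N `*` setT); split.
- exact: measurableX.
- by rewrite product_measure1E// [X in (X * _)%E](_ : _ = 0%E)// mul0e.
- by move=> z /= hz; split => //; apply: hN.
Qed.

Let ae_exchange : {ae mu, forall z, D z -> exchange z = G z.1 - g z}.
Proof. by apply: filterS ae_section => z hz Dz; exact: exchangeE. Qed.

(** The integrand couples v' with all of z, so the section integral is taken over (T1 * T2) * T2
    with z as the parameter. *)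
Lemma measurable_exchange : measurable_fun D exchange.
Proof.
pose h (p : (T1 * T2) * T2) := g (p.1.1, p.2) - g p.1.
have mh : measurable_fun setT h.
  apply: measurable_funB.
    apply: (measurableT_comp (g := fun p : (T1 * T2) * T2 => (p.1.1, p.2)) mg).
    apply/measurable_fun_pairP; split; last exact: measurable_snd.
    exact: (measurableT_comp measurable_fst measurable_fst).
  exact: (measurableT_comp mg measurable_fst).
have := measurable_section_Rintegral m2 mV mh.
move=> /(measurable_funS measurableT (@subsetT _ D)); apply: eq_measurable_fun => z /set_mem Dz.
by apply: eq_Rintegral => v /set_mem Vv; rewrite /h/= !gE//; case: z Dz.
Qed.

(** G does not depend on v and V has mass 1, so the integral over D reduces to one over T1,
    controlled by Fubini for g. *)
Let Gi : mu.-integrable D (EFin \o (fun z => G z.1)).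
Proof.
apply/(integrable_mkcond _ mD); rewrite restrict_EFin.
have mGD : measurable_fun setT ((fun z => G z.1) \_ D).
  apply/(measurable_restrictT _ mD).
  by apply: measurable_funTS; exact: (measurableT_comp mG measurable_fst).
apply/integrable12ltyP; first exact/measurable_EFinP.
have /integrableP[_] := integrable_fubini_F gi; apply: le_lt_trans.
have mFg : measurable_fun setT (fun x => \int[m2]_y (g (x, y))%:E)%E.
  by apply: (@measurable_section_integral _ _ _ _ _ m2 (EFin \o g)); exact/measurable_EFinP.
have -> : (fun x => \int[m2]_y `|(EFin \o ((fun z => G z.1) \_ D)) (x, y)|)%E =
   (fun x => `|G x|%:E)%E.
  apply/funext => x; transitivity (\int[m2]_(y in V) (cst `|G x|%:E) y)%E.
    rewrite [RHS]integral_mkcond; apply: eq_integral => y _ /=.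
    by rewrite !patchE mem_D; case: ifP => _ //=; rewrite normr0.
  by rewrite integral_cst// [X in (_ * X)%E](_ : _ = 1%E) ?mule1.
apply: ge0_le_integral => //.
- by apply/measurable_EFinP; apply: measurableT_comp.
- exact: measurableT_comp.
- move=> x _; rewrite /G /Rintegral /fubini_F/=.
  by case: (\int[m2]_y (g (x, y))%:E)%E => [r| |] //=; rewrite ?normr0 ?leey.
Qed.

Variables (phi : T1 * T2 -> R) (C : R).
Hypotheses (mphi : measurable_fun setT phi) (phiC : forall z, D z -> `|phi z| <= C).

Definition velocity_mean (x : T1) : R := \int[m2]_(v in V) phi (x, v).

Let mphiD : measurable_fun D phi. Proof. exact: measurable_funTS. Qed.

Let phiV x : m2.-integrable V (EFin \o (fun v => phi (x, v))).
Proof.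
apply: (@le_Rintegrable _ _ _ _ _ mV _ (cst C)).
- by apply: measurable_funTS; exact: (measurableT_comp mphi).
- by move=> v Vv; exact: phiC.
- exact: cstV.
Qed.

Lemma measurable_velocity_mean : measurable_fun setT velocity_mean.
Proof. exact: measurable_section_Rintegral. Qed.

Lemma velocity_mean_le x : `|velocity_mean x| <= C.
Proof.
apply: (le_trans (le_normr_Rintegral mV (phiV x))).
apply: (@le_trans _ _ (\int[m2]_(v in V) cst C v)).
  by apply: le_Rintegral => //; [exact: Rintegrable_norm|move=> v Vv; exact: phiC].
by rewrite Rintegral_cst// [X in fine X](_ : _ = 1%E)//= mulr1.
Qed.

Let mmean : measurable_fun setT (fun z : T1 * T2 => velocity_mean z.1).
Proof. exact: (measurableT_comp measurable_velocity_mean measurable_fst). Qed.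

Let Gphi : mu.-integrable D (EFin \o (fun z => G z.1 * phi z)).
Proof. exact: (RintegrableM mD Gi mphiD phiC). Qed.

Let gmean : mu.-integrable D (EFin \o (fun z => g z * velocity_mean z.1)).
Proof.
apply: (RintegrableM mD giD (c := C)); first exact: measurable_funTS.
by move=> z _; exact: velocity_mean_le.
Qed.

(** Both sides equal the integral over x of G(x) times the velocity mean of phi. *)
Let exchange_sides : \int[mu]_(z in D) (G z.1 * phi z) =
  \int[mu]_(z in D) (g z * velocity_mean z.1).
Proof.
congr fine; rewrite integral_mkcond [RHS]integral_mkcond !restrict_EFin.
have i1 : mu.-integrable setT (EFin \o ((fun z => G z.1 * phi z) \_ D)).
  by rewrite -restrict_EFin; apply/(integrable_mkcond _ mD).
have i2 : mu.-integrable setT (EFin \o ((fun z => g z * velocity_mean z.1) \_ D)).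
  by rewrite -restrict_EFin; apply/(integrable_mkcond _ mD).
rewrite -(integral12_prod_meas1 i1) -(integral12_prod_meas1 i2).
apply: ae_eq_integral; first exact: measurableT.
- by case/integrableP: (integrable_fubini_F i1).
- by case/integrableP: (integrable_fubini_F i2).
apply: filterS (ae_integrable1 gi) => x gx _; rewrite /fubini_F.
transitivity (G x * velocity_mean x)%:E.
  transitivity (\int[m2]_(v in V) (G x * phi (x, v))%:E)%E.
    rewrite [RHS]integral_mkcond; apply: eq_integral => v _ /=.
    by rewrite !patchE mem_D; case: ifP.
  rewrite (Rintegrable_fin mV); last exact: RintegrableZ.
  by rewrite RintegralZl.
transitivity (\int[m2]_v (velocity_mean x * g (x, v))%:E)%E.
  by rewrite (Rintegrable_fin measurableT) ?RintegralZl 1?mulrC//; exact: RintegrableZ.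
apply: eq_integral => v _ /=; rewrite patchE mem_D mulrC.
by case: ifPn => // /negP Vv; rewrite gV ?mul0r// => /mem_set.
Qed.

Let ae_exchangeM : ae_eq mu D (EFin \o (fun z => exchange z * phi z))
  (EFin \o (fun z => G z.1 * phi z - g z * phi z)).
Proof.
by apply: filterS ae_exchange => z h Dz /=; rewrite h// mulrBl.
Qed.

Let gphi : mu.-integrable D (EFin \o (fun z => g z * phi z)).
Proof. exact: (RintegrableM mD giD mphiD phiC). Qed.

Let RHSi := RintegrableB mD Gphi gphi.

Lemma integrable_exchange : mu.-integrable D (EFin \o (fun z => exchange z * phi z)).
Proof.
have mQ : measurable_fun D (fun z => exchange z * phi z).
  by apply: measurable_funM => //; exact: measurable_exchange.
apply/integrableP; split; first exact/measurable_EFinP.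
have /integrableP[mr] := RHSi; apply: le_lt_trans; rewrite le_eqVlt; apply/orP; left; apply/eqP.
apply: ae_eq_integral; first exact: mD.
- by apply: measurableT_comp => //; exact/measurable_EFinP.
- exact: measurableT_comp.
- exact: (ae_eq_comp abse ae_exchangeM).
Qed.

Lemma exchange_adjoint : \int[mu]_(z in D) (exchange z * phi z) =
  \int[mu]_(z in D) (f z * (K z * (velocity_mean z.1 - phi z))).
Proof.
transitivity (\int[mu]_(z in D) (G z.1 * phi z - g z * phi z)).
  congr fine; apply: ae_eq_integral; first exact: mD.
  - by case/integrableP: integrable_exchange.
  - by case/integrableP: RHSi.
  - exact: ae_exchangeM.
rewrite RintegralB//; last exact: mD.
rewrite exchange_sides -RintegralB//; last exact: mD.
by apply: eq_Rintegral => z /set_mem Dz; rewrite gE//; ring.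
Qed.

End kernel_adjoint.

(** * Continuous curves in L1 *)
Section L1_continuity.
Context d (T : measurableType d) (R : realType) (mu : {measure set T -> \bar R}).
Context (D : set T) (mD : measurable D).

Definition L1_continuous (h : R -> T -> R) :=
  (forall t, mu.-integrable D (EFin \o h t)) /\
  forall t, \int[mu]_(z in D) `|h s z - h t z| @[s --> t] --> (0 : R).

Variable h : R -> T -> R.
Hypothesis hc : L1_continuous h.

Lemma L1_continuousM (k : T -> R) (C : R) : measurable_fun D k ->
  (forall z, D z -> `|k z| <= C) -> L1_continuous (fun t z => h t z * k z).
Proof.
have [hi hcont] := hc.
move=> mk kC; have hki t : mu.-integrable D (EFin \o (fun z => h t z * k z)).
  exact: (RintegrableM mD (hi t) mk kC).
split=> // t.
have b s : \int[mu]_(z in D) `|h s z * k z - h t z * k z| <=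
    C * \int[mu]_(z in D) `|h s z - h t z|.
  have ii := Rintegrable_norm (RintegrableB mD (hi s) (hi t)).
  rewrite -RintegralZl//; apply: le_Rintegral => //.
  - exact/Rintegrable_norm/RintegrableB.
  - exact: RintegrableZ.
  - by move=> z Dz; rewrite -mulrBl normrM mulrC ler_wpM2r// kC.
apply: (squeeze_cvgr (f := cst 0) (h := fun s => C * \int[mu]_(z in D) `|h s z - h t z|)).
- by near=> s; rewrite b andbT Rintegral_ge0.
- exact: cvg_cst.
- by rewrite -[X in _ --> X](mulr0 C); apply: cvgM; [exact: cvg_cst|exact: hcont].
Unshelve. all: by end_near. Qed.

Lemma L1_continuous_norm : L1_continuous (fun t z => `|h t z|).
Proof.
have [hi hcont] := hc; split=> [t|t]; first exact: Rintegrable_norm.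
have b s : \int[mu]_(z in D) `|(`|h s z|) - (`|h t z|)| <=
    \int[mu]_(z in D) `|h s z - h t z|.
  apply: le_Rintegral => //.
  - by apply/Rintegrable_norm/RintegrableB => //; exact: Rintegrable_norm.
  - exact/Rintegrable_norm/RintegrableB.
  - by move=> z Dz; exact: ler_dist_dist.
apply: (squeeze_cvgr (f := cst 0) (h := fun s => \int[mu]_(z in D) `|h s z - h t z|)).
- by near=> s; rewrite b andbT Rintegral_ge0.
- exact: cvg_cst.
- exact: hcont.
Unshelve. all: by end_near. Qed.

(** Split h_s u_s = (h_s - h_t) u_s + h_t u_s: the first term is small by L1 continuity and the
    uniform bound on u, the second converges by domination by C |h_t|. *)
Lemma L1_continuous_pairing (u : R -> T -> R) (C : R) :
  (forall t, measurable_fun D (u t)) -> (forall t z, D z -> `|u t z| <= C) ->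
  (forall z, D z -> continuous (u ^~ z)) ->
  continuous (fun t => \int[mu]_(z in D) (h t z * u t z)).
Proof.
have [hi hcont] := hc; move=> mu_ uC cu t.
have i1 s r : mu.-integrable D (EFin \o (fun z => h s z * u r z)).
  by apply: (RintegrableM mD (hi s) (mu_ r)) => z; exact: uC.
have i2 s : mu.-integrable D (EFin \o (fun z => (h s z - h t z) * u s z)).
  by apply: (RintegrableM mD _ (mu_ s)) => [|z]; [exact: RintegrableB|exact: uC].
have -> : (fun s => \int[mu]_(z in D) (h s z * u s z)) =
  (fun s => \int[mu]_(z in D) ((h s z - h t z) * u s z) + \int[mu]_(z in D) (h t z * u s z)).
  apply/funext => s; rewrite -RintegralD//; apply: eq_Rintegral => z _; ring.
apply: (@cvg_trans _ (nbhs (0 + \int[mu]_(z in D) (h t z * u t z)))); last first.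
  rewrite (_ : \int[mu]_(z in D) ((h t z - h t z) * u t z) = 0) //.
  rewrite (@eq_Rintegral _ _ _ _ _ (cst 0)) ?Rintegral_cst ?mul0r// => z _.
  by rewrite subrr mul0r.
apply: cvgD.
  have b s : `|\int[mu]_(z in D) ((h s z - h t z) * u s z)| <=
      C * \int[mu]_(z in D) `|h s z - h t z|.
    have ii := Rintegrable_norm (RintegrableB mD (hi s) (hi t)).
    apply: (le_trans (le_normr_Rintegral mD (i2 s))).
    rewrite -RintegralZl//; apply: le_Rintegral => //.
    - exact: Rintegrable_norm.
    - exact: RintegrableZ.
    - by move=> z Dz; rewrite normrM mulrC ler_wpM2r// uC.
  apply/norm_cvg0P.
  apply: (squeeze_cvgr (f := cst 0) (h := fun s => C * \int[mu]_(z in D) `|h s z - h t z|)).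
  - by apply: nearW => s /=; rewrite b normr_ge0.
  - exact: cvg_cst.
  - by rewrite -[X in _ --> X](mulr0 C); apply: cvgM; [exact: cvg_cst|exact: hcont].
have := @continuity_under_integral R _ T mu (fun s z => h t z * u s z) D mD (t - 1) (t + 1)
  (fun s _ => i1 t s).
move=> /(_ _ (fun z => C * `|h t z|)); apply.
- by apply: aeW => z Dz s _; apply: cvgM; [exact: cvg_cst|exact: cu].
- exact/RintegrableZ/Rintegrable_norm.
- by move=> s _; apply: aeW => z Dz; rewrite normrM mulrC ler_wpM2r// uC.
- by apply/mem_set => /=; rewrite in_itv/=; apply/andP; split; lra.
Unshelve. all: by end_near. Qed.

Lemma L1_continuous_Rintegral : continuous (fun t => \int[mu]_(z in D) h t z).
Proof.
have -> : (fun t => \int[mu]_(z in D) h t z) = (fun t => \int[mu]_(z in D) (h t z * 1)).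
  by apply/funext => t; apply: eq_Rintegral => z _; rewrite mulr1.
apply: (L1_continuous_pairing (u := fun _ _ => 1) (C := 1)).
- by move=> t; exact: measurable_cst.
- by move=> t z _; rewrite normr1.
- by move=> z _ t; exact: cst_continuous.
Qed.

End L1_continuity.

Section dominated.
Context d (T : measurableType d) (R : realType) (mu : {measure set T -> \bar R}).
Context (D : set T) (mD : measurable D).

Lemma Rintegral_dominated_cvg (f_ : nat -> T -> R) (f g : T -> R) :
  (forall n, measurable_fun D (f_ n)) -> measurable_fun D f ->
  (forall z, D z -> f_ n z @[n --> \oo] --> f z) ->
  mu.-integrable D (EFin \o g) -> (forall n z, D z -> `|f_ n z| <= g z) ->
  \int[mu]_(z in D) f_ n z @[n --> \oo] --> \int[mu]_(z in D) f z.
Proof.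
move=> mf_ mf ff gi fg.
have [|||||fi _ h] := @dominated_convergence _ T R mu D mD (fun n => EFin \o f_ n)
  (EFin \o f) (EFin \o g).
- by move=> n; exact/measurable_EFinP.
- exact/measurable_EFinP.
- by apply: aeW => z Dz; apply: cvg_EFin; [exact: nearW|exact: ff].
- exact: gi.
- by apply: aeW => z n Dz; rewrite /= lee_fin; exact: fg.
by apply: fine_cvg; rewrite fineK//; exact: integrable_fin_num.
Qed.

End dominated.

(** * Duhamel's formula *)
Section evolution.
Context {R : realType} {d : nat}.
Variables chi V0 : R.
Hypotheses (chi_gt0 : 0 < chi) (chi_lt1 : chi < 1).
Hypothesis volV : lebesgue_rV d (velocities V0) = 1%E.
Local Notation vol := (lebesgue_rV d).
Local Notation V := (@velocities R d V0).
Local Notation X := ('rV[R]_d * 'rV[R]_d)%type.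
Local Notation D := (@phase R d V0).
Local Notation mu := (@dxdv R d).
Local Notation leb := (@lebesgue_measure R).
Implicit Types (phi psi : X -> R) (z : X).

Definition rate z : R := tumble chi z.1 z.2.

Lemma measurable_sgr : measurable_fun setT (@Num.sg R).
Proof.
rewrite (_ : Num.sg = (fun u => \1_`]0, +oo[%classic u - \1_`]-oo, 0[%classic u)).
  by apply: measurable_funB; exact: measurable_indic.
apply/funext => u; rewrite !indicE !mem_setE !in_itv/= andbT.
by case: sgrP; rewrite ?subrr ?subr0 ?sub0r.
Qed.

Lemma measurable_rate : measurable_fun setT rate.
Proof.
apply: measurable_funD => //; apply: measurable_funM => //.
exact: (measurableT_comp measurable_sgr (@measurable_dotpp R d)).
Qed.

Lemma rate_bounds z : 0 <= rate z <= 2.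
Proof.
rewrite /rate /tumble; have := chi_gt0; have := chi_lt1.
by case: sgrP => _ c0 c1; apply/andP; split; lra.
Qed.

Lemma norm_rate_le z : `|rate z| <= 2.
Proof. by have /andP[a b] := rate_bounds z; rewrite ger0_norm. Qed.

Lemma measurable_phase : measurable D.
Proof. by apply: measurableX => //; exact: measurable_V. Qed.
Local Notation mD := measurable_phase.

Lemma measurable_foot t : measurable_fun setT (@foot R d t).
Proof.
apply: measurable_fun_pair; last exact: measurable_snd.
apply: measurable_fun_rVP => i.
rewrite (_ : _ \o _ = (fun z : X => z.1 ord0 i - t * z.2 ord0 i)); last first.
  by apply/funext => z; rewrite /= /rV_coord !mxE.
apply: measurable_funB; last apply: measurable_funM => //.
  exact: (measurableT_comp (measurable_rV_coord i) measurable_fst).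
exact: (measurableT_comp (measurable_rV_coord i) measurable_snd).
Qed.

(* The adjoint of f |-> collision f + 2 f, which preserves positivity since the
   tumbling rate is at most 2. *)
Definition gain_adj phi z : R :=
  rate z * (velocity_mean vol V phi z.1 - phi z) + 2 * phi z.

Definition transport phi t z : R := phi (foot t z).

Lemma measurable_transport phi t : measurable_fun setT phi ->
  measurable_fun setT (transport phi t).
Proof. by move=> mphi; apply: (measurableT_comp mphi); exact: measurable_foot. Qed.

Lemma measurable_gain_adj phi : measurable_fun setT phi ->
  measurable_fun setT (gain_adj phi).
Proof.
move=> mphi; apply: measurable_funD; last exact: measurable_funM.
apply: measurable_funM; first exact: measurable_rate.
apply: measurable_funB => //.
have mv := measurable_velocity_mean vol (@measurable_V R d V0) mphi.
exact: (measurableT_comp mv measurable_fst).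
Qed.

(** 6 = 2 (1 + 1) + 2, the rate being at most 2. *)
Lemma gain_adj_le phi (C : R) : measurable_fun setT phi ->
  (forall z, D z -> `|phi z| <= C) -> forall z, D z -> `|gain_adj phi z| <= 6 * C.
Proof.
move=> mphi phiC z Dz.
have mC := velocity_mean_le (@measurable_V R d V0) volV mphi phiC z.1.
have pC := phiC z Dz; rewrite /gain_adj.
apply: (le_trans (ler_normD _ _)); rewrite !normrM.
have h1 : `|rate z| * `|velocity_mean vol V phi z.1 - phi z| <= 2 * (C + C).
  apply: ler_pM => //; first exact: norm_rate_le.
  by apply: (le_trans (ler_normB _ _)); exact: lerD.
rewrite (@ger0_norm _ 2)//; lra.
Qed.

Lemma integrable_V_bounded phi (C : R) : measurable_fun setT phi ->
  (forall z, D z -> `|phi z| <= C) -> forall x,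
  vol.-integrable V (EFin \o (fun v => phi (x, v))).
Proof.
move=> mphi phiC x; apply: (@bounded_integrable_V _ _ _ volV _ C).
  exact: (measurableT_comp mphi).
by move=> v Vv; apply: phiC.
Qed.

Lemma gain_adj_linear phi psi (a C : R) : measurable_fun setT phi -> measurable_fun setT psi ->
  (forall z, D z -> `|phi z| <= C) -> (forall z, D z -> `|psi z| <= C) ->
  forall z, gain_adj (fun z => a * phi z + psi z) z = a * gain_adj phi z + gain_adj psi z.
Proof.
move=> mphi mpsi hphi hpsi z; rewrite /gain_adj.
have mV := @measurable_V R d V0.
have i1 := integrable_V_bounded mphi hphi z.1.
have i2 := integrable_V_bounded mpsi hpsi z.1.
have -> : velocity_mean vol V (fun z => a * phi z + psi z) z.1 =
    a * velocity_mean vol V phi z.1 + velocity_mean vol V psi z.1.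
  by rewrite /velocity_mean (RintegralD mV (RintegrableZ mV a i1) i2) (RintegralZl _ mV i1).
by ring.
Qed.

Lemma gain_adj_mono phi psi (C : R) : measurable_fun setT phi -> measurable_fun setT psi ->
  (forall z, D z -> `|phi z| <= C) ->
  (forall x, vol.-integrable V (EFin \o (fun v => psi (x, v)))) ->
  (forall z, D z -> `|phi z| <= psi z) -> forall z, D z -> `|gain_adj phi z| <= gain_adj psi z.
Proof.
move=> mphi mpsi hphi ipsi h z Dz; rewrite /gain_adj; have mV := @measurable_V R d V0.
have i1 := integrable_V_bounded mphi hphi z.1.
have m1 : `|velocity_mean vol V phi z.1| <= velocity_mean vol V psi z.1.
  apply: (le_trans (le_normr_Rintegral mV i1)); apply: le_Rintegral => //.
    exact: Rintegrable_norm.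
  by move=> v Vv; apply: h.
(* In this form both coefficients are visibly nonnegative. *)
have e p q : rate z * (p - q) + 2 * q = rate z * p + (2 - rate z) * q by ring.
have /andP[r0 r2] := rate_bounds z.
rewrite !e; apply: (le_trans (ler_normD _ _)); rewrite !normrM (ger0_norm r0).
rewrite (@ger0_norm _ (2 - rate z)) ?subr_ge0//.
by apply: lerD; apply: ler_wpM2l; rewrite ?subr_ge0// h.
Qed.

Variable g : R -> X -> R.
Hypothesis hg : L1_continuous mu D g.

(* Duhamel's formula for the semigroup generated by - v . grad_x - 2, tested
   against phi.  At time t the test function is transported to phi (foot t z). *)
Definition pairing phi t : R := expR (2 * t) * \int[mu]_(z in D) (g t z * transport phi t z).
Definition gain_pairing phi t : R :=
  expR (2 * t) * \int[mu]_(z in D) (g t z * gain_adj (transport phi t) z).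

(** Measurability in time is part of the property, because in the monotone class argument
    [gain_pairing] is only known as a pointwise limit. *)
Definition duhamel phi := measurable_fun setT (gain_pairing phi) /\
  forall s t, 0 <= s -> s < t ->
  pairing phi t - pairing phi s = \int[leb]_(r in `[s, t]) gain_pairing phi r.

Lemma continuous_mass : continuous (fun t => \int[mu]_(z in D) `|g t z|).
Proof.
exact: (L1_continuous_Rintegral mD (L1_continuous_norm mD hg)).
Qed.

Lemma gain_pairing_le phi (C : R) : measurable_fun setT phi ->
  (forall z, D z -> `|phi z| <= C) -> forall t,
  `|gain_pairing phi t| <= expR (2 * t) * (6 * C * \int[mu]_(z in D) `|g t z|).
Proof.
move=> mphi phiC t; rewrite /gain_pairing normrM (ger0_norm (expR_ge0 _)).
rewrite ler_wpM2l ?expR_ge0//.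
have mt := measurable_transport t mphi.
have tC z : D z -> `|transport phi t z| <= C by move=> Dz; apply: phiC.
have ig : mu.-integrable D (EFin \o (fun z => g t z * gain_adj (transport phi t) z)).
  apply: (RintegrableM mD (hg.1 t) (c := 6 * C)).
    by apply: measurable_funTS; exact: measurable_gain_adj.
  by move=> z; exact: gain_adj_le.
apply: (le_trans (le_normr_Rintegral mD ig)).
have gn := Rintegrable_norm (hg.1 t).
rewrite -RintegralZl//; last exact: mD.
apply: le_Rintegral; [exact: mD|exact: Rintegrable_norm|exact: (RintegrableZ mD)|].
by move=> z Dz; rewrite normrM mulrC ler_wpM2r//; exact: gain_adj_le.
Qed.

Lemma integrable_gain_pairing phi (C : R) : measurable_fun setT phi ->
  (forall z, D z -> `|phi z| <= C) -> measurable_fun setT (gain_pairing phi) ->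
  forall s t, leb.-integrable `[s, t] (EFin \o gain_pairing phi).
Proof.
move=> mphi phiC mG s t.
apply: (@le_Rintegrable _ _ _ leb `[s, t]%classic (measurable_itv _) _
  (fun t => expR (2 * t) * (6 * C * \int[mu]_(z in D) `|g t z|))).
- exact: measurable_funTS.
- by move=> r _; exact: gain_pairing_le.
- apply: continuous_integrable_itv => r; apply: cvgM.
    apply: (@continuous_comp _ _ _ (fun t : R => 2 * t) expR); last exact: continuous_expR.
    by apply: cvgM; [exact: cvg_cst|exact: cvg_id].
  by apply: cvgM; [exact: cvg_cst|exact: continuous_mass].
Qed.

(** Stability under bounded pointwise convergence: dominated convergence in the velocity mean, then
    on phase space, then in time. *)
Lemma duhamel_cvg (phi_ : nat -> X -> R) phi (C : R) :
  (forall n, measurable_fun setT (phi_ n)) -> measurable_fun setT phi ->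
  (forall n z, D z -> `|phi_ n z| <= C) ->
  (forall z, D z -> phi_ n z @[n --> \oo] --> phi z) ->
  (forall n, duhamel (phi_ n)) -> duhamel phi.
Proof.
move=> mn mphi nC cphi dn; have mV := @measurable_V R d V0.
have phiC z : D z -> `|phi z| <= C.
  move=> Dz; have h : `|phi_ n z| @[n --> \oo] --> `|phi z| by apply: cvg_norm; exact: cphi.
  rewrite -(cvg_lim (@norm_hausdorff _ R) h).
  by apply: limr_le; [exact: cvgP h|apply: nearW => n; exact: nC].
have tcvg t z : D z -> transport (phi_ n) t z @[n --> \oo] --> transport phi t z.
  by move=> Dz; apply: cphi.
have mcvg t z : D z -> velocity_mean vol V (transport (phi_ n) t) z.1 @[n --> \oo]
    --> velocity_mean vol V (transport phi t) z.1.
  move=> Dz; apply: (@Rintegral_dominated_cvg _ _ _ _ _ mV _ _ (cst C)).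
  - by move=> n; apply: measurable_funTS; apply: (measurableT_comp (measurable_transport t (mn n))).
  - by apply: measurable_funTS; apply: (measurableT_comp (measurable_transport t mphi)).
  - by move=> v Vv; apply: cphi.
  - by apply: (@bounded_integrable_V _ _ _ volV _ `|C|) => //; exact: measurable_cst.
  - by move=> n v Vv; apply: nC.
have acvg t z : D z -> gain_adj (transport (phi_ n) t) z @[n --> \oo]
    --> gain_adj (transport phi t) z.
  move=> Dz; apply: cvgD; (apply: cvgM; first exact: cvg_cst); last exact: tcvg.
  by apply: cvgB; [exact: mcvg|exact: tcvg].
have trC n t z : D z -> `|transport (phi_ n) t z| <= C by move=> Dz; apply: nC.
have Fcvg t : pairing (phi_ n) t @[n --> \oo] --> pairing phi t.
  apply: cvgM; first exact: cvg_cst.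
  apply: (@Rintegral_dominated_cvg _ _ _ _ _ mD _ _ (fun z => C * `|g t z|)).
  - move=> n; apply: measurable_funM; first exact: Rintegrable_measurable (hg.1 t).
    by apply: measurable_funTS; exact: measurable_transport.
  - apply: measurable_funM; first exact: Rintegrable_measurable (hg.1 t).
    by apply: measurable_funTS; exact: measurable_transport.
  - by move=> z Dz; apply: cvgM; [exact: cvg_cst|exact: tcvg].
  - by apply: RintegrableZ; [exact: mD|exact/Rintegrable_norm/hg.1].
  - by move=> n z Dz; rewrite normrM mulrC ler_wpM2r// trC.
have Gcvg t : gain_pairing (phi_ n) t @[n --> \oo] --> gain_pairing phi t.
  apply: cvgM; first exact: cvg_cst.
  apply: (@Rintegral_dominated_cvg _ _ _ _ _ mD _ _ (fun z => 6 * C * `|g t z|)).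
  - move=> n; apply: measurable_funM; first exact: Rintegrable_measurable (hg.1 t).
    by apply: measurable_funTS; apply: measurable_gain_adj; exact: measurable_transport.
  - apply: measurable_funM; first exact: Rintegrable_measurable (hg.1 t).
    by apply: measurable_funTS; apply: measurable_gain_adj; exact: measurable_transport.
  - by move=> z Dz; apply: cvgM; [exact: cvg_cst|exact: acvg].
  - by apply: RintegrableZ; [exact: mD|exact/Rintegrable_norm/hg.1].
  - move=> n z Dz; rewrite normrM mulrC ler_wpM2r//.
    by apply: gain_adj_le => //; [exact: measurable_transport|exact: trC].
have mG : measurable_fun setT (gain_pairing phi).
  by apply: (measurable_fun_cvg (fun n => (dn n).1)) => t _; exact: Gcvg.
split=> // s t s0 st.
have c1 : pairing (phi_ n) t - pairing (phi_ n) s @[n --> \oo] --> pairing phi t - pairing phi s.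
  by apply: cvgB; exact: Fcvg.
have c2 : pairing (phi_ n) t - pairing (phi_ n) s @[n --> \oo] -->
    \int[leb]_(r in `[s, t]) gain_pairing phi r.
  under eq_fun do rewrite (dn _).2//.
  apply: (@Rintegral_dominated_cvg _ _ _ leb `[s, t]%classic _ _ _
    (fun t => expR (2 * t) * (6 * C * \int[mu]_(z in D) `|g t z|))).
  - exact: measurable_itv.
  - by move=> n; apply: measurable_funTS; exact: (dn n).1.
  - exact: measurable_funTS.
  - by move=> r _; exact: Gcvg.
  - apply: continuous_integrable_itv => r; apply: cvgM.
      apply: (@continuous_comp _ _ _ (fun t : R => 2 * t) expR); last exact: continuous_expR.
      by apply: cvgM; [exact: cvg_cst|exact: cvg_id].
    by apply: cvgM; [exact: cvg_cst|exact: continuous_mass].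
  - by move=> n r _; apply: gain_pairing_le => //; exact: nC.
exact: (cvg_unique (@norm_hausdorff _ R) c1 c2).
Qed.

Lemma duhamel_linear phi psi (a C : R) : measurable_fun setT phi -> measurable_fun setT psi ->
  (forall z, D z -> `|phi z| <= C) -> (forall z, D z -> `|psi z| <= C) ->
  duhamel phi -> duhamel psi -> duhamel (fun z => a * phi z + psi z).
Proof.
move=> mphi mpsi hphi hpsi dphi dpsi.
have ip (f : X -> R) (mf : measurable_fun setT f) (hf : forall z, D z -> `|f z| <= C) t :
    mu.-integrable D (EFin \o (fun z => g t z * transport f t z)).
  apply: (RintegrableM mD (hg.1 t) (c := C)); last by move=> z Dz; apply: hf.
  by apply: measurable_funTS; exact: measurable_transport.
have ig (f : X -> R) (mf : measurable_fun setT f) (hf : forall z, D z -> `|f z| <= C) t :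
    mu.-integrable D (EFin \o (fun z => g t z * gain_adj (transport f t) z)).
  apply: (RintegrableM mD (hg.1 t) (c := 6 * C)).
    by apply: measurable_funTS; apply: measurable_gain_adj; exact: measurable_transport.
  move=> z Dz; apply: gain_adj_le => //; first exact: measurable_transport.
  by move=> z' Dz'; apply: hf.
have pE t : pairing (fun z => a * phi z + psi z) t = a * pairing phi t + pairing psi t.
  rewrite /pairing mulrCA -mulrDr; congr (_ * _).
  rewrite -(RintegralZl _ mD (ip _ mphi hphi t)).
  rewrite -(RintegralD mD (RintegrableZ mD a (ip _ mphi hphi t)) (ip _ mpsi hpsi t)).
  by apply: eq_Rintegral => z _; rewrite /transport; ring.
have gE t : gain_pairing (fun z => a * phi z + psi z) t =
    a * gain_pairing phi t + gain_pairing psi t.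
  rewrite /gain_pairing mulrCA -mulrDr; congr (_ * _).
  rewrite -(RintegralZl _ mD (ig _ mphi hphi t)).
  rewrite -(RintegralD mD (RintegrableZ mD a (ig _ mphi hphi t)) (ig _ mpsi hpsi t)).
  apply: eq_Rintegral => z _.
  rewrite -[transport (fun z => _) t]/(fun z => a * transport phi t z + transport psi t z).
  rewrite (@gain_adj_linear _ _ a C); [by ring|exact: measurable_transport..| |].
    by move=> z' Dz'; apply: hphi.
  by move=> z' Dz'; apply: hpsi.
have mG : measurable_fun setT (gain_pairing (fun z => a * phi z + psi z)).
  rewrite (_ : gain_pairing _ = (fun t => a * gain_pairing phi t + gain_pairing psi t)).
    by apply: measurable_funD; [apply: measurable_funM => //; exact: dphi.1|exact: dpsi.1].
  by apply/funext => t; rewrite gE.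
split=> // s t s0 st; rewrite !pE.
have i1 := integrable_gain_pairing mphi hphi dphi.1 s t.
have i2 := integrable_gain_pairing mpsi hpsi dpsi.1 s t.
have mst : measurable (`[s, t]%classic : set (measurableTypeR R)) by exact: measurable_itv.
transitivity (\int[leb]_(r in `[s, t]) (a * gain_pairing phi r + gain_pairing psi r)); last first.
  by apply: eq_Rintegral => r _; rewrite gE.
rewrite (RintegralD mst (RintegrableZ mst a i1) i2) (RintegralZl _ mst i1).
have /esym -> := dphi.2 _ _ s0 st; have /esym -> := dpsi.2 _ _ s0 st.
by move: (pairing phi s) (pairing phi t) (pairing psi s) (pairing psi t) => *; ring.
Qed.

Hypothesis duhamel_profile : forall psi, profile psi -> duhamel psi.

(** The pi-system of the monotone class argument; products of profiles give its stability under
    intersection. *)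
Let box (A : set X) := exists psi_ : nat -> X -> R,
  (forall n, profile (psi_ n)) /\ forall z, psi_ n z @[n --> \oo] --> (\1_A z : R).

Let box_setI : setI_closed box.
Proof.
move=> A B [a [na ca]] [b [nb cb]]; exists (fun n z => a n z * b n z); split.
  by move=> n; exact: profileM.
by move=> z; rewrite indicI; apply: cvgM; [exact: ca|exact: cb].
Qed.

Let box_gt (phi : X -> R) (a : R) : transported (fun p => phi (foot p.1 p.2)) ->
  measurable_fun setT phi -> box [set z | a < phi z].
Proof.
move=> tphi mphi; exists (fun n z => step n (phi z - a)); split.
  move=> n; apply: profile_step.
    rewrite (_ : (fun p => _) = (fun p => phi (foot p.1 p.2) + cst (- a) p)) //.
    by apply: transportedD => //; exact: transported_cst.
  exact: measurable_funB.
move=> z; rewrite indicE; have [az|az] := ltP a (phi z).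
  rewrite mem_set//=; apply: (@cvg_step _ _ (phi z - a)); first by rewrite subr_gt0.
  exact: nearW.
rewrite memNset/=; last by apply/negP; rewrite -leNgt.
under eq_fun do rewrite step_eq0 ?subr_le0//.
exact: cvg_cst.
Qed.

Let coord_box (phi : X -> R) : transported (fun p => phi (foot p.1 p.2)) ->
  measurable_fun setT phi -> measurable_fun setT (phi : g_sigma_algebraType box -> R).
Proof.
move=> tphi mphi; apply: (measurability _ (RGenOInfty.measurableE R)).
move=> _ [_ [a ->] <-]; rewrite setTI; apply: sub_gen_smallest.
rewrite (_ : _ @^-1` _ = [set z | a < phi z]); first exact: box_gt.
by apply/seteqP; split => z /=; rewrite in_itv/= andbT.
Qed.

(** The coordinates of x and v have smooth transports, so their open superlevel sets are boxes, and
    these generate the sigma-algebra. *)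
Let measurable_box (A : set X) : measurable A -> <<s box >> A.
Proof.
have mid : measurable_fun setT (id : g_sigma_algebraType box -> X).
  apply/measurable_fun_pairP; split; apply: measurable_fun_rVP => i.
    apply: (@coord_box (fun z => z.1 ord0 i)); first exact: transported_origin.
    exact: (measurableT_comp (measurable_rV_coord i) measurable_fst).
  apply: (@coord_box (fun z => z.2 ord0 i)); first exact: transported_velocity.
  exact: (measurableT_comp (measurable_rV_coord i) measurable_snd).
by move=> mA; have := mid measurableT A mA; rewrite setTI.
Qed.

Let indic_le1 (A : set X) z : `|\1_A z : R| <= 1.
Proof. by rewrite indicE; case: (_ \in _); rewrite ?normr1 ?normr0. Qed.

(** Dynkin's pi-lambda theorem: linearity handles differences, [duhamel_cvg] increasing unions and
    the boxes themselves. *)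
Lemma duhamel_indic (A : set X) : measurable A -> duhamel (\1_A : X -> R).
Proof.
suff : <<s box >> `<=` [set B | measurable B /\ duhamel (\1_B : X -> R)].
  by move=> h /measurable_box /h [].
apply: (lambda_system_subset box_setI); last by move=> B _; exact: subsetT.
- split; first by move=> B _; exact: subsetT.
  + split=> //; rewrite (_ : \1_setT = cst 1); first by apply: duhamel_profile; exact: profile1.
    by apply/funext => z; rewrite indicE mem_setT.
  + move=> B C CB [mB dB] [mC dC]; split; first exact: measurableD.
    rewrite (_ : \1_(B `\` C) = (fun z => -1 * \1_C z + \1_B z)).
      exact: (@duhamel_linear _ _ (-1) 1 (measurable_indic mC) (measurable_indic mB)
        (fun z _ => indic_le1 C z) (fun z _ => indic_le1 B z) dC dB).
    apply/funext => z; rewrite !indicE in_setD.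
    have [zC|zC] := boolP (z \in C).
      by rewrite andbF (_ : z \in B) ?mulN1r ?addNr//; apply/mem_set/CB/set_mem.
    by rewrite andbT mulr0 add0r.
  + move=> B ndB hB; have mB n : measurable (B n) by have [] := hB n.
    split; first exact: bigcupT_measurable.
    apply: (@duhamel_cvg (fun n => \1_(B n)) _ 1) => //.
    * by apply: measurable_indic; exact: bigcupT_measurable.
    * move=> z _; have [[n _ Bn]|nB] := pselect ((\bigcup_n B n) z).
        rewrite indicE mem_set; last by exists n.
        apply: cvg_near_cst; near=> k.
        rewrite indicE mem_set//.
        have nk : (n <= k)%N by near: k; exact: nbhs_infty_ge.
        by move/subsetPset : (ndB _ _ nk); apply.
      rewrite indicE memNset//.
      apply: cvg_near_cst; near=> k.
      by rewrite indicE memNset// => Bk; apply: nB; exists k.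
    * by move=> n; have [] := hB n.
- move=> B [psi_ [npsi cpsi]]; have mpsi n : measurable_fun setT (psi_ n) by have [] := npsi n.
  have mB : measurable B.
    apply/(@measurable_indicP _ _ R); apply: (measurable_fun_cvg mpsi) => z _; exact: cpsi.
  split => //; apply: (@duhamel_cvg psi_ _ 1) => //.
  + move=> n z _; have [_ _ /(_ z)/andP[h0 h1]] := npsi n; by rewrite ger0_norm.
  + by move=> n; exact: duhamel_profile.
Unshelve. all: by end_near. Qed.

(** Approximation from below by simple functions, whose bound C is inherited from their limit. *)
Lemma duhamel_ge0 phi (C : R) : measurable_fun setT phi ->
  (forall z, 0 <= phi z <= C) -> duhamel phi.
Proof.
move=> mphi phiC.
have mE : measurable_fun setT (EFin \o phi) by exact/measurable_EFinP.
pose a := nnsfun_approx measurableT mE.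
have ca z : a n z @[n --> \oo] --> phi z.
  apply: (@fine_cvg _ _ _ _ (fun n => (a n z)%:E)).
  apply: (@cvg_nnsfun_approx _ _ _ _ measurableT _ mE _ z) => // z' _.
  by rewrite lee_fin; case/andP: (phiC z').
have aC n z : `|a n z| <= C.
  rewrite ger0_norm ?fun_ge0//; case/andP: (phiC z) => _; apply: le_trans.
  rewrite -(cvg_lim (@norm_hausdorff _ R) (ca z)).
  apply: (nondecreasing_cvgn_le _ (cvgP _ (ca z))) => k l kl.
  by have /lefP := nd_nnsfun_approx measurableT mE kl; apply.
apply: (@duhamel_cvg a _ C) => // n.
have C0 : 0 <= C by case/andP: (phiC 0) => /le_trans h /h.
have [N [c hc]] : exists N (c : 'I_N -> R),
    forall z, a n z = \sum_(i < N) c i * \1_(a n @^-1` [set c i]) z.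
  by eexists; eexists => z; exact: fimfunEord.
have -> : (a n : X -> R) = (fun z => \sum_(i < N) c i * \1_(a n @^-1` [set c i]) z).
  exact/funext.
suff H (s : seq 'I_N) :
   [/\ measurable_fun setT (fun z => \sum_(i <- s) c i * \1_(a n @^-1` [set c i]) z),
      exists M, forall z, `|\sum_(i <- s) c i * \1_(a n @^-1` [set c i]) z| <= M &
    duhamel (fun z => \sum_(i <- s) c i * \1_(a n @^-1` [set c i]) z)].
  by have [] := H (index_enum _).
have mI i : measurable (a n @^-1` [set c i]) by exact: measurable_sfunP.
elim: s => [|i s [m1 [M hM] d1]].
  have e0 : (fun z : X => \sum_(i <- [::]) c i * \1_(a n @^-1` [set c i]) z) = \1_set0.
    by apply/funext => z; rewrite big_nil indic0.
  rewrite e0; split; first exact: measurable_indic.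
    by exists 0 => z; rewrite big_nil normr0.
  exact: duhamel_indic.
have eS : (fun z : X => \sum_(j <- i :: s) c j * \1_(a n @^-1` [set c j]) z) =
    (fun z => c i * \1_(a n @^-1` [set c i]) z + \sum_(j <- s) c j * \1_(a n @^-1` [set c j]) z).
  by apply/funext => z; rewrite big_cons.
rewrite eS; split.
- by apply: measurable_funD => //; apply: measurable_funM.
- exists (`|c i| + M) => z; rewrite big_cons (le_trans (ler_normD _ _))// lerD//.
  by rewrite normrM -[leRHS]mulr1 ler_wpM2l.
- apply: (@duhamel_linear _ _ (c i) (Num.max 1 M) (measurable_indic (mI i)) m1).
  + by move=> z _; rewrite le_max indic_le1.
  + by move=> z _; rewrite le_max hM orbT.
  + exact: duhamel_indic.
  + exact: d1.
Qed.

Lemma duhamel_bounded phi (C : R) : measurable_fun setT phi ->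
  (forall z, `|phi z| <= C) -> duhamel phi.
Proof.
move=> mphi phiC.
rewrite (_ : phi = fun z => (- C) * \1_setT z + (phi z + C)); last first.
  by apply/funext => z; rewrite indicE mem_setT mulr1; ring.
have h z : 0 <= phi z + C <= 2 * C by have := phiC z; rewrite ler_norml; lra.
have C0 : 0 <= C by apply: le_trans (phiC 0).
apply: (@duhamel_linear _ _ _ (1 + 2 * C)).
- exact: measurable_indic.
- exact: measurable_funD.
- by move=> z _; apply: (le_trans (indic_le1 _ _)); lra.
- by move=> z _; have /andP[h0 h1] := h z; rewrite ger0_norm//; lra.
- exact: duhamel_indic.
- by apply: (@duhamel_ge0 _ (2 * C)) => //; exact: measurable_funD.
Qed.

End evolution.

(** * From the weak formulation to Duhamel's formula *)

Section weak_to_duhamel.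
Context {R : realType} {d : nat}.
Variables chi V0 gamma : R.
Hypotheses (chi_gt0 : 0 < chi) (chi_lt1 : chi < 1) (V0_gt0 : 0 < V0) (gamma_gt0 : 0 < gamma).
Hypothesis volV : lebesgue_rV d (velocities V0) = 1%E.
Local Notation vol := (lebesgue_rV d).
Local Notation V := (@velocities R d V0).
Local Notation X := ('rV[R]_d * 'rV[R]_d)%type.
Local Notation txv := (R * X)%type.
Local Notation D := (@phase R d V0).
Local Notation mu := (@dxdv R d).
Local Notation m := (exp_weight gamma : X -> R).
Local Notation mD := (@measurable_phase R d V0).
Implicit Types (psi : X -> R) (z : X).

Lemma exp_weight_ge1 z : 1 <= m z.
Proof.
rewrite /exp_weight -[leLHS]expR0 ler_expR mulr_ge0 ?(ltW gamma_gt0)//.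
exact: jap_ge0.
Qed.

Lemma measurable_exp_weightV : measurable_fun setT (fun z : X => (m z)^-1).
Proof.
rewrite (_ : (fun z => _) = (fun z : X => expR (- (gamma * jap z.1)))); last first.
  by apply/funext => z; rewrite expRN.
apply: (measurableT_comp (@measurable_expR R)); apply: measurableT_comp => //.
apply: measurable_funM => //.
exact: (measurableT_comp (@measurable_jap R d) measurable_fst).
Qed.

Variables (f0 : X -> R) (f : R -> X -> R).
Hypothesis wf : weak_solution chi V0 m f0 f.

(* f is constrained at times t >= 0 only; freezing it before time 0 makes it
   continuous on the whole line. *)
Definition extend (t : R) : X -> R := f (Num.max 0 t).

Lemma max0_ge0 (t : R) : 0 <= Num.max 0 t.
Proof. by rewrite le_max lexx. Qed.

Lemma L1_continuous_weighted : L1_continuous mu D (fun t z => m z * extend t z).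
Proof.
split=> [t|t]; first exact: sol_L1 wf _ (max0_ge0 t).
have ii s : mu.-integrable D (EFin \o (fun z => m z * (f (Num.max 0 s) \- f (Num.max 0 t)) z)).
  have := RintegrableB mD (sol_L1 wf (max0_ge0 s)) (sol_L1 wf (max0_ge0 t)).
  by apply: (eq_integrable mD) => z _ /=; rewrite mulrBr.
(* Truncation at 0 transfers the one-sided continuity in [sol_continuous] to the whole line. *)
have cm : (fun s : R => Num.max 0 s) @ t --> within [set s : R | 0 <= s] (nbhs (Num.max 0 t)).
  move=> P; rewrite /within/= => hP.
  have cmax : Num.max 0 s @[s --> t] --> Num.max 0 t.
    have c := @continuous_max R R (cst 0) id t (@cst_continuous _ _ (0 : R) t) cvg_id.
    exact: c.
  change (nbhs t [set s | P (Num.max 0 s)]).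
  have h : nbhs t [set s : R | 0 <= Num.max 0 s -> P (Num.max 0 s)] := cmax _ hP.
  by near=> s; have /= := near h s; apply => //; exact: max0_ge0.
have := cvg_comp _ _ cm (sol_continuous wf (max0_ge0 t)).
have E s : L1norm V0 m (f (Num.max 0 s) \- f (Num.max 0 t)) =
    (\int[mu]_(z in D) `|m z * extend s z - m z * extend t z|)%:E.
  rewrite /L1norm (Rintegrable_fin mD (Rintegrable_norm (ii s))).
  by congr EFin; apply: eq_Rintegral => z _; rewrite /extend /= mulrBr.
move=> h; apply: (@fine_cvg _ _ _ _ (fun s => (\int[mu]_(z in D) `|m z * extend s z - m z * extend t z|)%:E)).
apply: cvg_trans h; rewrite /=.
by under eq_fun do rewrite -E.
Unshelve. all: by end_near. Qed.

Lemma L1_continuous_extend : L1_continuous mu D extend.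
Proof.
have -> : extend = (fun t z => m z * extend t z * (m z)^-1).
  by apply/funext => t; apply/funext => z; rewrite mulrAC divff ?mul1r// gt_eqF// expR_gt0.
apply: (L1_continuousM mD L1_continuous_weighted (C := 1)).
  by apply: measurable_funTS; exact: measurable_exp_weightV.
move=> z _; rewrite normfV invf_le1 ?normr_gt0 ?gt_eqF ?expR_gt0//.
by rewrite ger0_norm ?expR_ge0// exp_weight_ge1.
Qed.
Local Notation hg := L1_continuous_extend.

Lemma profile_continuous psi : profile psi -> forall z, continuous (fun t => transport psi t z).
Proof.
move=> [[spsi _] _ _] z t.
apply: (@continuous_comp _ _ _ (fun t : R => (t, z) : txv) (fun p : txv => psi (foot p.1 p.2))).
  exact: (cvg_pair cvg_id (cvg_cst z)).
exact: (smooth_continuous spsi).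
Qed.

Lemma profile_le1 psi z : profile psi -> `|psi z| <= 1.
Proof. by move=> [_ _ /(_ z)/andP[h0 h1]]; rewrite ger0_norm. Qed.

Lemma profile_gain_continuous psi : profile psi ->
  forall z, continuous (fun t => gain_adj chi V0 (transport psi t) z).
Proof.
move=> npsi z t; have [_ mpsi _] := npsi; have mV := @measurable_V R d V0.
apply: cvgD; (apply: cvgM; first exact: cvg_cst); last exact: profile_continuous.
apply: cvgB; last exact: profile_continuous.
have := @continuity_under_integral R _ 'rV[R]_d vol (fun s v => transport psi s (z.1, v)) V mV (t - 1) (t + 1).
move=> /(_ _ _ (fun=> 1)); apply.
- move=> s _; apply: (integrable_V_bounded volV (C := 1)); first exact: measurable_transport.
  by move=> z' _; exact: (@profile_le1 psi _ npsi).
- by apply: aeW => v _ s _; exact: (@profile_continuous psi npsi).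
- by apply: (@bounded_integrable_V _ _ _ volV _ 1) => // v _; rewrite normr1.
- by move=> s _; apply: aeW => v _; exact: (@profile_le1 psi _ npsi).
- by apply/mem_set => /=; rewrite in_itv/=; apply/andP; split; lra.
Qed.

Lemma continuous_expR2 : continuous (fun t : R => expR (2 * t)).
Proof.
move=> t; apply: (@continuous_comp _ _ _ (fun t : R => 2 * t) expR); last exact: continuous_expR.
by apply: cvgM; [exact: cvg_cst|exact: cvg_id].
Qed.

(** For cut-off profiles both pairings are continuous in time, and the weak formulation is exactly
    the hypothesis of [du_bois_reymond]. *)
Lemma duhamel_cutoff psi n : profile psi ->
  duhamel chi V0 extend (fun z => psi z * cutoff V0 n z).
Proof.
move=> npsi; pose kap z := psi z * cutoff V0 n z.
have nk : profile kap by apply: profileM => //; exact: profile_cutoff.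
have [_ mk _] := nk.
have mkt t := measurable_transport t mk.
have ktC t z : D z -> `|transport kap t z| <= 1 by move=> _; exact: (@profile_le1 kap _ nk).
have mgt t := measurable_gain_adj chi V0 (mkt t).
have agC t := gain_adj_le chi_gt0 chi_lt1 volV (mkt t) (ktC t).
have cF : continuous (pairing V0 extend kap).
  move=> t; apply: cvgM; first exact: continuous_expR2.
  have c := L1_continuous_pairing mD hg (fun s => measurable_funTS (mkt s)) ktC
    (fun z _ => @profile_continuous kap nk z).
  exact: c.
have cG : continuous (gain_pairing chi V0 extend kap).
  move=> t; apply: cvgM; first exact: continuous_expR2.
  have c := L1_continuous_pairing mD hg (fun s => measurable_funTS (mgt s)) agC
    (fun z _ => @profile_gain_continuous kap nk z).
  exact: c.
split; first exact: continuous_measurable_fun.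
apply: du_bois_reymond => // theta stheta [a [b [a0 ab thab]]].
(* Differentiating the exponential produces the term 2 f that turns the collision operator into the
   positive gain. *)
pose theta2 (t : R) := theta t * expR (2 * t).
have sexp2 : smooth (fun t : R => expR (2 * t)).
  have := smooth_comp smooth_expR (smooth_affine 2 (0 : R)).
  by rewrite (_ : _ \o _ = (fun t : R => expR (2 * t)))//; apply/funext => t /=; rewrite addr0.
have stheta2 : smooth theta2 by exact: smoothM.
have Dtheta2 (t : R) : 'D_1 theta2 t = ('D_1 theta t + 2 * theta t) * expR (2 * t).
  have de : is_derive t (1 : R) (fun t : R => expR (2 * t)) (expR (2 * t) * 2).
    apply: (@is_derive1_comp _ expR (fun t : R => 2 * t)).
    have := is_derive1_affine 2 0 t.
    by under eq_fun do rewrite addr0 mulrC.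
  have [_ ->] := is_deriveM (smooth_derivable t 1 stheta) de.
  by rewrite /GRing.scale/=; ring.
have c2 : compact_in_pos theta2.
  by exists a, b; split=> // x /thab tx; rewrite /theta2 tx mul0r.
rewrite -[RHS](sol_eq wf (test_function_cutoff V0_gt0 n npsi stheta2 c2)).
apply: eq_Rintegral => t; rewrite inE/= in_itv/= andbT => t0.
have ft : f t = extend t by rewrite /extend max_r// ltW.
have tk : transported (fun p : txv => kap (foot p.1 p.2)) by have [] := nk.
have i1 : mu.-integrable D (EFin \o (fun z => extend t z * transport kap t z)).
  exact: (RintegrableM mD (hg.1 t) (measurable_funTS (mkt t)) (ktC t)).
have i2 : mu.-integrable D (EFin \o (fun z => collision chi V0 (extend t) z * transport kap t z)).
  exact: (integrable_exchange (@measurable_V R d V0) volV (measurable_rate chi)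
    (norm_rate_le chi_gt0 chi_lt1) (hg.1 t) (mkt t) (ktC t)).
have adj : \int[mu]_(z in D) (collision chi V0 (extend t) z * transport kap t z) =
  \int[mu]_(z in D) (extend t z * (rate chi z * (velocity_mean vol V (transport kap t) z.1 - transport kap t z))).
  exact: (exchange_adjoint (@measurable_V R d V0) volV (measurable_rate chi)
    (norm_rate_le chi_gt0 chi_lt1) (hg.1 t) (mkt t) (ktC t)).
transitivity (\int[mu]_(z in D) ('D_1 theta2 t * (extend t z * transport kap t z) +
   theta2 t * (collision chi V0 (extend t) z * transport kap t z))); last first.
  apply: eq_Rintegral => z _; rewrite ft.
  have := material_derivative_theta (t, z) stheta2 tk; rewrite /material_derivative/= => ->.
  by rewrite /transport /kap; ring.
rewrite (RintegralD mD (RintegrableZ mD _ i1) (RintegrableZ mD _ i2)).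
rewrite (RintegralZl _ mD i1) (RintegralZl _ mD i2) adj Dtheta2 /pairing /gain_pairing.
have i3 : mu.-integrable D (EFin \o (fun z => extend t z *
    (rate chi z * (velocity_mean vol V (transport kap t) z.1 - transport kap t z)))).
  have i4 : mu.-integrable D (EFin \o (fun z => extend t z * gain_adj chi V0 (transport kap t) z)).
    exact: (RintegrableM mD (hg.1 t) (measurable_funTS (mgt t)) (agC t)).
  have := RintegrableB mD i4 (RintegrableZ mD 2 i1).
  by apply: (eq_integrable mD) => z _ /=; congr EFin; rewrite /gain_adj; ring.
have -> : \int[mu]_(z in D) (extend t z * gain_adj chi V0 (transport kap t) z) =
   \int[mu]_(z in D) (extend t z * (rate chi z * (velocity_mean vol V (transport kap t) z.1
      - transport kap t z))) + 2 * \int[mu]_(z in D) (extend t z * transport kap t z).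
  rewrite -(RintegralZl _ mD i1) -(RintegralD mD i3 (RintegrableZ mD 2 i1)).
  by apply: eq_Rintegral => z _; rewrite /gain_adj; ring.
by rewrite /theta2; ring.
Qed.

End weak_to_duhamel.

(** * A barrier principle *)
Section barrier.
Context {R : realType}.

(** At the supremum of the times up to t where Z <= 0, continuity gives Z <= 0 and the extension
    hypothesis passes beyond it. *)
Lemma continuation (Z : R -> R) : continuous Z -> Z 0 <= 0 ->
  (forall s, 0 <= s -> Z s <= 0 ->
     exists2 e : R, 0 < e & forall h, 0 < h -> h <= e -> Z (s + h) <= 0) ->
  forall t, 0 <= t -> Z t <= 0.
Proof.
move=> cZ Z0 ext t t0; rewrite leNgt; apply/negP => Zt.
pose S := [set s | 0 <= s <= t /\ Z s <= 0].
have S0 : S 0 by rewrite /S/= lexx t0.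
have supS : has_sup S.
  by split; [exists 0|exists t => s [/andP[]]].
have S_ub s : S s -> s <= sup S by move=> Ss; exact: (ub_le_sup supS.2).
have tau0 : 0 <= sup S by exact: S_ub.
have taut : sup S <= t by apply: ge_sup; [exists 0|move=> s [/andP[]]].
have Ztau : Z (sup S) <= 0.
  rewrite leNgt; apply/negP => Zp.
  have /cvgrPdist_lt/(_ _ Zp)[e /= e0 he] := cZ (sup S).
  have [s Ss ls] := sup_adherent e0 supS.
  have := he s; rewrite /= ger0_norm ?subr_ge0 ?S_ub// => /(_ _); case: Ss => _ Zs.
  have h1 : sup S - s < e by lra.
  move=> /(_ h1); rewrite ltr_distl; lra.
have tauE : sup S < t.
  by rewrite lt_neqAle taut andbT; apply/eqP => e; move: Ztau; rewrite e leNgt Zt.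
have [e e0 he] := ext _ tau0 Ztau.
pose h := Num.min e (t - sup S).
have h0 : 0 < h by rewrite lt_min e0 subr_gt0.
have he' : h <= e by rewrite ge_min lexx.
have ht : h <= t - sup S by rewrite ge_min lexx orbT.
have : S (sup S + h).
  by split; [apply/andP; split; lra|exact: he].
by move/S_ub; lra.
Qed.

(** N is compared with the increasing barrier U + eta (1 + t). On contact N >= B, so slope <= 0 and
    N rises at rate at most eta, no faster than the barrier; below it, continuity suffices. *)
Lemma dini_barrier (N slope : R -> R) (B : R) : continuous N ->
  (forall s, 0 <= s -> forall e, 0 < e -> exists2 del : R, 0 < del &
     forall h, 0 < h -> h <= del -> N (s + h) <= N s + h * (slope s + e)) ->
  (forall s, 0 <= s -> B <= N s -> slope s <= 0) ->
  forall t, 0 <= t -> N t <= Num.max B (N 0).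
Proof.
move=> cN dN sN t t0; apply/ler_addgt0Pr => e e0.
set U := Num.max B (N 0).
have BU : B <= U by rewrite le_max lexx.
have NU : N 0 <= U by rewrite le_max lexx orbT.
pose eta := e / (1 + t); have eta0 : 0 < eta by rewrite divr_gt0//; lra.
have etaE : eta * (1 + t) = e by rewrite divfK//; lra.
suff : N t - (U + eta * (1 + t)) <= 0 by lra.
apply: (@continuation (fun t => N t - (U + eta * (1 + t)))) => //.
- move=> s; apply: cvgB; first exact: cN.
  by apply: cvgD; [exact: cvg_cst|apply: cvgM; [exact: cvg_cst|apply: cvgD; [exact: cvg_cst|exact: cvg_id]]].
- lra.
move=> s s0; rewrite le_eqVlt => /predU1P[Zs|Zs].
  have es0 : 0 <= eta * s by rewrite mulr_ge0// ltW.
  have [del del0 hdel] := dN s s0 eta eta0.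
  exists del => // h h0 hd; have := hdel h h0 hd.
  have ss : slope s <= 0 by apply: sN => //; lra.
  have := ler_wpM2l (ltW h0) ss; lra.
have Zs' : 0 < U + eta * (1 + s) - N s by lra.
have /cvgrPdist_le/(_ _ Zs')[del /= del0 hdel] := cN s.
exists (del / 2); first by rewrite divr_gt0.
move=> h h0 hd; have := hdel (s + h); rewrite /=.
have -> : s - (s + h) = - h by ring.
rewrite normrN gtr0_norm// => /(_ _); have h1 : h < del by lra.
move=> /(_ h1); rewrite ler_distl; have := mulr_gt0 eta0 h0; lra.
Qed.

(** Divide by e^(2 s) and use e^(2 h) >= 1 + 2 h, legitimate as N >= 0. The errors amount to 4 eta:
    one for Q near s, one for the factor 1 + kappa h, two for replacing 2 N(s + h) by 2 N(s). *)
Lemma dini_of_duhamel (N Q : R -> R) (S kappa h0 s : R) :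
  continuous N -> continuous Q -> (forall t, 0 <= N t) -> 0 <= kappa -> 0 < h0 ->
  (forall h, 0 < h -> h <= h0 -> expR (2 * (s + h)) * N (s + h) <=
     expR (2 * s) * (N s + h * S) +
     \int[lebesgue_measure]_(r in `[s, s + h]) (expR (2 * r) * ((1 + kappa * h) * Q r))) ->
  forall e, 0 < e -> exists2 del : R, 0 < del & forall h, 0 < h -> h <= del ->
    N (s + h) <= N s + h * (S + Q s - 2 * N s + e).
Proof.
move=> cN cQ N0 k0 h0_gt0 duh e e0; pose eta := e / 4.
have eta0 : 0 < eta by rewrite divr_gt0.
have /cvgrPdist_le/(_ _ eta0)[d1 /= d10 hd1] := cN s.
pose G r := expR (2 * (r - s)) * Q r.
have cexp : continuous (fun r : R => expR (2 * (r - s))).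
  move=> r; apply: continuous_comp; last exact: continuous_expR.
  by apply: cvgM; [exact: cvg_cst|apply: cvgB; [exact: cvg_id|exact: cvg_cst]].
have cG : continuous G by move=> r; apply: cvgM; [exact: cexp|exact: cQ].
have Gs : G s = Q s by rewrite /G subrr mulr0 expR0 mul1r.
have /cvgrPdist_le/(_ _ eta0)[d2 /= d20 hd2] := cG s.
(* For h <= d3 the correction kappa h (Q s + eta) is at most eta; the 1 keeps the denominator
   positive. *)
pose d3 := eta / (kappa * (`|Q s| + eta) + 1).
have den0 : 0 < kappa * (`|Q s| + eta) + 1.
  by rewrite ltr_wpDl// mulr_ge0// addr_ge0// ltW.
have d30 : 0 < d3 by rewrite divr_gt0.
pose del := Num.min h0 (Num.min (d1 / 2) (Num.min (d2 / 2) d3)).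
have del0 : 0 < del by rewrite !lt_min h0_gt0 d30 !divr_gt0.
exists del => // h hp; rewrite !le_min => /and4P[hh0 hh1 hh2 hh3].
have shift : s - (s + h) = - h by ring.
have Nlow : N s - eta <= N (s + h).
  have := hd1 (s + h); rewrite /= shift normrN gtr0_norm// => /(_ _).
  have h1 : h < d1 by lra.
  by move=> /(_ h1); rewrite ler_distl => /andP[]; lra.
have es r : expR (2 * r) = expR (2 * s) * expR (2 * (r - s)).
  by rewrite -expRD; congr expR; ring.
have kh0 : 0 <= 1 + kappa * h by rewrite addr_ge0// mulr_ge0// ltW.
have Gup r : s <= r <= s + h -> G r <= Q s + eta.
  move=> /andP[r1 r2]; have := hd2 r; rewrite /= distrC ger0_norm ?subr_ge0// => /(_ _).
  have h2 : r - s < d2 by lra.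
  by move=> /(_ h2); rewrite Gs ler_distl => /andP[]; lra.
have int_le : \int[lebesgue_measure]_(r in `[s, s + h])
    (expR (2 * r) * ((1 + kappa * h) * Q r)) <=
    expR (2 * s) * (h * ((1 + kappa * h) * (Q s + eta))).
  set k := (1 + kappa * h) in kh0 *.
  have -> : expR (2 * s) * (h * (k * (Q s + eta))) =
      \int[lebesgue_measure]_(r in `[s, s + h]) cst (expR (2 * s) * (k * (Q s + eta))) r.
    rewrite Rintegral_cst; last exact: measurable_itv.
    rewrite [X in fine X](_ : _ = h%:E) /=; first by ring.
    rewrite (lebesgue_measure_itv `[s, s + h])/= lte_fin ltrDl hp/=.
    by rewrite -EFinD addrAC subrr add0r.
  apply: le_Rintegral.
  - exact: measurable_itv.
  - rewrite (_ : (fun r => _) = (fun r => expR (2 * s) * (k * G r))).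
      apply: continuous_integrable_itv => r.
      by apply: cvgM; [exact: cvg_cst|apply: cvgM; [exact: cvg_cst|exact: cG]].
    by apply/funext => r; rewrite es /G; ring.
  - by apply: continuous_integrable_itv => r; exact: cvg_cst.
  move=> r; rewrite /= in_itv/= => hr; rewrite es.
  rewrite -mulrA ler_wpM2l ?expR_ge0// mulrCA ler_wpM2l//; exact: Gup.
have := duh h hp hh0; rewrite es [s + h - s]addrAC subrr add0r => duhh.
have e1 : expR (2 * h) * N (s + h) <= N s + h * S + h * ((1 + kappa * h) * (Q s + eta)).
  rewrite -(ler_pM2l (expR_gt0 (2 * s))) [leLHS]mulrA [leRHS]mulrDr.
  by apply: (le_trans duhh); rewrite lerD2l.
have e2 : (1 + 2 * h) * N (s + h) <= expR (2 * h) * N (s + h).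
  by rewrite ler_wpM2r// expR_ge1Dx.
have hNlow := ler_wpM2l (ltW hp) Nlow.
have small : kappa * h * (Q s + eta) <= eta.
  apply: (@le_trans _ _ (kappa * h * (`|Q s| + eta))).
    by rewrite ler_wpM2l ?mulr_ge0 ?(ltW hp)// lerD2r ler_norm.
  have h3 : h * (kappa * (`|Q s| + eta) + 1) <= eta by rewrite -ler_pdivlMr.
  lra.
have hsmall := ler_wpM2l (ltW hp) small; have eE : e = 4 * eta by rewrite /eta; field.
rewrite eE; move: e1 e2 hNlow hsmall; clear; lra.
Qed.

End barrier.

(** * Evolution of weighted masses *)
Section weighted_masses.
Context {R : realType} {d : nat}.
Variables chi V0 gamma : R.
Hypotheses (chi_gt0 : 0 < chi) (chi_lt1 : chi < 1) (V0_gt0 : 0 < V0) (gamma_gt0 : 0 < gamma).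
Hypothesis volV : lebesgue_rV d (velocities V0) = 1%E.
Local Notation vol := (lebesgue_rV d).
Local Notation V := (@velocities R d V0).
Local Notation X := ('rV[R]_d * 'rV[R]_d)%type.
Local Notation D := (@phase R d V0).
Local Notation mu := (@dxdv R d).
Local Notation leb := (@lebesgue_measure R).
Local Notation m := (exp_weight gamma : X -> R).
Local Notation mD := (@measurable_phase R d V0).
Implicit Types (psi : X -> R) (z : X).

Variables (f0 : X -> R) (f : R -> X -> R).
Hypothesis wf : weak_solution chi V0 m f0 f.
Local Notation extend := (extend f).
Let L1_continuous_extend := L1_continuous_extend gamma_gt0 wf.
Let L1_continuous_weighted := L1_continuous_weighted wf.
Let duhamel_cutoff := duhamel_cutoff chi_gt0 chi_lt1 V0_gt0 gamma_gt0 volV wf.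
Implicit Types phi : X -> R.

Lemma duhamel_extend phi (C : R) : measurable_fun setT phi ->
  (forall z, `|phi z| <= C) -> duhamel chi V0 extend phi.
Proof.
apply: (duhamel_bounded chi_gt0 chi_lt1 volV L1_continuous_extend) => psi npsi.
have [_ mpsi _] := npsi.
apply: (@duhamel_cvg _ _ _ _ chi_gt0 chi_lt1 volV _ L1_continuous_extend
  (fun n z => psi z * cutoff V0 n z) _ 1) => //.
- by move=> n; have [] := profileM npsi (profile_cutoff V0 n).
- by move=> n z _; exact: (profile_le1 z (profileM npsi (profile_cutoff V0 n))).
- move=> z Dz; rewrite -[X in _ --> X]mulr1; apply: cvgM; first exact: cvg_cst.
  exact: cvg_cutoff.
- by move=> n; exact: duhamel_cutoff.
Qed.

(** k may be unbounded, but k / m is bounded and m f is a continuous curve in L1. *)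
Lemma L1_continuous_abs (k : X -> R) (C : R) : measurable_fun setT k ->
  (forall z, D z -> `|k z| <= C * m z) ->
  L1_continuous mu D (fun t z => `|extend t z| * k z).
Proof.
move=> mk kC.
have -> : (fun t z => `|extend t z| * k z) =
    (fun t z => `|m z * extend t z| * (k z * (m z)^-1)).
  apply/funext => t; apply/funext => z; rewrite normrM (gtr0_norm (exp_weight_gt0 _ _)).
  by field; rewrite gt_eqF// exp_weight_gt0.
apply: (L1_continuousM mD (L1_continuous_norm mD L1_continuous_weighted) (C := C)).
  by apply: measurable_funTS; apply: measurable_funM => //; exact: measurable_exp_weightV.
move=> z Dz; rewrite normrM normfV (gtr0_norm (exp_weight_gt0 _ _)).
by rewrite ler_pdivrMr ?exp_weight_gt0// kC.
Qed.

(** * Masses for an abstract Lyapunov weight, applied to the constant 1 and to the tilted weight *)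

Section weighted.
Variables (w slope : X -> R) (c kappa a b h0 : R).
Hypotheses (mw : measurable_fun setT w) (mslope : measurable_fun setT slope).
Hypotheses (w_ge0 : forall z, D z -> 0 <= w z) (w_le : forall z, D z -> w z <= c * m z).
Hypotheses (slope_norm : forall z, D z -> `|slope z| <= c * m z).
Hypotheses (kappa_ge0 : 0 <= kappa) (slope_le : forall z, D z -> slope z <= kappa * w z).
Hypotheses (h0_gt0 : 0 < h0) (w_shift : forall h x v, 0 < h -> h <= h0 -> V v ->
  w (x + h *: v, v) <= w (x, v) + h * slope (x, v)).
Hypothesis lyap : forall z, D z ->
  slope z + rate chi z * (velocity_mean vol V w z.1 - w z) <= - a * w z + b.

Local Notation mV := (@measurable_V R d V0).
Local Notation gw := (gain_adj chi V0 w).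

Let wV x : vol.-integrable V (EFin \o (fun v => w (x, v))).
Proof.
apply: (@bounded_integrable_V _ _ _ volV _ (c * m (x, 0))).
  exact: (measurableT_comp mw).
by move=> v Vv; rewrite ger0_norm ?w_ge0// w_le.
Qed.

Let mgw : measurable_fun setT gw. Proof. exact: measurable_gain_adj. Qed.

Let gwE z : gw z = rate chi z * velocity_mean vol V w z.1 + (2 - rate chi z) * w z.
Proof. by rewrite /gain_adj; ring. Qed.

Let mean_ge0 x : 0 <= velocity_mean vol V w x.
Proof. by apply: Rintegral_ge0 => v Vv; exact: w_ge0. Qed.

Let gw_ge0 z : D z -> 0 <= gw z.
Proof.
move=> Dz; rewrite gwE; have /andP[r0 r2] := rate_bounds chi_gt0 chi_lt1 z.
by rewrite addr_ge0// mulr_ge0 ?subr_ge0 ?w_ge0.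
Qed.

Let gw_le z : D z -> `|gw z| <= (4 * c) * m z.
Proof.
move=> Dz; rewrite ger0_norm ?gw_ge0// gwE.
have /andP[r0 r2] := rate_bounds chi_gt0 chi_lt1 z.
have cm0 : 0 <= c * m z by exact: le_trans (w_ge0 Dz) (w_le Dz).
have ml : velocity_mean vol V w z.1 <= c * m z.
  rewrite /velocity_mean; apply: (@le_trans _ _ (\int[vol]_(v in V) cst (c * m z) v)).
    apply: le_Rintegral; [exact: mV|exact: wV| |].
      apply: (@bounded_integrable_V _ _ _ volV _ (c * m z)); first exact: measurable_cst.
      by move=> v _; rewrite ger0_norm.
    by move=> v Vv; exact: w_le.
  by rewrite Rintegral_cst ?[X in fine X](_ : _ = 1%E)//= ?mulr1//; exact: mV.
have h1 : rate chi z * velocity_mean vol V w z.1 <= 2 * (c * m z).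
  by apply: ler_pM.
have h2 : (2 - rate chi z) * w z <= 2 * (c * m z).
  by apply: ler_pM; rewrite ?subr_ge0 ?w_ge0 ?w_le// gerBl.
lra.
Qed.

Let gw_scale (k : R) z : gain_adj chi V0 (fun z => k * w z) z = k * gw z.
Proof.
rewrite /gain_adj /velocity_mean (RintegralZl _ mV (wV z.1)); ring.
Qed.

Definition weighted_mass t := \int[mu]_(z in D) (`|extend t z| * w z).
Definition weighted_gain t := \int[mu]_(z in D) (`|extend t z| * gw z).

Let w_norm z : D z -> `|w z| <= c * m z.
Proof. by move=> Dz; rewrite ger0_norm ?w_ge0 ?w_le. Qed.

Let hN := L1_continuous_abs mw w_norm.
Let hQ := L1_continuous_abs mgw gw_le.
Let hS := L1_continuous_abs mslope slope_norm.

Lemma continuous_weighted_mass : continuous weighted_mass.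
Proof. exact: (L1_continuous_Rintegral mD hN). Qed.

Lemma continuous_weighted_gain : continuous weighted_gain.
Proof. exact: (L1_continuous_Rintegral mD hQ). Qed.

(** The multiplicative form of [w_shift]: a multiple of w can be compared through the monotone
    operator [gain_adj]. *)
Let h_le (h : R) x v : 0 <= h -> h <= h0 -> V v ->
  w (x + h *: v, v) <= (1 + kappa * h) * w (x, v).
Proof.
rewrite le_eqVlt => /predU1P[<-|h_gt0] hh0 Vv; first by rewrite scale0r addr0 mulr0 addr0 mul1r.
have Dz : D (x, v) by [].
have := ler_wpM2l (ltW h_gt0) (slope_le Dz); have := w_shift x h_gt0 hh0 Vv; lra.
Qed.

(** Duhamel's formula asks for a bound on the whole space; the outer maximum provides it off the
    phase space, where w may have any sign. *)
Let clamp (n : nat) (u : R) : R := Num.max 0 (Num.min u n%:R).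

Let clamp_ge0 n u : 0 <= clamp n u. Proof. by rewrite /clamp le_max lexx. Qed.

Let clamp_le n u : clamp n u <= n%:R. Proof. by rewrite /clamp ge_max ler0n ge_min lexx orbT. Qed.

Let clamp_leu n u : 0 <= u -> clamp n u <= u.
Proof. by move=> u0; rewrite /clamp ge_max u0 ge_min lexx. Qed.

Let measurable_clamp n : measurable_fun setT (clamp n).
Proof.
apply: measurable_maxr; first exact: measurable_cst.
by apply: measurable_minr; [exact: measurable_id|exact: measurable_cst].
Qed.

Let cvg_clamp u : 0 <= u -> clamp n u @[n --> \oo] --> u.
Proof.
move=> u0; apply: cvg_near_cst; near=> n; rewrite /clamp min_l ?max_r//.
by near: n; exact: nbhs_infty_ger.
Unshelve. all: by end_near. Qed.

(* The test function which transport carries at time t to sgn f(t) min(w, n). *)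
Let phi_ (t : R) (n : nat) (z : X) : R :=
  Num.sg ((extend t \_ D) (foot (- t) z)) * clamp n (w (foot (- t) z)).

Let footK t r z : foot (- t) (foot r z) = (z.1 + (t - r) *: z.2, z.2).
Proof. by rewrite /foot/= scaleNr opprK -addrA -scaleNr -scalerDl addrC [_ - _]addrC addrC. Qed.

Let mphi_ t n : measurable_fun setT (phi_ t n).
Proof.
have me : measurable_fun setT (extend t \_ D).
  by apply/(measurable_restrictT _ mD); exact: Rintegrable_measurable (L1_continuous_extend.1 t).
apply: measurable_funM.
  apply: (measurableT_comp (@measurable_sgr R)); apply: (measurableT_comp me).
  exact: measurable_foot.
apply: (measurableT_comp (measurable_clamp n)); apply: (measurableT_comp mw).
exact: measurable_foot.
Qed.

Let norm_sg_le (x : R) : `|Num.sg x| <= 1.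
Proof. by case: sgrP; rewrite ?normr0 ?normr1 ?normrN1. Qed.

Let phi_le t n z : `|phi_ t n z| <= clamp n (w (foot (- t) z)).
Proof.
rewrite /phi_ normrM (ger0_norm (clamp_ge0 _ _)) -[leRHS]mul1r.
by apply: ler_wpM2r; [exact: clamp_ge0|exact: norm_sg_le].
Qed.

Let phi_le_n t n z : `|phi_ t n z| <= n%:R.
Proof. exact: le_trans (phi_le t n z) (clamp_le _ _). Qed.

Let transport_phi_le t n r z : 0 <= t - r -> t - r <= h0 -> D z ->
  `|transport (phi_ t n) r z| <= (1 + kappa * (t - r)) * w z.
Proof.
move=> r0 rh Dz; apply: (le_trans (phi_le _ _ _)); rewrite footK.
case: z Dz => x v Dz/=; have Vv : V v by case: Dz.
by apply: le_trans (h_le x r0 rh Vv); apply: clamp_leu; apply: w_ge0.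
Qed.

Let pairing_phi t n : pairing V0 extend (phi_ t n) t =
  expR (2 * t) * \int[mu]_(z in D) (`|extend t z| * clamp n (w z)).
Proof.
congr (_ * _); apply: eq_Rintegral => z Dz.
rewrite /transport /phi_ footK subrr scale0r addr0 -surjective_pairing patchE Dz.
by rewrite mulrA [extend t z * _]mulrC -normrEsg.
Qed.

(** At time s the test function has modulus at most w(x + h v, v), to which [w_shift] applies. *)
Let pairing_phi_le s h n : 0 < h -> h <= h0 -> pairing V0 extend (phi_ (s + h) n) s <=
  expR (2 * s) * (weighted_mass s + h * \int[mu]_(z in D) (`|extend s z| * slope z)).
Proof.
move=> h_gt0 hh0; rewrite /pairing ler_wpM2l ?expR_ge0//.
rewrite -(RintegralZl _ mD (hS.1 s)) /weighted_mass.
rewrite -(RintegralD mD (hN.1 s) (RintegrableZ mD h (hS.1 s))).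
have mt := measurable_transport s (mphi_ (s + h) n).
apply: le_Rintegral; first exact: mD.
- apply: (RintegrableM mD (L1_continuous_extend.1 s) (measurable_funTS mt) (c := n%:R)) => z _.
  exact: phi_le_n.
- exact: (RintegrableD mD (hN.1 s) (RintegrableZ mD h (hS.1 s))).
move=> z Dz; apply: (le_trans (ler_norm _)); rewrite normrM.
rewrite mulrCA -mulrDr ler_wpM2l//; apply: (le_trans (phi_le _ _ _)); rewrite footK.
rewrite [s + h - s]addrAC subrr add0r.
case: z Dz => x v Dz/=; have Vv : V v by case: Dz.
by apply: le_trans (w_shift x h_gt0 hh0 Vv); apply: clamp_leu; apply: w_ge0.
Qed.

(** At the intermediate time r the test function is at most (1 + kappa h) w in modulus, and
    positivity of the gain transfers this bound. *)
Let gain_phi_le s h n r : 0 < h -> h <= h0 -> s <= r <= s + h ->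
  gain_pairing chi V0 extend (phi_ (s + h) n) r <=
  expR (2 * r) * ((1 + kappa * h) * weighted_gain r).
Proof.
move=> h_gt0 hh0 /andP[sr rh]; rewrite /gain_pairing ler_wpM2l ?expR_ge0//.
rewrite /weighted_gain -(RintegralZl _ mD (hQ.1 r)).
have mt := measurable_transport r (mphi_ (s + h) n).
have tn z : D z -> `|transport (phi_ (s + h) n) r z| <= n%:R by move=> _; exact: phi_le_n.
apply: le_Rintegral; first exact: mD.
- exact: (RintegrableM mD (L1_continuous_extend.1 r)
    (measurable_funTS (measurable_gain_adj chi V0 mt)) (gain_adj_le chi_gt0 chi_lt1 volV mt tn)).
- exact: (RintegrableZ mD _ (hQ.1 r)).
move=> z Dz; apply: (le_trans (ler_norm _)); rewrite normrM mulrCA ler_wpM2l//.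
rewrite -gw_scale.
apply: (gain_adj_mono chi_gt0 chi_lt1 volV mt _ tn) => //.
- by apply: measurable_funM.
- by move=> x; exact: (RintegrableZ mV _ (wV x)).
move=> z' Dz'; have r1 : 0 <= s + h - r by lra.
have r2 : s + h - r <= h0 by lra.
apply: (le_trans (transport_phi_le n r1 r2 Dz')); rewrite ler_wpM2r ?w_ge0// lerD2l.
by rewrite ler_wpM2l//; lra.
Qed.

Let integrable_gain_bound s t (k : R) :
  leb.-integrable `[s, t] (EFin \o (fun r => expR (2 * r) * (k * weighted_gain r))).
Proof.
apply: continuous_integrable_itv => r; apply: cvgM; first exact: continuous_expR2.
by apply: cvgM; [exact: cvg_cst|exact: continuous_weighted_gain].
Qed.

(** Duhamel's formula for the n-th test function, with bounds independent of n; its left side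
    converges by domination as n -> oo. *)
Lemma weighted_duhamel s h : 0 <= s -> 0 < h -> h <= h0 ->
  expR (2 * (s + h)) * weighted_mass (s + h) <=
  expR (2 * s) * (weighted_mass s + h * \int[mu]_(z in D) (`|extend s z| * slope z)) +
  \int[leb]_(r in `[s, s + h]) (expR (2 * r) * ((1 + kappa * h) * weighted_gain r)).
Proof.
move=> s0 h_gt0 hh0; set rhs := (X in _ <= X).
have bound n : expR (2 * (s + h)) * \int[mu]_(z in D) (`|extend (s + h) z| * clamp n (w z)) <= rhs.
  have [mG dE] := duhamel_extend (mphi_ (s + h) n) (phi_le_n (s + h) n).
  have sh : s < s + h by lra.
  have := dE _ _ s0 sh; rewrite pairing_phi => e.
  have le1 := pairing_phi_le s n h_gt0 hh0.
  have le2 : \int[leb]_(r in `[s, s + h]) gain_pairing chi V0 extend (phi_ (s + h) n) r <=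
     \int[leb]_(r in `[s, s + h]) (expR (2 * r) * ((1 + kappa * h) * weighted_gain r)).
    apply: le_Rintegral.
    - exact: measurable_itv.
    - exact: (integrable_gain_pairing chi_gt0 chi_lt1 volV L1_continuous_extend
        (mphi_ (s + h) n) (fun z _ => phi_le_n (s + h) n z) mG).
    - exact: integrable_gain_bound.
    - by move=> r; rewrite /= in_itv/= => hr; exact: gain_phi_le.
  rewrite -[leLHS](subrK (pairing V0 extend (phi_ (s + h) n) s)) e addrC.
  exact: lerD le1 le2.
have cv : expR (2 * (s + h)) * \int[mu]_(z in D) (`|extend (s + h) z| * clamp n (w z))
    @[n --> \oo] --> expR (2 * (s + h)) * weighted_mass (s + h).
  apply: cvgM; first exact: cvg_cst.
  apply: (Rintegral_dominated_cvg mD (g := fun z => `|extend (s + h) z| * w z)).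
  - move=> n; apply: measurable_funM.
      exact: Rintegrable_measurable (Rintegrable_norm (L1_continuous_extend.1 _)).
    by apply: measurable_funTS; apply: (measurableT_comp (measurable_clamp n)).
  - exact: Rintegrable_measurable (hN.1 _).
  - by move=> z Dz; apply: cvgM; [exact: cvg_cst|apply: cvg_clamp; exact: w_ge0].
  - exact: hN.1.
  - move=> n z Dz; rewrite normrM normr_id (ger0_norm (clamp_ge0 _ _)) ler_wpM2l//.
    by apply: clamp_leu; exact: w_ge0.
rewrite -(cvg_lim (@norm_hausdorff _ R) cv).
by apply: limr_le; [exact: cvgP cv|exact: nearW].
Qed.

Let mass t := \int[mu]_(z in D) `|extend t z|.

(** Pointwise, the adjoint gain minus 2 w is the adjoint collision of w, so this is [lyap]
    integrated against |f|. *)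
Let mass_balance s : (\int[mu]_(z in D) (`|extend s z| * slope z)) + weighted_gain s -
  2 * weighted_mass s <= - a * weighted_mass s + b * mass s.
Proof.
have iE := Rintegrable_norm (L1_continuous_extend.1 s).
rewrite /weighted_gain /weighted_mass /mass.
rewrite -(RintegralZl _ mD (hN.1 s)) -(RintegralD mD (hS.1 s) (hQ.1 s)).
rewrite -(RintegralB mD (RintegrableD mD (hS.1 s) (hQ.1 s)) (RintegrableZ mD 2 (hN.1 s))).
rewrite -(RintegralZl _ mD (hN.1 s)) -(RintegralZl _ mD iE).
rewrite -(RintegralD mD (RintegrableZ mD (- a) (hN.1 s)) (RintegrableZ mD b iE)).
apply: le_Rintegral; first exact: mD.
- exact: (RintegrableB mD (RintegrableD mD (hS.1 s) (hQ.1 s)) (RintegrableZ mD 2 (hN.1 s))).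
- exact: (RintegrableD mD (RintegrableZ mD (- a) (hN.1 s)) (RintegrableZ mD b iE)).
move=> z Dz; have le := ler_wpM2l (normr_ge0 (extend s z)) (lyap Dz).
rewrite gwE [leLHS](_ : _ =
  `|extend s z| * (slope z + rate chi z * (velocity_mean vol V w z.1 - w z))); last by ring.
by apply: (le_trans le); rewrite le_eqVlt; apply/orP; left; apply/eqP; ring.
Qed.

Lemma weighted_mass_barrier B :
  (forall s, 0 <= s -> B <= weighted_mass s -> - a * weighted_mass s + b * mass s <= 0) ->
  forall t, 0 <= t -> weighted_mass t <= Num.max B (weighted_mass 0).
Proof.
apply: (dini_barrier continuous_weighted_mass) => s s0 e e0.
have N0 t : 0 <= weighted_mass t.
  by apply: Rintegral_ge0 => z Dz; rewrite mulr_ge0 ?w_ge0.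
have [del del0 hdel] := dini_of_duhamel continuous_weighted_mass continuous_weighted_gain
  N0 kappa_ge0 h0_gt0 (fun h => @weighted_duhamel s h s0) e0.
exists del => // h hp hd; apply: (le_trans (hdel h hp hd)).
by rewrite lerD2l ler_wpM2l ?(ltW hp)// lerD2r; exact: mass_balance.
Qed.

End weighted.

(** The weight 1 is annihilated by transport and by the adjoint collision, so slope, a and b are 0;
    the initial mass serves as the barrier. *)
Lemma mass_nonincreasing t : 0 <= t ->
  \int[mu]_(z in D) `|extend t z| <= \int[mu]_(z in D) `|extend 0 z|.
Proof.
move=> t0.
have mass1 s : \int[mu]_(z in D) `|extend s z| = weighted_mass (cst 1) s.
  by apply: eq_Rintegral => z _; rewrite mulr1.
have m1 z : 1 <= 1 * m z by rewrite mul1r; exact: exp_weight_ge1.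
have : weighted_mass (cst 1) t <=
    Num.max (weighted_mass (cst 1) 0) (weighted_mass (cst 1) 0).
  apply: (@weighted_mass_barrier (cst 1) (cst 0) 1 0 0 0 1) => //.
  - by move=> z _; rewrite normr0 mulr_ge0// ltW// exp_weight_gt0.
  - by move=> z _; rewrite mul0r.
  - by move=> h x v _ _ _; rewrite mulr0 addr0.
  - move=> z _; rewrite /velocity_mean Rintegral_cst; last exact: measurable_V.
    by rewrite [X in fine X](_ : _ = 1%E)//=; lra.
  - by move=> s _ _; rewrite oppr0 !mul0r addr0.
by rewrite maxxx -!mass1.
Qed.

End weighted_masses.

(** * The estimate for the tilted weight and the bound on the semigroup *)

Section weighted_estimate.
Context {R : realType} {d : nat}.
Variables chi V0 gamma A : R.
Hypotheses (chi_gt0 : 0 < chi) (chi_lt1 : chi < 1) (V0_gt0 : 0 < V0).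
Hypothesis volV : lebesgue_rV d (velocities V0) = 1%E.
Hypotheses (A_gt0 : 0 < A) (lower : forall x : 'rV[R]_d, A * enorm x <= mean_abs_dotp V0 x).
Local Notation a0 := ((1 - chi) * (chi / 2) * A).
Local Notation B := (16 * V0 ^+ 2 + a0).
Hypotheses (gamma_gt0 : 0 < gamma) (gamma_small : gamma * (2 + 4 * V0 + 6 * V0 ^+ 2) <= 1).
Hypothesis gamma_small' : gamma * (14 * V0 ^+ 2) <= a0.
Local Notation X := ('rV[R]_d * 'rV[R]_d)%type.
Local Notation D := (@phase R d V0).
Local Notation mu := (@dxdv R d).
Local Notation m := (exp_weight gamma : X -> R).
Local Notation mt := (weight chi gamma : X -> R).
Local Notation mD := (@measurable_phase R d V0).

Let a0_gt0 : 0 < a0.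
Proof. by rewrite !mulr_gt0 ?subr_gt0 ?invr_gt0. Qed.

Let B_gt0 : 0 < B.
Proof. by rewrite ltr_wpDl// mulr_ge0 ?sqr_ge0. Qed.

(* The quotient of the two constants in [lyapunov]: the weighted mass decreases as
   long as it exceeds mass_ratio times the mass. *)
Definition mass_ratio : R := B * 8 / a0 * expR (gamma * (4 * B / a0)).

Lemma mass_ratio_gt0 : 0 < mass_ratio.
Proof. by rewrite mulr_gt0 ?expR_gt0// divr_gt0// mulr_gt0. Qed.

Lemma weight_equiv (z : X) : D z -> 2^-1 * m z <= mt z <= 2 * m z.
Proof. by case=> _ /ltW; exact: (weight_bounds chi_gt0 chi_lt1 V0_gt0 gamma_gt0 gamma_small). Qed.

Let mt_ge0 (z : X) : D z -> 0 <= mt z.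
Proof.
move=> Dz; have /andP[+ _] := weight_equiv Dz; apply: le_trans.
by rewrite mulr_ge0// ltW// exp_weight_gt0.
Qed.

Lemma Rintegrable_L1 (g : X -> R) : L1 V0 m g -> mu.-integrable D (EFin \o g).
Proof.
move=> gi; apply: (@le_Rintegrable _ _ _ _ _ mD _ (fun z => `|m z * g z|)).
- rewrite (_ : g = fun z => (m z)^-1 * (m z * g z)).
    apply: measurable_funM; last exact: Rintegrable_measurable gi.
    by apply: measurable_funTS; exact: measurable_exp_weightV.
  by apply/funext => z; rewrite mulKf// gt_eqF// exp_weight_gt0.
- move=> z _; rewrite normrM ler_peMl// ger0_norm ?(ltW (exp_weight_gt0 _ _))//.
  exact: exp_weight_ge1.
- exact: Rintegrable_norm.
Qed.

Lemma Rintegrable_L1_weight (g : X -> R) : L1 V0 m g ->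
  mu.-integrable D (EFin \o (fun z => `|g z| * mt z)).
Proof.
move=> gi; apply: (@le_Rintegrable _ _ _ _ _ mD _ (fun z => 2 * `|m z * g z|)).
- apply: measurable_funM; first exact: Rintegrable_measurable (Rintegrable_norm (Rintegrable_L1 gi)).
  by apply: measurable_funTS; exact: measurable_weight.
- move=> z Dz; have /andP[_ h] := weight_equiv Dz.
  rewrite normrM normr_id (ger0_norm (mt_ge0 Dz)) normrM (ger0_norm (ltW (exp_weight_gt0 _ _))).
  by have := ler_wpM2l (normr_ge0 (g z)) h; lra.
- exact/(RintegrableZ mD)/Rintegrable_norm.
Qed.

Section solution.
Variables (f0 : X -> R) (f : R -> X -> R).
Hypothesis wf : weak_solution chi V0 m f0 f.

Lemma Rintegral_weight_le t : 0 <= t -> \int[mu]_(z in D) (`|f t z| * mt z) <=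
  Num.max (mass_ratio * \int[mu]_(z in D) `|f 0 z|) (\int[mu]_(z in D) (`|f 0 z| * mt z)).
Proof.
have e0 s : 0 <= s -> extend f s = f s by move=> s0; rewrite /extend max_r.
move=> t0; rewrite -[f t]e0// -[f 0]e0//.
(* The constant of [weight_slope_bound]. The constant 2 + k bounds both the weight (by 2 m) and its
   slope (by k m). *)
pose k := 2 * V0 + 21 * V0 ^+ 2.
have k0 : 0 <= k by rewrite addr_ge0 ?mulr_ge0 ?sqr_ge0 ?(ltW V0_gt0).
have mg z : 0 <= m z by rewrite ltW// exp_weight_gt0.
apply: (@weighted_mass_barrier _ _ _ _ _ chi_gt0 chi_lt1 V0_gt0 gamma_gt0 volV _ _ wf
  mt (weight_slope chi V0 gamma) (2 + k) (2 * k) (gamma * a0 / 8)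
  (gamma * B * expR (gamma * (4 * B / a0))) gamma) => //.
- exact: measurable_weight.
- exact: measurable_weight_slope.
- move=> z Dz; have /andP[_ /le_trans] := weight_equiv Dz; apply.
  by rewrite ler_wpM2r// lerDl.
- move=> z [_ /ltW Dz].
  apply: (le_trans (weight_slope_bound chi_gt0 chi_lt1 V0_gt0 gamma_gt0 gamma_small Dz)).
  by rewrite ler_wpM2r// lerDr.
- by rewrite mulr_ge0.
- move=> z [_ /ltW Dz].
  exact: (weight_slope_le chi_gt0 chi_lt1 V0_gt0 gamma_gt0 gamma_small Dz).
- move=> h x v h0 hg /ltW Vv.
  exact: (weight_shift chi_gt0 chi_lt1 V0_gt0 gamma_gt0 gamma_small).
- move=> [x v] [_ /ltW Vv].
  exact: (lyapunov chi_gt0 chi_lt1 V0_gt0 volV A_gt0 lower gamma_gt0 gamma_small x gamma_small' Vv).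
move=> s s0; set N := weighted_mass _ _ _ _ => leN.
have Ms := mass_nonincreasing chi_gt0 chi_lt1 V0_gt0 gamma_gt0 volV wf s0.
set E := expR _; have E0 : 0 < E by exact: expR_gt0.
(* [mass_ratio] is b / a, so above the barrier the decay a N exceeds b times the initial mass, hence
   b times the current mass. *)
have bMs : gamma * B * E * (\int[mu]_(z in D) `|extend f s z|) <= gamma * a0 / 8 *
    (mass_ratio * \int[mu]_(z in D) `|extend f 0 z|).
  rewrite [leRHS](_ : _ = gamma * B * E * (\int[mu]_(z in D) `|extend f 0 z|)).
    by rewrite ler_wpM2l// !mulr_ge0 ?ltW.
  rewrite /mass_ratio -/E; move: (lt0r_neq0 a0_gt0); move: a0 B => u v u0; by field.
have p0 : 0 <= gamma * a0 / 8 by rewrite divr_ge0// mulr_ge0// ltW.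
by have := ler_wpM2l p0 leN; lra.
Qed.

Lemma integral_weight_le t : L1 V0 m f0 -> 0 <= t ->
  (\int[mu]_(z in D) (`|f t z| * mt z)%:E <=
    maxe (mass_ratio%:E * \int[mu]_(z in D) `|f0 z|%:E)
         (\int[mu]_(z in D) (`|f0 z| * mt z)%:E))%E.
Proof.
move=> f0L t0; have fL := sol_L1 wf t0; have f00 := sol_L1 wf (lexx 0).
have init (h : R -> X -> R) : 
    mu.-integrable D (EFin \o (fun z => h (f0 z) z)) ->
    mu.-integrable D (EFin \o (fun z => h (f 0 z) z)) ->
    (\int[mu]_(z in D) (h (f0 z) z)%:E = \int[mu]_(z in D) (h (f 0 z) z)%:E)%E.
  move=> i1 i2; apply: (ae_eq_integral (D := D)).
  - exact: mD.
  - by case/integrableP: i1.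
  - by case/integrableP: i2.
  by apply: filterS (sol_init wf) => z fz Dz /=; rewrite fz.
have I0 := Rintegrable_norm (Rintegrable_L1 f0L).
have J0 := Rintegrable_norm (Rintegrable_L1 f00).
have IW := Rintegrable_L1_weight f0L; have JW := Rintegrable_L1_weight f00.
rewrite (init (fun (y : R) _ => `|y|) I0 J0) (init (fun (y : R) z => `|y| * mt z) IW JW).
rewrite (Rintegrable_fin mD (Rintegrable_L1_weight fL)) (Rintegrable_fin mD J0) (Rintegrable_fin mD JW).
by rewrite -EFinM -EFin_max lee_fin; exact: Rintegral_weight_le.
Qed.

(** The outer 2 undoes the comparison m / 2 <= weight; inside, the mass is at most the m-norm since
    m >= 1, and the weighted mass at most twice the m-norm. *)
Lemma L1norm_solution_le t : L1 V0 m f0 -> 0 <= t ->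
  (L1norm V0 m (f t) <= (2 * Num.max mass_ratio 2)%:E * L1norm V0 m f0)%E.
Proof.
move=> f0L t0; have fL := sol_L1 wf t0.
have low : (L1norm V0 m (f t) <= 2%:E * \int[mu]_(z in D) (`|f t z| * mt z)%:E)%E.
  rewrite /L1norm (Rintegrable_fin mD (Rintegrable_norm fL)).
  rewrite (Rintegrable_fin mD (Rintegrable_L1_weight fL)) -EFinM lee_fin.
  have iW := Rintegrable_L1_weight fL.
  rewrite -(RintegralZl _ mD iW); apply: le_Rintegral; first exact: mD.
  - exact: Rintegrable_norm.
  - exact: (RintegrableZ mD 2 iW).
  move=> z Dz; have /andP[h _] := weight_equiv Dz.
  rewrite normrM (ger0_norm (ltW (exp_weight_gt0 _ _))).
  by have := ler_wpM2l (normr_ge0 (f t z)) h; lra.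
apply: (le_trans low); rewrite EFinM -muleA lee_pmul2l//.
apply: (le_trans (integral_weight_le f0L t0)).
have IW := Rintegrable_L1_weight f0L.
have I0 := Rintegrable_norm (Rintegrable_L1 f0L).
rewrite /L1norm (Rintegrable_fin mD I0) (Rintegrable_fin mD IW) (Rintegrable_fin mD (Rintegrable_norm f0L)).
rewrite -!EFinM -EFin_max lee_fin; set K := \int[mu]_(z in D) `|m z * f0 z|.
have K0 : 0 <= K by apply: Rintegral_ge0.
rewrite ge_max; apply/andP; split.
  apply: (@le_trans _ _ (mass_ratio * K)); last by rewrite ler_wpM2r// le_max lexx.
  rewrite ler_wpM2l ?(ltW mass_ratio_gt0)//; apply: le_Rintegral; first exact: mD.
  - exact: I0.
  - exact: Rintegrable_norm f0L.
  move=> z _; rewrite normrM ler_peMl// ger0_norm ?(ltW (exp_weight_gt0 _ _))//.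
  exact: exp_weight_ge1.
apply: (@le_trans _ _ (2 * K)); last by rewrite ler_wpM2r// le_max lexx orbT.
rewrite -(RintegralZl _ mD (Rintegrable_norm f0L)); apply: le_Rintegral; first exact: mD.
- exact: IW.
- exact: (RintegrableZ mD 2 (Rintegrable_norm f0L)).
move=> z Dz; have /andP[_ h] := weight_equiv Dz.
rewrite normrM (ger0_norm (ltW (exp_weight_gt0 _ _))).
by have := ler_wpM2l (normr_ge0 (f0 z)) h; lra.
Qed.

End solution.

Lemma opnorm_S_L_le t : 0 <= t ->
  (opnorm V0 m (S_L chi V0 m t) <= (2 * Num.max mass_ratio 2)%:E)%E.
Proof.
move=> t0; have K0 : 0 <= 2 * Num.max mass_ratio 2.
  by rewrite mulr_ge0// le_max ler0n orbT.
apply: ge_ereal_sup => _ [g [gL g1] <-]; rewrite /S_L; case: xgetP => [f _ wf|_].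
  apply: (le_trans (L1norm_solution_le wf gL t0)).
  by rewrite -[leRHS]mule1 lee_wpmul2l// lee_fin.
(* The default value of [xget] is the zero function, of norm 0. *)
rewrite /L1norm integral0_eq ?lee_fin// => z _.
by rewrite /= mulr0 normr0.
Qed.

End weighted_estimate.

Theorem lemma2 (R : realType) (d : nat) (chi V0 : R)
  (d_ge1 : (1 <= d)%N) (chi_gt0 : 0 < chi) (chi_lt1 : chi < 1)
  (V0_gt0 : 0 < V0) (volV : lebesgue_rV d (velocities V0) = 1%E) :
  exists2 gamma_star : R, 0 < gamma_star &
  forall gamma : R, 0 < gamma -> gamma < gamma_star ->
  let m : 'rV[R]_d * 'rV[R]_d -> R := exp_weight gamma in
  (exists (mt : 'rV[R]_d * 'rV[R]_d -> R) (c1 c2 C : R),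
    [/\ measurable_fun (phase V0) mt,
        0 < c1 <= c2,
        forall z, phase V0 z ->
          c1 * m z <= mt z <= c2 * m z,
        0 < C &
        forall (f0 : 'rV[R]_d * 'rV[R]_d -> R)
               (f : R -> 'rV[R]_d * 'rV[R]_d -> R),
          L1 V0 m f0 ->
          weak_solution chi V0 m f0 f ->
          forall t : R, 0 <= t ->
          (\int[dxdv]_(z in phase V0) (`|f t z| * mt z)%:E
           <= maxe (C%:E * \int[dxdv]_(z in phase V0) `|f0 z|%:E)
                   (\int[dxdv]_(z in phase V0) (`|f0 z| * mt z)%:E))%E]) /\
  (ereal_sup [set opnorm V0 m (S_L chi V0 m t) | t in [set t : R | (0 <= t)%R]] < +oo)%E.
Proof.
have [A A_gt0 lower] := mean_abs_dotp_lower volV.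
(* gamma p <= 1 makes the weight comparable to m and controls its expansion along the flow; gamma q
   <= a0 lets the decay rate absorb the errors in gamma. *)
pose p := 2 + 4 * V0 + 6 * V0 ^+ 2; pose q := 14 * V0 ^+ 2.
pose a0 := (1 - chi) * (chi / 2) * A.
have V2 : 0 < V0 ^+ 2 by rewrite exprn_gt0.
have p_gt0 : 0 < p by rewrite /p; lra.
have q_gt0 : 0 < q by rewrite mulr_gt0.
have a0_gt0 : 0 < a0 by rewrite !mulr_gt0 ?subr_gt0 ?invr_gt0.
exists (Num.min p^-1 (a0 / q)); first by rewrite lt_min invr_gt0 p_gt0 divr_gt0.
move=> gamma gamma_gt0; rewrite lt_min => /andP[/ltW gp /ltW gq].
have small1 : gamma * p <= 1 by rewrite -ler_pdivlMr// mul1r.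
have small2 : gamma * q <= a0 by rewrite -ler_pdivlMr.
move=> m; split.
  exists (weight chi gamma), 2^-1, 2, (mass_ratio chi V0 gamma A); split.
  - by apply: measurable_funTS; exact: measurable_weight.
  - by rewrite invr_gt0 ltr0n/=; lra.
  - move=> z; exact: weight_equiv.
  - exact: mass_ratio_gt0.
  - move=> f0 f f0L wf t t0.
    exact: (integral_weight_le chi_gt0 chi_lt1 V0_gt0 volV A_gt0 lower gamma_gt0 small1 small2 wf).
apply: (@le_lt_trans _ _ (2 * Num.max (mass_ratio chi V0 gamma A) 2)%:E); last exact: ltry.
apply: ge_ereal_sup => _ [t t0 <-].
exact: (opnorm_S_L_le chi_gt0 chi_lt1 V0_gt0 volV A_gt0 lower gamma_gt0 small1 small2).
Qed.
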